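(* Let $X$ and $Y$ be smooth projective varieties of dimension $n$, and let $\pi:X\to Y$ be a (potentially ramified) finite covering. Let $\Delta(B)$ be the collection of irreducible components of the branch locus (on $Y$) and $\Delta(R)=\pi^{-1}(\Delta(B))$ the collection of (reduced) irreducible components of the ramification locus (on $X$). Suppose that $\Delta(R)$ and $\Delta(B)$ consist of simple normal crossing divisors. Then $$\pi^*\big(\Omega^1_Y(\log\Delta(B))\big)=\Omega^1_X(\log\Delta(R)).$$
   Context: Varieties are irreducible, over an algebraically closed field of characteristic $0$. $\Omega^1_X(\log\Delta)$ denotes the logarithmic cotangent bundle of $X$ relative to a collection of divisors $\Delta$ with simple normal crossings. The ''ramification locus'' is by convention $\pi^{-1}(B)$ with $B$ the branch locus, so $\Delta(R)$ contains every irreducible component (with reduced structure) of $\pi^{-1}(B)$, even those along which $\pi$ is unramified. Equality means that the two bundles are identified by the natural pullback of logarithmic differential forms. *)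

(* Defs.v *)
From HB Require Import structures.
From mathcomp Require Import all_boot all_order all_algebra.
From mathcomp Require Import generic_quotient ring.
From mathcomp Require Import boolp classical_sets.
From mathcomp Require Import mpoly.

Set Implicit Arguments.
Unset Strict Implicit.
Unset Printing Implicit Defensive.

Import GRing.Theory.
Local Open Scope ring_scope.
Local Open Scope classical_set_scope.
Local Open Scope quotient_scope.

(** Varieties are sets of closed points.  A point of P^N is a line of k^(N+1),
    and homogeneous polynomials are evaluated at the generator [vpick] of that
    line, so only their vanishing, and quotients of two of them of the same
    degree, are meaningful. *)

Section ProjectiveSpace.
Variable k : closedFieldType.

Definition proj_space (N : nat) : Type :=
  {L : {vspace 'rV[k]_N.+1} | \dim L == 1%N}.

Definition heval N (x : proj_space N) (p : {mpoly k[N.+1]}) : k :=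
  p.@[fun i => vpick (val x) 0 i].

Definition zariski_closed N (Z : set (proj_space N)) : Prop :=
  exists T : set {mpoly k[N.+1]},
    (forall p, T p -> exists d, p \is d.-homog) /\
    (forall x, Z x <-> forall p, T p -> heval x p = 0).

Definition zariski_open_in N (S U : set (proj_space N)) : Prop :=
  exists2 Z, zariski_closed Z & U = S `\` Z.

Definition irreducible_set N (S : set (proj_space N)) : Prop :=
  S !=set0 /\
  forall A B, zariski_closed A -> zariski_closed B ->
    S `<=` A `|` B -> S `<=` A \/ S `<=` B.

(** For [S] closed. *)
Definition irreducible_component N (S D : set (proj_space N)) : Prop :=
  [/\ zariski_closed D, irreducible_set D, D `<=` S &
      forall D', zariski_closed D' -> irreducible_set D' ->
        D `<=` D' -> D' `<=` S -> D' = D].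

(** A map is regular on [S] when around each point of [S] it is given by forms
    of one degree; the values of [u] outside [S] are irrelevant. *)
Definition regular_map N M (S : set (proj_space N)) (T : set (proj_space M))
    (u : proj_space N -> proj_space M) : Prop :=
  (forall x, S x -> T (u x)) /\
  forall x, S x -> exists (d : nat) (F : 'I_M.+1 -> {mpoly k[N.+1]}),
    let Fval z := \row_i heval z (F i) in
    [/\ forall i, F i \is d.-homog, Fval x != 0 &
        forall z, S z -> Fval z != 0 -> val (u z) = <[Fval z]>%VS].

Definition isomorphic_sets N M (S : set (proj_space N))
    (T : set (proj_space M)) : Prop :=
  exists u v, [/\ regular_map S T u, regular_map T S v,
    forall x, S x -> v (u x) = x & forall y, T y -> u (v y) = y].

Definition affine_space m : set (proj_space m) :=
  [set z | heval z 'X_ord0 != 0].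

Definition is_affine N (U : set (proj_space N)) : Prop :=
  exists m (Z : set (proj_space m)),
    zariski_closed Z /\ isomorphic_sets U (Z `&` @affine_space m).

End ProjectiveSpace.

Record proj_variety (k : closedFieldType) := ProjVariety {
  ambient : nat;
  points : set (proj_space k ambient);
  pv_closed : zariski_closed points;
  pv_irreducible : irreducible_set points
}.

Arguments points {k} X _ : rename.

Definition ambient_space (k : closedFieldType) (X : proj_variety k) : Type :=
  proj_space k (ambient X).

(** The function field: fractions [num / den] of forms of one degree, [den] not
    vanishing identically on [X], up to equality on [X]. *)

Section FunctionField.
Variables (k : closedFieldType) (X : proj_variety k).
Local Notation P := {mpoly k[(ambient X).+1]}.

Definition frac_pair (a : P * P) : bool :=
  `[< (exists d, a.1 \is d.-homog /\ a.2 \is d.-homog) /\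
      exists2 x, points X x & heval x a.2 != 0 >].

Definition frac : Type := {a : P * P | frac_pair a}.
HB.instance Definition _ := Choice.on frac.

Definition mk_frac a (h : frac_pair a) : frac := Sub a h.
Definition num (a : frac) : P := (val a).1.
Definition den (a : frac) : P := (val a).2.

Definition frac_eq (a b : frac) : bool :=
  `[< forall x, points X x ->
      heval x (num a) * heval x (den b) = heval x (num b) * heval x (den a) >].

Lemma hevalD N (x : proj_space k N) : {morph heval x : p q / p + q}.
Proof. exact: mevalD. Qed.
Lemma hevalN N (x : proj_space k N) : {morph heval x : p / - p}.
Proof. exact: mevalN. Qed.
Lemma hevalM N (x : proj_space k N) : {morph heval x : p q / p * q}.
Proof. exact: mevalM. Qed.
Lemma hevalC N (x : proj_space k N) c : heval x c%:MP = c.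
Proof. exact: mevalC. Qed.
Lemma heval1 N (x : proj_space k N) : heval x 1 = 1.
Proof. exact: meval1. Qed.

Lemma fracP (a : frac) :
  exists d, [/\ num a \is d.-homog, den a \is d.-homog &
                exists2 x, points X x & heval x (den a) != 0].
Proof.
by have /asboolP[[d [hn hd]] hx] := valP a; exists d.
Qed.

Lemma closed_hypersurface N (p : {mpoly k[N.+1]}) d :
  p \is d.-homog -> zariski_closed [set x : proj_space k N | heval x p = 0].
Proof.
move=> hp; exists [set p]; split=> [_ ->|x]; first by exists d.
by split=> [/= px _ ->|]; last exact.
Qed.

(** The homogeneous ideal of [X] is prime. *)
Lemma vanishing_prime (p q : P) d e : p \is d.-homog -> q \is e.-homog ->
  (forall x, points X x -> heval x p * heval x q = 0) ->
  (forall x, points X x -> heval x p = 0) \/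
  (forall x, points X x -> heval x q = 0).
Proof.
move=> hp hq pq0; have [_ irr] := pv_irreducible X.
apply: (irr _ _ (closed_hypersurface hp) (closed_hypersurface hq)) => x Xx /=.
by move/eqP: (pq0 x Xx); rewrite mulf_eq0 => /orP[]/eqP; [left|right].
Qed.

Lemma vanishing_cancel (p q : P) d e : p \is d.-homog -> q \is e.-homog ->
  (exists2 x, points X x & heval x q != 0) ->
  (forall x, points X x -> heval x p * heval x q = 0) ->
  forall x, points X x -> heval x p = 0.
Proof.
move=> hp hq [y Xy qy] /(vanishing_prime hp hq)[//|q0].
by rewrite (q0 y Xy) eqxx in qy.
Qed.

Lemma frac_eq_refl : reflexive frac_eq.
Proof. by move=> a; apply/asboolP. Qed.

Lemma frac_eq_sym : ssrbool.symmetric frac_eq.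
Proof. by move=> a b; apply/asboolP/asboolP => h x Xx; rewrite h. Qed.

Lemma frac_eq_trans : transitive frac_eq.
Proof.
move=> b a c /asboolP ab /asboolP bc; apply/asboolP => x Xx.
have [da [na ea _]] := fracP a; have [dc [nc ec _]] := fracP c.
have [db [nb eb hb]] := fracP b.
have hp : num a * den c - num c * den a \is (da + dc).-homog.
  by rewrite rpredB ?(dhomogM na ec) // addnC dhomogM.
apply/eqP; rewrite -subr_eq0 -!hevalM -hevalN -hevalD; apply/eqP.
apply: (vanishing_cancel hp eb hb) => // y Xy.
rewrite hevalD hevalN !hevalM.
have := ab y Xy; have := bc y Xy.
set n1 := heval y (num a); set n2 := heval y (num b); set n3 := heval y (num c).
set d1 := heval y (den a); set d2 := heval y (den b); set d3 := heval y (den c).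
move=> e1 e2.
rewrite mulrBl mulrAC e2 mulrAC e1; ring.
Qed.

Canonical frac_equiv := EquivRel frac_eq frac_eq_refl frac_eq_sym frac_eq_trans.

Definition ratfun : Type := {eq_quot frac_eq}.
HB.instance Definition _ := Choice.on ratfun.
HB.instance Definition _ := EqQuotient.on ratfun.

Definition ratio (a : frac) : ratfun := \pi_ratfun a.

Lemma ratioP (a b : frac) : (ratio a = ratio b) <->
  forall x, points X x ->
    heval x (num a) * heval x (den b) = heval x (num b) * heval x (den a).
Proof.
split=> [/eqP|h]; first by rewrite eqmodE => /asboolP.
by apply/eqP; rewrite eqmodE; apply/asboolP.
Qed.

Lemma ratio_surj (f : ratfun) : exists a, f = ratio a.
Proof. by exists (repr f); rewrite /ratio reprK. Qed.

Lemma den_mul_neq0 (a b : frac) :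
  exists2 x, points X x & heval x (den a * den b) != 0.
Proof.
have [da [_ ea ha]] := fracP a; have [db [_ eb [y Xy hy]]] := fracP b.
apply: contrapT => /forall2NP h; case/eqP: hy.
apply: (vanishing_cancel eb ea ha) => // x Xx; rewrite mulrC -hevalM.
by have [//|/negP/negPn/eqP] := h x.
Qed.

Lemma frac_add_subproof (a b : frac) :
  frac_pair (num a * den b + num b * den a, den a * den b).
Proof.
have [da [na ea _]] := fracP a; have [db [nb eb _]] := fracP b.
apply/asboolP; split; last exact: den_mul_neq0.
exists (da + db)%N; rewrite rpredD ?(dhomogM na eb) ?(dhomogM ea eb) //.
by rewrite addnC dhomogM.
Qed.
Definition frac_add a b : frac := mk_frac (frac_add_subproof a b).

Lemma frac_mul_subproof (a b : frac) :
  frac_pair (num a * num b, den a * den b).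
Proof.
have [da [na ea _]] := fracP a; have [db [nb eb _]] := fracP b.
apply/asboolP; split; last exact: den_mul_neq0.
by exists (da + db)%N; split; apply: dhomogM.
Qed.
Definition frac_mul a b : frac := mk_frac (frac_mul_subproof a b).

Lemma frac_opp_subproof (a : frac) : frac_pair (- num a, den a).
Proof.
have [da [na ea ha]] := fracP a; apply/asboolP; split => //.
by exists da; rewrite rpredN.
Qed.
Definition frac_opp a : frac := mk_frac (frac_opp_subproof a).

Lemma frac_const_subproof (c : k) : frac_pair (c%:MP, 1).
Proof.
apply/asboolP; split; first by exists 0%N;
  rewrite -[c%:MP]mulr1 mul_mpolyC rpredZ ?dhomog1.
have [[x Xx] _] := pv_irreducible X.
by exists x; rewrite // heval1 oner_neq0.
Qed.
Definition frac_const c : frac := mk_frac (frac_const_subproof c).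

Definition frac_inv (a : frac) : frac :=
  if pselect (frac_pair (den a, num a)) is left h then mk_frac h
  else frac_const 0.

Definition ratfun_const (c : k) : ratfun := ratio (frac_const c).
Definition ratfun_add (f g : ratfun) := ratio (frac_add (repr f) (repr g)).
Definition ratfun_mul (f g : ratfun) := ratio (frac_mul (repr f) (repr g)).
Definition ratfun_opp (f : ratfun) := ratio (frac_opp (repr f)).
Definition ratfun_inv (f : ratfun) := ratio (frac_inv (repr f)).

Lemma repr_ratio a x : points X x ->
  heval x (num (repr (ratio a))) * heval x (den a) =
  heval x (num a) * heval x (den (repr (ratio a))).
Proof. by move: x; apply/ratioP; rewrite /ratio reprK. Qed.

Lemma heval_frac_add a b x :
  (heval x (num (frac_add a b)) =
    heval x (num a) * heval x (den b) + heval x (num b) * heval x (den a)) *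
  (heval x (den (frac_add a b)) = heval x (den a) * heval x (den b)).
Proof. by rewrite hevalD !hevalM. Qed.

Lemma heval_frac_mul a b x :
  (heval x (num (frac_mul a b)) = heval x (num a) * heval x (num b)) *
  (heval x (den (frac_mul a b)) = heval x (den a) * heval x (den b)).
Proof. by rewrite !hevalM. Qed.

Lemma heval_frac_opp a x :
  (heval x (num (frac_opp a)) = - heval x (num a)) *
  (heval x (den (frac_opp a)) = heval x (den a)).
Proof. by rewrite hevalN. Qed.

Lemma heval_frac_const c x :
  (heval x (num (frac_const c)) = c) * (heval x (den (frac_const c)) = 1).
Proof. by rewrite hevalC heval1. Qed.

Definition heval_frac :=
  (heval_frac_add, heval_frac_mul, heval_frac_opp, heval_frac_const).

Lemma ratio_add a b :
  ratfun_add (ratio a) (ratio b) = ratio (frac_add a b).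
Proof.
apply/ratioP => x Xx; have e1 := repr_ratio a Xx; have e2 := repr_ratio b Xx.
by rewrite !heval_frac; ring: e1 e2.
Qed.

Lemma ratio_mul a b :
  ratfun_mul (ratio a) (ratio b) = ratio (frac_mul a b).
Proof.
apply/ratioP => x Xx; have e1 := repr_ratio a Xx; have e2 := repr_ratio b Xx.
by rewrite !heval_frac mulrACA e1 e2; ring.
Qed.

Lemma ratio_opp a : ratfun_opp (ratio a) = ratio (frac_opp a).
Proof.
by apply/ratioP => x Xx; rewrite !heval_frac !mulNr repr_ratio.
Qed.

Let ratioE := (ratio_add, ratio_mul, ratio_opp).

Ltac ratfun_ring :=
  repeat (let f := fresh "f" in move=> f; have [? ->] := ratio_surj f);
  rewrite /ratfun_const ?ratioE; apply/ratioP => x Xx;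
  rewrite !heval_frac; ring.

Lemma ratfun_addA : associative ratfun_add.
Proof. by ratfun_ring. Qed.
Lemma ratfun_addC : commutative ratfun_add.
Proof. by ratfun_ring. Qed.
Lemma ratfun_add0 : left_id (ratfun_const 0) ratfun_add.
Proof. by ratfun_ring. Qed.
Lemma ratfun_addN : left_inverse (ratfun_const 0) ratfun_opp ratfun_add.
Proof. by ratfun_ring. Qed.
Lemma ratfun_mulA : associative ratfun_mul.
Proof. by ratfun_ring. Qed.
Lemma ratfun_mulC : commutative ratfun_mul.
Proof. by ratfun_ring. Qed.
Lemma ratfun_mul1 : left_id (ratfun_const 1) ratfun_mul.
Proof. by ratfun_ring. Qed.
Lemma ratfun_mulDl : left_distributive ratfun_mul ratfun_add.
Proof. by ratfun_ring. Qed.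
Lemma ratfun_1neq0 : ratfun_const 1 != ratfun_const 0.
Proof.
apply/eqP => /ratioP h; have [[x Xx] _] := pv_irreducible X.
by have /eqP := h x Xx; rewrite !heval_frac mul0r mulr1 oner_eq0.
Qed.

HB.instance Definition _ := GRing.isZmodule.Build ratfun
  ratfun_addA ratfun_addC ratfun_add0 ratfun_addN.
HB.instance Definition _ := GRing.Zmodule_isComNzRing.Build ratfun
  ratfun_mulA ratfun_mulC ratfun_mul1 ratfun_mulDl ratfun_1neq0.

Lemma ratfun_mulV (f : ratfun) : f != 0 -> ratfun_inv f * f = 1.
Proof.
move=> f0; rewrite -[f in _ * f]reprK /ratfun_inv.
rewrite -[_ * _]/(ratfun_mul _ (ratio _)) ratio_mul /frac_inv.
have [d [hn hd hx]] := fracP (repr f).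
case: pselect => [h|[]].
  by apply/ratioP => x Xx; rewrite !heval_frac; ring.
apply/asboolP; split; first by exists d.
apply: contrapT => /forall2NP h; case/eqP: f0; rewrite -[f]reprK.
apply/ratioP => x Xx; rewrite !heval_frac mul0r mulr1.
by have [//|/negP/negPn/eqP] := h x.
Qed.

Lemma ratfun_inv0 : ratfun_inv 0 = 0.
Proof.
have n0 x : points X x -> heval x (num (repr (0 : ratfun))) = 0.
  move=> Xx; have := @repr_ratio (frac_const 0) x Xx.
  by rewrite !heval_frac mul0r mulr1.
rewrite /ratfun_inv /frac_inv; case: pselect => // h.
by have /asboolP[_ [x Xx /=]] := h; rewrite n0 ?eqxx.
Qed.

HB.instance Definition _ :=
  GRing.ComNzRing_isField.Build ratfun ratfun_mulV ratfun_inv0.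

End FunctionField.

Arguments ratfun_const {k} X c.

(** Subrings, ideals and modules are subsets of an ambient field or vector
    space. *)

Definition span (K : comNzRingType) (V : lmodType K) (R : set K) (G : set V) :
    set V :=
  [set v | exists m (a : 'I_m -> K) (g : 'I_m -> V),
    [/\ forall i, R (a i), forall i, G (g i) & v = \sum_i a i *: g i]].

Definition ideal_span (K : comNzRingType) (R I : set K) : set K :=
  @span K K^o R I.

Section BaseChange.
Variables (K L : comNzRingType) (R : set K) (S : set L) (phi : K -> L).
Variables (V : lmodType K) (W : lmodType L) (M : set V) (N : set W).
Variable p : V -> W.

Definition balanced (A : zmodType) (beta : L -> V -> A) : Prop :=
  [/\ forall a b m, S a -> S b -> M m ->
        beta (a + b) m = beta a m + beta b m,
      forall a m m', S a -> M m -> M m' ->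
        beta a (m + m') = beta a m + beta a m' &
      forall a r m, S a -> R r -> M m ->
        beta (a * phi r) m = beta a (r *: m)].

Definition tensor_factors (A : zmodType) (beta : L -> V -> A) (h : W -> A) :
    Prop :=
  (forall w w', N w -> N w' -> h (w + w') = h w + h w') /\
  (forall a m, S a -> M m -> h (a *: p m) = beta a m).

(** [S (x)_R M -> N, a (x) m |-> a *: p m] is well defined and bijective: [N],
    with this pairing, has the universal property of the tensor product. *)
Definition base_change_iso : Prop :=
  [/\ forall a m, S a -> M m -> N (a *: p m),
      balanced (fun a m => a *: p m) &
      forall (A : zmodType) (beta : L -> V -> A), balanced beta ->
        (exists h, tensor_factors beta h) /\
        (forall h h', tensor_factors beta h -> tensor_factors beta h' ->
           forall w, N w -> h w = h' w)].

End BaseChange.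

Section LocalRings.
Variables (k : closedFieldType) (X : proj_variety k).
Implicit Types (f g z : ratfun X) (x : ambient_space X) (c : k).

(** [f] is regular at the point [x] of [X], with value [c]. *)
Definition has_value f x c : Prop :=
  exists a : frac X, [/\ f = ratio a, heval x (den a) != 0 &
                         c = heval x (num a) / heval x (den a)].

Lemma has_value_unique f x c c' :
  points X x -> has_value f x c -> has_value f x c' -> c = c'.
Proof.
move=> Xx [a [-> da ->]] [b [/ratioP ab db ->]].
by apply/eqP; rewrite eqr_div // ab.
Qed.

Definition local_ring x : set (ratfun X) := [set f | exists c, has_value f x c].

Definition maximal_ideal x : set (ratfun X) := [set f | has_value f x 0].

Definition regular_on (U : set (ambient_space X)) : set (ratfun X) :=
  [set f | forall x, U x -> local_ring x f].

(** The ideal in the local ring at [x] of an irreducible closed [D] through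
    [x]. *)
Definition local_ideal (D : set (ambient_space X)) x : set (ratfun X) :=
  [set f | local_ring x f /\ forall y c, D y -> has_value f y c -> c = 0].

Definition local_equation (D : set (ambient_space X)) x z : Prop :=
  local_ideal D x = ideal_span (local_ring x) [set z].

(** When [X] is smooth of dimension [n]: a regular system of parameters at
    [x]. *)
Definition local_parameters n x (t : 'I_n -> ratfun X) : Prop :=
  maximal_ideal x = ideal_span (local_ring x) (range t).

Definition alg_independent n (t : 'I_n -> ratfun X) : Prop :=
  forall p : {mpoly k[n]}, mmap (ratfun_const X) t p = 0 -> p = 0.

(** The dimension of [X] is the transcendence degree of its function field. *)
Definition has_dim n : Prop :=
  (exists t : 'I_n -> ratfun X, alg_independent t) /\
  (forall t : 'I_n.+1 -> ratfun X, ~ alg_independent t).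

(** All local rings are regular: of dimension [n], with maximal ideal generated
    by [n] elements. *)
Definition smooth_of_dim n : Prop :=
  has_dim n /\
  forall x, points X x -> exists t : 'I_n -> ratfun X, local_parameters x t.

Definition snc n (Delta : set (set (ambient_space X))) : Prop :=
  forall x, points X x ->
    exists t : 'I_n -> ratfun X, local_parameters x t /\
      forall D, Delta D -> D x -> exists i, local_equation D x (t i).

End LocalRings.

Section Differentials.
Variables (k : closedFieldType) (X : proj_variety k).

Definition derivation (V : lmodType (ratfun X)) (D : ratfun X -> V) : Prop :=
  [/\ forall f g, D (f + g) = D f + D g,
      forall f g, D (f * g) = f *: D g + g *: D f &
      forall c, D (ratfun_const X c) = 0].

(** [Omega], with [d], is the module of Kaehler differentials of the function
    field of [X] over [k], that is, the space of rational 1-forms on [X]. *)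
Definition rational_forms (Omega : lmodType (ratfun X))
    (d : ratfun X -> Omega) : Prop :=
  derivation d /\
  forall (V : lmodType (ratfun X)) (D : ratfun X -> V), derivation D ->
    exists h : {linear Omega -> V},
      (forall f, h (d f) = D f) /\
      (forall h' : {linear Omega -> V}, (forall f, h' (d f) = D f) -> h' =1 h).

(** The stalk at [x] of the sheaf of logarithmic forms: the submodule of the
    rational forms generated over the local ring by the [df], [f] regular, and
    by the [dz / z], [z] a local equation of a member of [Delta]. *)
Definition log_forms (Omega : lmodType (ratfun X)) (d : ratfun X -> Omega)
    (Delta : set (set (ambient_space X))) (x : ambient_space X) : set Omega :=
  span (local_ring x)
    ([set d f | f in local_ring x] `|`
     [set w | exists D z, [/\ Delta D, D x, local_equation D x z &
                              w = z^-1 *: d z]]).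

End Differentials.

Section Coverings.
Variables (k : closedFieldType) (X Y : proj_variety k).
Variable pi : ambient_space X -> ambient_space Y.

(** For a dominant regular map [pi], there is exactly one such [g], namely
    [f o pi]. *)
Definition pullback (f : ratfun Y) : ratfun X :=
  xget 0 [set g | forall x c,
    points X x -> has_value f (pi x) c -> has_value g x c].

Definition inverse_image (V : set (ambient_space Y)) : set (ambient_space X) :=
  points X `&` pi @^-1` V.

Definition finite_over (V : set (ambient_space Y)) : Prop :=
  exists m (g : 'I_m -> ratfun X),
    (forall i, regular_on (inverse_image V) (g i)) /\
    forall f, regular_on (inverse_image V) f ->
      exists a : 'I_m -> ratfun Y,
        (forall i, regular_on V (a i)) /\ f = \sum_i pullback (a i) * g i.

Definition finite_covering : Prop :=
  [/\ regular_map (points X) (points Y) pi,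
      forall y, points Y y -> exists2 x, points X x & pi x = y &
      forall y, points Y y -> exists V : set (ambient_space Y),
        [/\ V y, zariski_open_in (points Y) V, is_affine V,
            is_affine (inverse_image V) & finite_over V]].

(** The residue fields are all [k], so only the maximal ideals matter. *)
Definition unramified_at (x : ambient_space X) : Prop :=
  maximal_ideal x =
  ideal_span (local_ring x) (pullback @` maximal_ideal (pi x)).

Definition branch_locus : set (ambient_space Y) :=
  [set y | exists x, [/\ points X x, pi x = y & ~ unramified_at x]].

Definition branch_divisors : set (set (ambient_space Y)) :=
  irreducible_component branch_locus.

(** All components of the inverse image of the branch locus, including those
    along which [pi] is unramified. *)
Definition ramification_divisors : set (set (ambient_space X)) :=
  irreducible_component (inverse_image branch_locus).

Definition forms_pullback (OmegaX : lmodType (ratfun X))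
    (dX : ratfun X -> OmegaX) (OmegaY : lmodType (ratfun Y))
    (dY : ratfun Y -> OmegaY) (p : OmegaY -> OmegaX) : Prop :=
  (forall v w, p (v + w) = p v + p w) /\
  (forall f g, p (f *: dY g) = pullback f *: dX (pullback g)).

End Coverings.

(* Main.v *)
From HB Require Import structures.
From mathcomp Require Import all_boot all_order all_algebra.
From mathcomp Require Import ring.
From mathcomp Require Import boolp classical_sets.
From mathcomp Require Import mpoly.
Require Import Defs.

(** Fix [x] on [X] and [y = pi x], with local rings [B] and [A], and regular
    parameters [u] and [t] adapted to the two divisors.  The forms [dt i / t i]
    (along a branch divisor) and [dt i] are a basis of the logarithmic forms at
    [y]; the claim is that their pullbacks are a basis of those at [x].

    By duality this says that the logarithmic derivations [Th] of [A] dual to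
    this basis, extended to the function field of [X], preserve [B] and the
    ideals [u j B] of the ramification divisors.  The Jacobian determinant of
    [pi] clears the denominators of [Th], and it vanishes only on [pi^-1] of the
    branch locus, so by the Nullstellensatz it is a unit times a product of the
    [u j].  The poles are then removed one factor at a time: if
    [E = u j * g * Th] preserves [B] and [u j B], then [E] vanishes modulo
    [u j] on functions coming from [Y], hence on everything integral over them
    since the characteristic is [0], and the equation
    [t i = u j ^ m.+1 * v] of a branch divisor below [u j = 0] gives that
    [E (u j)] is in [u j ^ 2 B].  So [g * Th] preserves [B] and [u j B] too. *)

Set Implicit Arguments.
Unset Strict Implicit.
Unset Printing Implicit Defensive.
Import GRing.Theory.
Local Open Scope ring_scope.
Local Open Scope classical_set_scope.

(** * Ideals and pseudo-division *)

(** Duality moves the claim into the function field of [X], where rings and ideals are mere subsets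
    and all depends on which elements they contain. The obstacle is that [B] is in general not
    integral over [A], since the fibre of [pi x] may have other points. Integrality is therefore
    taken from an affine [V] around [pi x]: functions on its preimage are integral over those on
    [V], and each element of [B] is a quotient of two of them with unit denominator. Factorizations
    come from radicals: an element all of whose primes contain some [u j] divides a power of their
    product, and primality of the [u j] then splits it. Stability of [u j B] is carried along with
    that of [B] because it lets [E] act on the domain [B / u j B], where the separability argument
    takes place. The exponent [m.+1] is a ramification index; [m = 0], a component along which [pi]
    is unramified, goes through the same computation. *)

Lemma Zorn_above (T : Type) (Q : set (set T)) (E : set T) : Q E ->
  (forall F, F !=set0 -> F `<=` Q -> total_on F subset ->
     Q (\bigcup_(A in F) A)) ->
  exists A, [/\ E `<=` A, Q A & forall B, A `<=` B -> Q B -> B = A].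
Proof.
move=> QE Qchain.
(* The chains of [Zorn_bigcup] include the empty one, whose union is [set0]; letting [set0] through
   keeps its hypothesis true. If the maximal set is [set0], then [E] is empty too. *)
have [|A [PA Amax]] := @Zorn_bigcup _ [set A | A = set0 \/ E `<=` A /\ Q A].
  move=> F FP Ftot; pose F' := F `&` [set A | E `<=` A /\ Q A].
  have [[A0 F'A0]|F'0] := pselect (F' !=set0); [right; split|left].
  - by move=> x Ex; exists A0; [case: F'A0|case: F'A0 => _ [EA _]; exact: EA].
  - have -> : \bigcup_(A in F) A = \bigcup_(A in F') A.
      apply/seteqP; split=> x [A FA Ax]; exists A => //; last by case: FA.
      by split=> //; have [A0e|//] := FP A FA; rewrite A0e in Ax.
    apply: Qchain; first by exists A0.
      by move=> A [_ []].
    by move=> A B [FA _] [FB _]; exact: Ftot.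
  - apply/seteqP; split=> // x [A FA Ax].
    have [A0e|EQ] := FP A FA; first by rewrite A0e in Ax.
    by case: F'0; exists A.
case: PA => [A0|[EA QA]].
  have E0 : E = set0.
    apply: contrapT => En; apply: (Amax E); last by right; split.
    rewrite A0; split=> // h.
    by apply: En; apply/seteqP; split.
  exists E; split=> // B _ QB; apply: contrapT => BE; apply: (Amax B).
    rewrite A0; split=> // h; apply: BE.
    by rewrite E0; apply/seteqP; split.
  by right; split=> //; rewrite E0.
exists A; split=> // B AB QB; apply: contrapT => BA; apply: (Amax B).
  by split=> // h; apply: BA; apply/seteqP; split.
by right; split=> // x Ex; apply: AB; exact: EA.
Qed.

Section Ideals.
Variable R : comNzRingType.

Definition ideal_in (S : {pred R}) (I : set R) : Prop :=
  [/\ forall a, I a -> a \in S, I 0, forall a b, I a -> I b -> I (a + b) &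
      forall a b, a \in S -> I b -> I (a * b)].

Definition prime_in (S : {pred R}) (P : set R) : Prop :=
  [/\ ideal_in S P, ~ P 1 &
      forall a b, a \in S -> b \in S -> P (a * b) -> P a \/ P b].

Lemma ideal_sum (S : {pred R}) (I : set R) J (r : seq J) (p : pred J) F :
  ideal_in S I -> (forall i, p i -> I (F i)) -> I (\sum_(i <- r | p i) F i).
Proof. by case=> _ I0 ID _ h; elim/big_ind: _. Qed.

Lemma ideal_opp (S : subringClosed R) (I : set R) a :
  ideal_in S I -> I a -> I (- a).
Proof. by case=> _ _ _ IM Ia; rewrite -mulN1r; apply: IM; rewrite // rpredN rpred1. Qed.

Lemma ideal_sub (S : subringClosed R) (I : set R) a b :
  ideal_in S I -> I a -> I b -> I (a - b).
Proof. by move=> hI Ia Ib; case: (hI) => _ _ ID _; apply: ID => //; exact: ideal_opp hI _. Qed.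

Lemma prime_expr (S : subringClosed R) (P : set R) a n :
  prime_in S P -> a \in S -> P (a ^+ n) -> P a.
Proof.
move=> [_ P1 PM] aS; elim: n => [/P1//|n IH].
by rewrite exprS => /(PM _ _ aS (rpredX n aS))[].
Qed.

(** An ideal maximal among those that contain [I] and miss all powers of [h] is prime. This is the
    form in which radicals are used: if every prime over [I] contains [h], some power of [h] is in
    [I]. *)
Lemma prime_avoiding (S : subringClosed R) (I : set R) (h : R) :
  ideal_in S I -> h \in S -> (forall n, ~ I (h ^+ n)) ->
  exists P, [/\ prime_in S P, I `<=` P & ~ P h].
Proof.
move=> hI hS hIn.
have [||P [IP [idP Ph] Pmax]] :=
  @Zorn_above R [set J | ideal_in S J /\ forall n, ~ J (h ^+ n)] I.
- by [].
- move=> F [A0 FA0] FQ Ftot; split; last by move=> n [A FA]; apply: (FQ A FA).2.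
  split.
  + by move=> a [A /FQ [[AS _ _ _] _] /AS].
  + by exists A0 => //; case: (FQ _ FA0) => -[].
  + move=> a b [A FA Aa] [B FB Bb].
    have [AB|BA] := Ftot A B FA FB.
      by exists B => //; have [[_ _ BD _] _] := FQ B FB; apply: BD => //; exact: AB.
    by exists A => //; have [[_ _ AD _] _] := FQ A FA; apply: AD => //; exact: BA.
  + by move=> a b aS [A FA Ab]; exists A => //; have [[_ _ _ AM] _] := FQ A FA; exact: AM.
case: (idP) => PS P0 PD PM.
exists P; split=> //; last by rewrite -[h]expr1; exact: Ph.
split=> //; first exact: (Ph 0%N).
have key a : a \in S -> ~ P a ->
    exists n p c, [/\ P p, c \in S & h ^+ n = p + c * a].
  move=> aS Pa; pose J := [set x | exists p c, [/\ P p, c \in S & x = p + c * a]].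
  have PJ : P `<=` J by move=> p Pp; exists p, 0; rewrite rpred0 mul0r addr0.
  apply: contrapT => nJ; apply: Pa; rewrite -(Pmax J) //.
    by exists 0, 1; rewrite rpred1 mul1r add0r.
  split; first split.
  - by move=> _ [p [c [/PS pS cS ->]]]; rewrite rpredD ?rpredM.
  - exact: PJ.
  - move=> _ _ [p [c [Pp cS ->]]] [q [d [Pq dS ->]]].
    by exists (p + q), (c + d); split; [exact: PD|rewrite rpredD|ring].
  - move=> x _ xS [p [c [Pp cS ->]]]; exists (x * p), (x * c).
    by split; [exact: PM|rewrite rpredM|ring].
  - by move=> n [p [c h']]; apply: nJ; exists n, p, c.
move=> a b aS bS Pab.
have [|Pa] := pselect (P a); first by left.
have [|Pb] := pselect (P b); first by right.
have [n [p [c [Pp cS ea]]]] := key a aS Pa.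
have [m [q [d [Pq dS eb]]]] := key b bS Pb.
case: (Ph (n + m)%N); rewrite exprD ea eb.
have -> : (p + c * a) * (q + d * b) =
  (q + d * b) * p + (c * a * q + (c * d) * (a * b)) by ring.
have qS := PS _ Pq.
by apply: (PD); [apply: PM; rewrite ?rpredD ?rpredM|apply: (PD); apply: PM; rewrite ?rpredM].
Qed.

End Ideals.

(** Multiplying by powers of the leading coefficient of [q] replaces division, so that everything
    stays over [S]. The ring may have zero divisors, as the dual numbers do; sizes are then only
    bounded above, and the drop is read off the top coefficient. *)
Lemma pseudo_division (R : comNzRingType) (S : subringClosed R)
    (p q : {poly R}) : p \is a polyOver S -> q \is a polyOver S -> q != 0 ->
  exists e (s r : {poly R}), [/\ s \is a polyOver S, r \is a polyOver S,
    lead_coef q ^+ e *: p = s * q + r & (size r < size q)%N].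
Proof.
move=> pS qS q0; have [m] := ubnP (size p); elim: m => // m IH in p pS *.
rewrite ltnS => pm; have [pq|qp] := ltnP (size p) (size q).
  by exists 0%N, 0, p; rewrite rpred0 expr0 scale1r mul0r add0r.
have p0 : p != 0 by rewrite -size_poly_gt0 (leq_trans _ qp) ?size_poly_gt0.
pose c := lead_coef p; pose d := (size p - size q)%N.
have cS : c \in S by apply/polyOverP.
have lS : lead_coef q \in S by apply/polyOverP.
pose p' := lead_coef q *: p - (c *: 'X^d) * q.
have p'S : p' \is a polyOver S.
  by rewrite rpredB ?rpredM ?polyOverZ ?polyOverXn.
have sp' : (size p' < size p)%N.
  have sp1 : (size p' <= size p)%N.
    rewrite (leq_trans (size_polyD _ _)) // geq_max size_polyN size_scale_leq.
    rewrite -scalerAl (leq_trans (size_scale_leq _ _)) //.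
    by rewrite mulrC size_mulXn // subnK.
  rewrite ltn_neqAle sp1 andbT; apply/eqP => esp.
  have : lead_coef p' = 0.
    rewrite lead_coefE esp coefB coefZ -scalerAl coefZ coefXnM.
    have h : (0 < size q)%N by rewrite size_poly_gt0.
    rewrite ifF; last by rewrite /d; apply/negbTE; rewrite -leqNgt; case: (size p) qp h; case: (size q) => //= a b; rewrite subSS leq_subr.
    have -> : ((size p).-1 - d = (size q).-1)%N.
      rewrite /d; case: (size p) qp h; case: (size q) => //= a b; rewrite ltnS subSS => ab _.
      by rewrite subKn.
    by rewrite -!lead_coefE -/c mulrC subrr.
  by move/eqP; rewrite lead_coef_eq0 -size_poly_eq0 esp size_poly_eq0 (negbTE p0).
have [e [s [r [sS rS eq sr]]]] := IH p' p'S (leq_trans sp' pm).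
exists e.+1, (s + (lead_coef q ^+ e * c) *: 'X^d), r; split=> //.
  by rewrite rpredD ?polyOverZ ?polyOverXn ?rpredM ?rpredX.
have : lead_coef q ^+ e *: p' = lead_coef q ^+ e.+1 *: p -
     ((lead_coef q ^+ e * c) *: 'X^d) * q.
  by rewrite /p' scalerBr scalerA -exprSr scalerAl scalerA.
rewrite eq => h; rewrite mulrDl addrAC h; ring.
Qed.

(** * The Nullstellensatz *)

Section Adjoin.
Variable R : comNzRingType.

Definition adjoin (S : subringClosed R) (z : R) : {pred R} :=
  fun x => `[< exists2 p : {poly R}, p \is a polyOver S & x = p.[z] >].

Lemma adjoinP (S : subringClosed R) z x :
  reflect (exists2 p : {poly R}, p \is a polyOver S & x = p.[z])
          (x \in adjoin S z).
Proof. exact: asboolP. Qed.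

Lemma adjoin_subring_closed (S : subringClosed R) z :
  subring_closed (adjoin S z).
Proof.
split=> [|_ _ /adjoinP[p pS ->] /adjoinP[q qS ->]|_ _ /adjoinP[p pS ->] /adjoinP[q qS ->]].
- by apply/adjoinP; exists 1; rewrite ?rpred1 // hornerC.
- by apply/adjoinP; exists (p - q); rewrite ?rpredB // hornerD hornerN.
- by apply/adjoinP; exists (p * q); rewrite ?rpredM // hornerM.
Qed.
HB.instance Definition _ S z :=
  GRing.isSubringClosed.Build R (adjoin S z) (adjoin_subring_closed S z).

Lemma sub_adjoin (S : subringClosed R) z x : x \in S -> x \in adjoin S z.
Proof. by move=> xS; apply/adjoinP; exists x%:P; rewrite ?polyOverC ?hornerC. Qed.

Lemma mem_adjoin (S : subringClosed R) z : z \in adjoin S z.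
Proof. by apply/adjoinP; exists 'X; rewrite ?polyOverX ?hornerX. Qed.

End Adjoin.

Section PartialHom.
Variables (R : comNzRingType) (k : fieldType).
Implicit Types (S : subringClosed R) (s : R -> k).

Definition hom_on (c : k -> R) S s : Prop :=
  [/\ forall a b, a \in S -> b \in S -> s (a + b) = s a + s b,
      forall a b, a \in S -> b \in S -> s (a * b) = s a * s b &
      forall x, s (c x) = x].

Variables (c : {rmorphism k -> R}) (S : subringClosed R) (s : R -> k).
Hypothesis hs : hom_on c S s.

Lemma hom_on0 : s 0 = 0.
Proof. by case: hs => _ _ h; rewrite -[0 in LHS](rmorph0 c) h. Qed.

Lemma hom_on1 : s 1 = 1.
Proof. by case: hs => _ _ h; rewrite -[1 in LHS](rmorph1 c) h. Qed.

Lemma hom_onX a n : a \in S -> s (a ^+ n) = s a ^+ n.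
Proof.
move=> aS; elim: n => [|n IH]; first exact: hom_on1.
by case: hs => _ h _; rewrite !exprS h ?IH // rpredX.
Qed.

Lemma hom_on_sum J (r : seq J) (P : pred J) F :
  (forall i, F i \in S) -> s (\sum_(i <- r | P i) F i) = \sum_(i <- r | P i) s (F i).
Proof.
move=> FS; suff [] : \sum_(i <- r | P i) F i \in S /\
  s (\sum_(i <- r | P i) F i) = \sum_(i <- r | P i) s (F i) by [].
elim/big_rec2: _ => [|i x y _ [yS <-]]; first by rewrite rpred0 hom_on0.
by case: hs => h _ _; rewrite h ?rpredD.
Qed.

Lemma coef_map_hom p i : (map_poly s p)`_i = s p`_i.
Proof. exact: coef_map_id0 hom_on0. Qed.

Lemma map_homD p q : p \is a polyOver S -> q \is a polyOver S ->
  map_poly s (p + q) = map_poly s p + map_poly s q.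
Proof.
move=> /polyOverP pS /polyOverP qS; apply/polyP => i; case: hs => h _ _.
by rewrite coefD !coef_map_hom coefD h.
Qed.

Lemma map_homM p q : p \is a polyOver S -> q \is a polyOver S ->
  map_poly s (p * q) = map_poly s p * map_poly s q.
Proof.
move=> /polyOverP pS /polyOverP qS; apply/polyP => i.
rewrite coef_map_hom !coefM hom_on_sum => [|j]; last by rewrite rpredM.
by apply: eq_bigr => j _; rewrite !coef_map_hom; case: hs => _ -> .
Qed.

Lemma map_homC a : map_poly s a%:P = (s a)%:P.
Proof. by apply/polyP => i; rewrite coef_map_hom !coefC; case: eqP; rewrite ?hom_on0. Qed.

(** Substituting [al] for [z] is well defined when each relation of [z] also holds at [al]. Asking
    this of relations modulo [Q], not only of exact ones, makes the new point vanish on [Q] as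
    well. *)
Lemma hom_on_extend (Q : set R) z (al : k) :
  (forall x, c x \in S) -> (forall x y, Q x -> Q y -> Q (x - y)) -> Q 0 ->
  (forall H, H \is a polyOver S -> Q H.[z] -> (map_poly s H).[al] = 0) ->
  exists s', [/\ hom_on c (adjoin S z) s',
    forall a, a \in adjoin S z -> Q a -> s' a = 0 &
    forall H, H \is a polyOver S -> s' H.[z] = (map_poly s H).[al]].
Proof.
move=> cS QB Q0 hal.
pose good x p := p \is a polyOver S /\ x = p.[z].
pose s' x := if pselect (exists p, good x p) is left h then
  (map_poly s (projT1 (cid h))).[al] else 0.
have s'E H : H \is a polyOver S -> s' H.[z] = (map_poly s H).[al].
  move=> HS; rewrite /s'; case: pselect => [h|[]]; last by exists H.
  have [pS e] := projT2 (cid h); set p := projT1 _ in pS e *.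
  apply/eqP; rewrite -subr_eq0 -hornerN -hornerD; apply/eqP.
  have -> : map_poly s p - map_poly s H = map_poly s (p - H).
    have := map_homD (p := p - H) (q := H); rewrite subrK => -> //.
      by rewrite addrK.
    by rewrite rpredB.
  by apply: hal; rewrite ?rpredB // hornerD hornerN e subrr.
exists s'; split=> //; last by move=> _ /adjoinP[p pS ->] /(hal _ pS) <-; exact: s'E.
split.
- move=> _ _ /adjoinP[p pS ->] /adjoinP[q qS ->].
  by rewrite -hornerD !s'E ?rpredD // map_homD // hornerD.
- move=> _ _ /adjoinP[p pS ->] /adjoinP[q qS ->].
  by rewrite -hornerM !s'E ?rpredM // map_homM // hornerM.
by move=> x; rewrite -[c x](hornerC _ z) s'E ?polyOverC // map_homC hornerC; case: hs.
Qed.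
End PartialHom.

Section Nullstellensatz.
Variables (R : idomainType) (k : closedFieldType) (c : {rmorphism k -> R}).
Variables (T : subringClosed R) (Q : set R).
Hypotheses (hQ : prime_in T Q) (cT : forall x, c x \in T).

(** The induction invariant of the Nullstellensatz: points modulo [Q] are dense. The freedom in [g]
    is consumed when a generator is adjoined, to keep leading coefficients away from 0. *)
Definition enough_points (S : subringClosed R) : Prop :=
  forall g, g \in S -> ~ Q g -> exists s : R -> k,
    [/\ hom_on c S s, forall a, a \in S -> Q a -> s a = 0 & s g != 0].

Let idQ : ideal_in T Q. Proof. by case: hQ. Qed.
Let Q0 : Q 0. Proof. by case: idQ. Qed.
Let QD a b : Q a -> Q b -> Q (a + b). Proof. by case: idQ => _ _ h _; exact: h. Qed.
Let QM a b : a \in T -> Q b -> Q (a * b). Proof. by case: idQ => _ _ _ h; exact: h. Qed.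
Let QB a b : Q a -> Q b -> Q (a - b). Proof. exact: ideal_sub idQ. Qed.
Let Qprime a b : a \in T -> b \in T -> Q (a * b) -> Q a \/ Q b.
Proof. by case: hQ => _ _ h; exact: h. Qed.

Variable S : subringClosed R.
Hypotheses (ST : forall a, a \in S -> a \in T) (cS : forall x, c x \in S).
Variable z : R.
Hypothesis zT : z \in T.
Implicit Types p q : {poly R}.

Let inQ p := forall i, Q p`_i.

Let hornerT p : p \is a polyOver S -> p.[z] \in T.
Proof.
move=> /polyOverP pS; rewrite horner_coef rpred_sum // => i _.
by apply: rpredM; [exact: ST|exact: rpredX].
Qed.

Let inQ_horner p : inQ p -> Q p.[z].
Proof.
move=> pQ; rewrite horner_coef; apply: ideal_sum idQ _ => i _.
by rewrite mulrC; apply: QM; rewrite ?rpredX.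
Qed.

Let inQM p q : p \is a polyOver S -> inQ q -> inQ (p * q).
Proof.
move=> /polyOverP hp hq i; rewrite coefM; apply: ideal_sum idQ _ => j _.
by apply: QM => //; exact: ST.
Qed.

(* Dropping a leading coefficient in [Q] does not change [p] modulo [Q]. *)
Let lead_notin (F : {poly R} -> Prop) p :
  (forall p q, p \is a polyOver S -> F p -> q \is a polyOver S -> inQ q -> F (p - q)) ->
  p \is a polyOver S -> F p -> ~ inQ p ->
  (forall q, q \is a polyOver S -> F q -> ~ inQ q -> (size p <= size q)%N) ->
  ~ Q (lead_coef p).
Proof.
move=> Fsub pS Fp np pmin lQ.
have p0 : p != 0 by apply/eqP => p0; apply: np => i; rewrite p0 coef0.
have sp0 : (0 < size p)%N by rewrite size_poly_gt0.
pose q : {poly R} := lead_coef p *: 'X^((size p).-1).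
have qS : q \is a polyOver S by rewrite polyOverZ ?polyOverXn //; apply/polyOverP.
have qQ : inQ q.
  move=> i; rewrite coefZ coefXn; case: eqP => _; rewrite ?mulr1 ?mulr0 //.
have : (size p <= size (p - q)%R)%N.
  apply: pmin; rewrite ?rpredB //; first exact: Fsub.
  move=> h; apply: np => i; have := QD (h i) (qQ i).
  by rewrite coefB subrK.
have : (size (p - q)%R <= size p)%N.
  rewrite (leq_trans (size_polyD _ _)) // geq_max leqnn size_polyN.
  by rewrite (leq_trans (size_scale_leq _ _)) // size_polyXn prednK.
move=> h1 h2; have e : size (p - q) = size p by apply/eqP; rewrite eqn_leq h1.
have : lead_coef (p - q) = 0.
  by rewrite lead_coefE e coefB coefZ coefXn eqxx mulr1 -lead_coefE subrr.
by move/eqP; rewrite lead_coef_eq0 -size_poly_eq0 e size_poly_eq0 (negbTE p0).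
Qed.

Let min_size (F : {poly R} -> Prop) p : F p ->
  exists q, F q /\ forall q', F q' -> (size q <= size q')%N.
Proof.
move=> Fp; have h : exists m, `[< exists2 q, F q & size q = m >].
  by exists (size p); apply/asboolP; exists p.
have := ex_minnP h => -[m /asboolP[q Fq <-] mmin].
by exists q; split=> // q' Fq'; apply: mmin; apply/asboolP; exists q'.
Qed.

(** If [z] is transcendental over [S] modulo [Q], a point of [S] where some coefficient of [G]
    survives extends by any [al] that is not a root. If [z] has a minimal relation [P], a point
    where the leading coefficient of [P] survives extends by a root of the image of [P], and a
    Bezout relation keeps [G] away from 0 there. *)
Lemma enough_points_adjoin : enough_points S -> enough_points (adjoin S z).
Proof.
move=> hS _ /adjoinP[G GS ->] nG.
have nGQ : ~ inQ G by move=> /inQ_horner.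
have [[P [PS PQ nP]]|transc] :=
    pselect (exists P, [/\ P \is a polyOver S, Q P.[z] & ~ inQ P]); last first.
  have inQ_all p : p \is a polyOver S -> Q p.[z] -> inQ p.
    by move=> pS pQ; apply: contrapT => np; apply: transc; exists p.
  have [i nGi] : exists i, ~ Q G`_i by apply/existsNP.
  have [s [hs sQ sG]] := hS G`_i (polyOverP GS i) nGi.
  have : map_poly s G != 0.
    by apply: contraNneq sG => /(congr1 (fun p : {poly k} => p`_i)); rewrite (coef_map_hom hs) coef0 => ->.
  case/closed_nonrootP => al; rewrite /root => nal.
  have [H HS HQ|s' [hs' s'Q s'E]] := hom_on_extend hs cS QB Q0 (z := z) (al := al).
    suff -> : map_poly s H = 0 by rewrite horner0.
    apply/polyP => j; rewrite (coef_map_hom hs) coef0 sQ //; first exact: (polyOverP HS).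
    exact: inQ_all.
  by exists s'; rewrite s'E.
have [{PS PQ nP}P [[PS PQ nP] Pmin]] := @min_size (fun P => [/\ P \is a polyOver S, Q P.[z] & ~ inQ P]) _ (And3 PS PQ nP).
have Psmall p : p \is a polyOver S -> Q p.[z] -> (size p < size P)%N -> inQ p.
  by move=> pS pQ; apply: contraPP => np; apply/negP; rewrite -leqNgt; apply: Pmin.
have P0 : P != 0 by apply/eqP => P0; apply: nP => i; rewrite P0 coef0.
have lP : ~ Q (lead_coef P).
  apply: (lead_notin (F := fun p => Q p.[z])) => // [p q pS pQ qS qQ|q qS qQ nq].
    by rewrite hornerD hornerN; apply: QB => //; exact: inQ_horner.
  by apply: Pmin.
have lS : lead_coef P \in S by apply/polyOverP.
have mQ a b : a \in S -> b \in S -> ~ Q a -> ~ Q b -> ~ Q (a * b).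
  by move=> aS bS na nb /(Qprime (ST aS) (ST bS))[].
have XQ a e : a \in S -> ~ Q a -> ~ Q (a ^+ e).
  by move=> aS na /(prime_expr hQ (ST aS)).
(* [c0] plays the role of a resultant of [P] and [G]: an element of [S] outside [Q] that is a
   multiple of [G.[z]] modulo [Q]. It comes from a shortest polynomial whose value at [z] is such a
   multiple. *)
have [c0 [U [c0S US nc0 c0Q]]] : exists c0 U, [/\ c0 \in S,
    U \is a polyOver S, ~ Q c0 & Q (c0 - U.[z] * G.[z])].
  pose F p := exists2 U, U \is a polyOver S & Q (p.[z] - U.[z] * G.[z]).
  have FG : F G by exists 1; rewrite ?rpred1 // hornerC mul1r subrr.
  have [p [[pS Fp np] pmin]] := @min_size (fun p => [/\ p \is a polyOver S, F p & ~ inQ p]) _ (And3 GS FG nGQ).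
  have [U US pU] := Fp.
  have pP : (size p < size P)%N.
    have [e [s [r [sS rS er srP]]]] := pseudo_division GS PS P0.
    apply: leq_ltn_trans srP; apply: pmin; split=> //.
      exists (lead_coef P ^+ e)%:P; first by rewrite polyOverC rpredX.
      have := congr1 (horner^~ z) er; rewrite hornerZ hornerD hornerM hornerC => ->.
      rewrite [_ + r.[z]]addrC opprD addrA subrr sub0r; apply: ideal_opp idQ _.
      by apply: QM => //; exact: hornerT.
    move=> /inQ_horner rQ; apply: nG.
    have lG : Q (lead_coef P ^+ e * G.[z]).
      have := congr1 (horner^~ z) er; rewrite hornerZ hornerD hornerM => ->.
      by apply: QD => //; apply: QM => //; exact: hornerT.
    have [||/(prime_expr hQ (ST lS))//|//] := Qprime _ _ lG.
      by rewrite ST ?rpredX.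
    exact: hornerT.
  have lp : ~ Q (lead_coef p).
    apply: (lead_notin (F := F)) => // [q r qS [V VS qV] rS rQ|q qS Fq nq].
      exists V => //; rewrite hornerD hornerN addrAC; apply: QB => //.
      exact: inQ_horner.
    exact: pmin.
  have lpS : lead_coef p \in S by apply/polyOverP.
  have p0 : p != 0 by apply/eqP => p0; apply: np => i; rewrite p0 coef0.
  have [sp|sp] := leqP (size p) 1.
    exists (lead_coef p), U; split=> //.
    by have /size1_polyC e := sp; rewrite e hornerC in pU; rewrite e lead_coefC.
  (* If [p] is not constant, dividing [P] by it leaves a remainder in [Q], so [s.[z] * p.[z]] is in
     [Q]. Both [s] and [p] are shorter than [P], so minimality of [P] puts the coefficients of one
     of them in [Q], a contradiction. *)
  exfalso.
  have [e [s [r [sS rS er srp]]]] := pseudo_division PS pS p0.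
  have ez := congr1 (horner^~ z) er; rewrite hornerZ hornerD hornerM in ez.
  have rQ : inQ r.
    apply: contrapT => nr; move: srp; rewrite ltnNge => /negP; apply; apply: pmin.
    split=> //; exists (- (s * U)); first by rewrite rpredN rpredM.
    have -> : r.[z] - (- (s * U)).[z] * G.[z] =
        lead_coef p ^+ e * P.[z] - s.[z] * (p.[z] - U.[z] * G.[z]).
      by rewrite ez hornerN hornerM; ring.
    by apply: QB; apply: QM; rewrite ?hornerT // ST ?rpredX.
  have spQ : Q (s.[z] * p.[z]).
    have -> : s.[z] * p.[z] = lead_coef p ^+ e * P.[z] - r.[z] by rewrite ez addrK.
    by apply: QB; [apply: QM; rewrite ?ST ?rpredX|exact: inQ_horner].
  have espP : s * p = lead_coef p ^+ e *: P - r by rewrite er addrK.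
  have lp0 : lead_coef p ^+ e != 0 by rewrite expf_neq0 // lead_coef_eq0.
  have size_sp : size (s * p) = size P.
    rewrite espP size_polyDl ?size_scale // size_polyN.
    exact: ltn_trans pP.
  have ns : ~ inQ s.
    move=> sQ; have := inQM pS sQ; rewrite mulrC => /(_ (size P).-1).
    rewrite espP coefB coefZ -lead_coefE => h.
    have := QD h (rQ (size P).-1); rewrite subrK.
    by apply: mQ; rewrite ?rpredX //; exact: XQ.
  have s0 : s != 0 by apply/eqP => s0; apply: ns => i; rewrite s0 coef0.
  have [sQ|pQ] := Qprime (hornerT sS) (hornerT pS) spQ.
    apply: ns; apply: Psmall => //; rewrite -size_sp size_mul //.
    by move: sp; case: (size p) => [|[|m]] // _; rewrite !addnS /= ltnS leq_addr.
  by apply: np; apply: Psmall.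
have [s [hs sQ sc]] := hS _ (rpredM lS c0S) (mQ _ _ lS c0S lP nc0).
have {sc} [sl sc] : s (lead_coef P) != 0 /\ s c0 != 0.
  by case: hs => _ hM _; move: sc; rewrite hM // mulf_eq0 negb_or => /andP.
have sP : (1 < size P)%N.
  rewrite ltnNge; apply/negP => /size1_polyC e; apply: lP; rewrite e lead_coefC.
  by rewrite e hornerC in PQ.
have smP : size (map_poly s P) = size P by rewrite size_poly_eq.
have /closed_rootP[al] : size (map_poly s P) != 1%N by rewrite smP gtn_eqF.
rewrite /root => /eqP Pal.
have hal H : H \is a polyOver S -> Q H.[z] -> (map_poly s H).[al] = 0.
  move=> HS HQ; have [e [u [r [uS rS er sr]]]] := pseudo_division HS PS P0.
  have rQ : inQ r.
    apply: Psmall => //; have := congr1 (horner^~ z) er.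
    rewrite hornerZ hornerD hornerM => h.
    have -> : r.[z] = lead_coef P ^+ e * H.[z] - u.[z] * P.[z] by rewrite h addrAC subrr add0r.
    by apply: QB; apply: QM; rewrite ?hornerT // ST ?rpredX.
  have r0 : map_poly s r = 0.
    by apply/polyP => j; rewrite (coef_map_hom hs) coef0 sQ //; exact: (polyOverP rS).
  have := congr1 (fun p => (map_poly s p).[al]) er.
  rewrite (map_homD hs) ?rpredM // r0 addr0 (map_homM hs) // hornerM Pal mulr0.
  rewrite -mul_polyC (map_homM hs) ?polyOverC ?rpredX // (map_homC hs) hornerM hornerC.
  by rewrite (hom_onX hs) // => /eqP; rewrite mulf_eq0 expf_eq0 (negbTE sl) andbF => /eqP.
have [s' [hs' s'Q s'E]] := hom_on_extend hs cS QB Q0 hal.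
exists s'; split=> //; rewrite s'E //; apply: contraNneq sc => G0.
have := hal (c0%:P - U * G); rewrite rpredB ?polyOverC ?rpredM // => /(_ isT).
rewrite hornerD hornerN hornerC hornerM => /(_ c0Q).
have e : c0%:P = (c0%:P - U * G) + U * G by rewrite subrK.
have := congr1 (map_poly s) e; rewrite (map_homC hs) (map_homD hs) ?rpredB ?polyOverC ?rpredM //.
move=> /(congr1 (horner^~ al)); rewrite hornerC hornerD => -> ->.
by rewrite (map_homM hs) // hornerM G0 mulr0 addr0.
Qed.

End Nullstellensatz.

Section FinitelyGenerated.
Variables (R : idomainType) (k : closedFieldType) (c : {rmorphism k -> R}).

Definition image_field : {pred R} := fun x => `[< exists a, x = c a >].

Lemma image_field_subring : subring_closed image_field.
Proof.
split=> [|_ _ /asboolP[a ->] /asboolP[b ->]|_ _ /asboolP[a ->] /asboolP[b ->]].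
- by apply/asboolP; exists 1; rewrite rmorph1.
- by apply/asboolP; exists (a - b); rewrite rmorphB.
- by apply/asboolP; exists (a * b); rewrite rmorphM.
Qed.
HB.instance Definition _ :=
  GRing.isSubringClosed.Build R image_field image_field_subring.

Definition fg_algebra (zs : seq R) : subringClosed R :=
  foldr (fun z (S : subringClosed R) => adjoin S z : subringClosed R)
        (image_field : subringClosed R) zs.

Lemma fg_algebra_const zs x : c x \in fg_algebra zs.
Proof.
by elim: zs => [|z zs IH] /=; [apply/asboolP; exists x|exact: sub_adjoin].
Qed.

Lemma fg_algebra_gen zs z : z \in zs -> z \in fg_algebra zs.
Proof.
elim: zs => //= a zs IH; rewrite inE => /predU1P[->|/IH]; first exact: mem_adjoin.
exact: sub_adjoin.
Qed.

Lemma fg_algebra_sub zs (T : subringClosed R) : (forall x, c x \in T) ->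
  (forall z, z \in zs -> z \in T) -> forall a, a \in fg_algebra zs -> a \in T.
Proof.
move=> cT; elim: zs => [_ a /asboolP[x ->]//|z zs IH /= zsT _ /adjoinP[p /polyOverP pS ->]].
rewrite horner_coef rpred_sum // => i _.
apply: rpredM; last by apply: rpredX; rewrite zsT ?mem_head.
by apply: IH (pS i) => w wzs; rewrite zsT // inE wzs orbT.
Qed.

(** [Q] is a prime of a possibly much larger ring [T], such as a local ring; the point lives on the
    algebra generated by [zs] and sees the trace of [Q] there. *)
Theorem nullstellensatz (T : subringClosed R) (Q : set R) (zs : seq R) (g : R) :
  prime_in T Q -> (forall x, c x \in T) -> (forall z, z \in zs -> z \in T) ->
  g \in fg_algebra zs -> ~ Q g ->
  exists s : R -> k, [/\ hom_on c (fg_algebra zs) s,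
    forall a, a \in fg_algebra zs -> Q a -> s a = 0 & s g != 0].
Proof.
move=> hQ cT zsT gS nQ; move: g gS nQ.
suff : enough_points c Q (fg_algebra zs) by [].
elim: zs zsT => [_ _ /asboolP[b ->] nb|z zs IH zsT].
  exists (fun x => xget 0 [set a | c a = x]).
  have sE x : xget 0 [set a | c a = c x] = x.
    by apply: (fmorph_inj c); apply: (xgetPex 0 (P := [set a | c a = c x])); exists x.
  split.
  - split=> // _ _ /asboolP[u ->] /asboolP[v ->].
      by rewrite -rmorphD !sE.
    by rewrite -rmorphM !sE.
  - move=> _ /asboolP[u ->] Qu; rewrite sE; apply: contrapT => /eqP u0.
    case: hQ => -[_ _ _ QM] Q1 _; apply: Q1.
    by rewrite -(rmorph1 c) -(mulVf u0) rmorphM; exact: QM.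
  - rewrite sE; apply: contra_notN nb => /eqP ->; rewrite rmorph0.
    by case: hQ => -[].
apply: (enough_points_adjoin hQ).
- by move=> a; apply: fg_algebra_sub => // w wzs; rewrite zsT // inE wzs orbT.
- exact: fg_algebra_const.
- by rewrite zsT // mem_head.
- by apply: IH => w wzs; rewrite zsT // inE wzs orbT.
Qed.

End FinitelyGenerated.

(** * Extension of derivations *)

Lemma mpoly_morph_eq n (k R : comNzRingType) (a b : {rmorphism {mpoly k[n]} -> R}) :
  (forall x, a x%:MP = b x%:MP) -> (forall i, a 'X_i = b 'X_i) -> a =1 b.
Proof.
move=> ab abX p; rewrite [p]mpolyE !rmorph_sum; apply: eq_bigr => m _.
rewrite -mul_mpolyC !rmorphM /= ab mpolyXE_id !rmorph_prod /=; congr (_ * _).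
by apply: eq_bigr => i _; rewrite !rmorphXn /= abX.
Qed.

Section AlgebraicIndependence.
Variables (k L : fieldType) (c : {rmorphism k -> L}).

Definition alg_indep n (t : 'I_n -> L) : Prop :=
  forall p : {mpoly k[n]}, mmap c t p = 0 -> p = 0.

Definition mpoly_values n (t : 'I_n -> L) : set L := range (mmap c t).

(** A relation between the [n.+1] elements [f] and [g], read by [muni] as a polynomial in the last
    variable. It stays nonzero after evaluation at [f] because [f] is independent. *)
Lemma alg_dependent_root n (f : 'I_n -> L) g : alg_indep f ->
  (forall t : 'I_n.+1 -> L, ~ alg_indep t) ->
  exists q : {poly L}, [/\ q != 0, q.[g] = 0 & forall i, mpoly_values f q`_i].
Proof.
move=> hf hdep; pose t (i : 'I_n.+1) := if unlift ord_max i is Some j then f j else g.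
have /existsNP[F /not_implyP[Ft F0]] := hdep t.
pose q := map_poly (mmap c f) (muni F); exists q.
have qE (H : {mpoly k[n.+1]}) : (map_poly (mmap c f) (muni H)).[g] = mmap c t H.
  have comm : commr_rmorph (mmap c f) g by move=> a; apply: mulrC.
  pose a : {rmorphism {mpoly k[n.+1]} -> L} :=
     (horner_morph comm \o @muni n k)%FUN.
  apply: (mpoly_morph_eq (a := a) (b := mmap c t)) => [x|i] /=.
    by rewrite muniC /horner_morph map_polyC hornerC /= !mmapC.
  rewrite [RHS]mmapX mmap1U /horner_morph /muni mmapX mmap1U /t.
  case: unliftP => [j ->|->].
    case: splitP => [j'|j'] /=.
      rewrite /bump leqNgt ltn_ord add0n => /val_inj <-.
      by rewrite map_polyC hornerC /= mmapX mmap1U.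
    by rewrite /bump leqNgt ltn_ord add0n => e; have := ltn_ord j; rewrite e ltnNge leq_addr.
  case: splitP => [j'|j'] /= e; last by rewrite map_polyX hornerX.
  by have := ltn_ord j'; rewrite -e ltnn.
split; last by move=> i; rewrite coef_map; exists ((muni F)`_i).
- apply: contra_notN F0 => /eqP q0.
  have m0 : muni F = 0.
    by apply/polyP => i; rewrite coef0; apply: hf; rewrite -coef_map -/q q0 coef0.
  have comm : commr_rmorph (@mwiden n k) 'X_ord_max by move=> a; apply: mulrC.
  pose a : {rmorphism {mpoly k[n.+1]} -> {mpoly k[n.+1]}} :=
     (horner_morph comm \o @muni n k)%FUN.
  rewrite -[F]/(idfun F) -(mpoly_morph_eq (a := a) (b := idfun)) /= ?m0 ?rmorph0 //.
    by move=> x; rewrite /= muniC /horner_morph map_polyC hornerC /= mwidenC.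
  move=> i /=; rewrite /horner_morph /muni mmapX mmap1U.
  case: splitP => [j|j] /= e.
    rewrite map_polyC hornerC /= /mwiden mmapX mmap1U; congr ('X__); exact: val_inj.
  rewrite map_polyX hornerX; congr ('X__); apply: val_inj => /=.
  by rewrite e ord1 addn0.
- by rewrite qE.
Qed.

End AlgebraicIndependence.

Section DualNumbers.
Variable L : fieldType.

(** The ring L[eps] with eps^2 = 0. An additive [D] obeys the Leibniz rule exactly when
    [a |-> (a, D a)] is multiplicative, so derivations become subrings, to which Zorn's lemma
    applies. *)
Definition dual : Type := (L * L)%type.
HB.instance Definition _ := GRing.Zmodule.on dual.
HB.instance Definition _ := Choice.on dual.

Definition dual_mul (x y : dual) : dual := (x.1 * y.1, x.1 * y.2 + x.2 * y.1).
Definition dual_one : dual := (1, 0).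

Lemma dual_mulA : associative dual_mul.
Proof. by move=> x y z; congr pair => /=; ring. Qed.
Lemma dual_mulC : commutative dual_mul.
Proof. by move=> x y; congr pair => /=; ring. Qed.
Lemma dual_mul1 : left_id dual_one dual_mul.
Proof. by case=> a b; congr pair => /=; ring. Qed.
Lemma dual_mulDl : left_distributive dual_mul +%R.
Proof. by move=> x y z; congr pair => /=; ring. Qed.
Lemma dual_1neq0 : dual_one != 0.
Proof. by apply/eqP => -[] /eqP; rewrite oner_eq0. Qed.

HB.instance Definition _ := GRing.Zmodule_isComNzRing.Build dual
  dual_mulA dual_mulC dual_mul1 dual_mulDl dual_1neq0.

Definition dual_fst (x : dual) : L := x.1.
Lemma dual_fst_additive : additive dual_fst. Proof. by []. Qed.
Lemma dual_fst_multiplicative : multiplicative dual_fst. Proof. by []. Qed.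
HB.instance Definition _ := GRing.isAdditive.Build dual L dual_fst dual_fst_additive.
HB.instance Definition _ :=
  GRing.isMultiplicative.Build dual L dual_fst dual_fst_multiplicative.

Definition dual_const (a : L) : dual := (a, 0).
Lemma dual_const_additive : additive dual_const.
Proof. by move=> a b; congr pair => /=; rewrite subr0. Qed.
Lemma dual_const_multiplicative : multiplicative dual_const.
Proof. by split=> // a b; congr pair => /=; ring. Qed.
HB.instance Definition _ := GRing.isAdditive.Build L dual dual_const dual_const_additive.
HB.instance Definition _ :=
  GRing.isMultiplicative.Build L dual dual_const dual_const_multiplicative.

(** First-order Taylor expansion: the second component is affine in [d] with slope the derivative at
    [g], so it can be solved for [d]. *)
Lemma dual_horner (p : {poly dual}) g d :
  p.[(g, d) : dual] = (((map_poly dual_fst p).[g],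
     p.[(g, 0) : dual].2 + (map_poly dual_fst p)^`().[g] * d) : dual).
Proof.
elim/poly_ind: p => [|p a IH]; first by rewrite rmorph0 deriv0 !horner0 mul0r addr0.
rewrite !hornerMXaddC IH rmorphD rmorphM /= map_polyX map_polyC.
rewrite derivD derivM derivX derivC !(hornerE, hornerMXaddC).
have e : p.[(g, 0) : dual].1 = (map_poly dual_fst p).[g].
  by rewrite -[LHS]/(dual_fst _) -horner_map.
by congr pair => /=; rewrite ?e; ring.
Qed.

End DualNumbers.

Section SubringOfSet.
Variables (R : comNzRingType) (G : set R).

Definition set_pred (h : subring_closed (fun x => `[< G x >])) : {pred R} :=
  fun x => `[< G x >].

Lemma set_predP h x : reflect (G x) (x \in set_pred h).
Proof. exact: asboolP. Qed.

Lemma set_pred_closed h : subring_closed (set_pred h). Proof. exact: h. Qed.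
HB.instance Definition _ h :=
  GRing.isSubringClosed.Build R (set_pred h) (set_pred_closed h).
End SubringOfSet.

Section ExtendDerivation.
Variables (k L : fieldType) (c : {rmorphism k -> L}).
Hypothesis char0 : forall n, n.+1%:R != 0 :> L.

Definition is_derivation (D : L -> L) : Prop :=
  [/\ forall a b, D (a + b) = D a + D b,
      forall a b, D (a * b) = a * D b + b * D a & forall x, D (c x) = 0].

(* The graph of a derivation of a subring of [L], as a subring of [dual L]. *)
Let graph (G : set (dual L)) : Prop :=
  subring_closed (fun x => `[< G x >]) /\ forall b, G (0, b) -> b = 0.

(** Take a shortest nonzero [P] over the graph whose first components vanish at [g]. Minimality and
    characteristic 0 make its derivative nonzero at [g], so one [d] satisfies P(g + d eps) = 0.
    Pseudo-division by [P] shows that every relation of [g] then holds for [(g, d)], so the enlarged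
    graph is still single-valued. *)
Let graph_extend (G : set (dual L)) g : graph G ->
  (exists q : {poly dual L}, [/\ forall i, G q`_i, q != 0 & (map_poly (@dual_fst L) q).[g] = 0]) ->
  exists d G', [/\ graph G', G `<=` G' & G' (g, d)].
Proof.
case=> Gring Gfun [q0 [q0G q0n0 q0g]].
pose S := set_pred Gring : subringClosed (dual L).
pose fst1 := map_poly (@dual_fst L).
pose F q := [/\ q \is a polyOver S, q != 0 & (fst1 q).[g] = 0].
have Fq0 : exists m, `[< exists2 q, F q & size q = m >].
  exists (size q0); apply/asboolP; exists q0 => //; split=> //.
  by apply/polyOverP => i; apply/set_predP.
have [m /asboolP[P [PS P0 Pg] <-] Pmin] := ex_minnP Fq0.
have G0 x : x \in S -> x.1 = 0 -> x = 0.
  by case: x => a b /set_predP Gab /= a0; move: Gab; rewrite a0 => /Gfun ->.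
have Psmall q : q \is a polyOver S -> (fst1 q).[g] = 0 -> (size q < size P)%N -> q = 0.
  move=> qS qg; apply: contraTeq => qn; rewrite -leqNgt; apply: Pmin.
  by apply/asboolP; exists q.
have sP : (1 < size P)%N.
  rewrite ltnNge; apply/negP => /size1_polyC e; case/eqP: P0.
  rewrite e; congr (_%:P); apply: G0; first exact: (polyOverP PS).
  by move: Pg; rewrite {1}e /fst1 map_polyC hornerC.
have lS : lead_coef P \in S by apply/polyOverP.
have l0 : (lead_coef P).1 != 0.
  by apply: contraNneq P0 => /(G0 _ lS) /eqP; rewrite lead_coef_eq0.
have dP : (fst1 P)^`().[g] != 0.
  have dPS : P^`() \is a polyOver S.
    by apply/polyOverP => i; rewrite coef_deriv rpredMn //; exact: (polyOverP PS).
  rewrite deriv_map; apply/negP => /eqP dPg.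
  have : P^`() = 0 by apply: Psmall => //; exact: lt_size_deriv.
  move=> /(congr1 (fun p : {poly dual L} => dual_fst p`_(size P).-2)).
  rewrite coef_deriv coef0 raddfMn rmorph0 /=.
  have e : (size P).-2.+1 = (size P).-1 by rewrite prednK // -subn1 subn_gt0.
  rewrite e -lead_coefE -mulr_natr => /eqP.
  rewrite mulf_eq0 (negbTE l0) /= -e; exact/negP/char0.
pose d := - P.[(g, 0) : dual L].2 / (fst1 P)^`().[g].
have Pgd : P.[(g, d) : dual L] = 0.
  by rewrite dual_horner -/fst1 Pg /d mulrC divfK //; congr pair; rewrite addrN.
have main q : q \is a polyOver S -> (fst1 q).[g] = 0 -> q.[(g, d) : dual L] = 0.
  move=> qS qg; have [e [s [r [sS rS er sr]]]] := pseudo_division qS PS P0.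
  have r0 : r = 0.
    apply: Psmall => //; have := congr1 (fun p => (fst1 p).[g]) er.
    rewrite /fst1 map_polyZ rmorphD rmorphM /= hornerZ hornerD hornerM.
    by rewrite -/fst1 qg Pg !mulr0 add0r.
  have := congr1 (horner^~ ((g, d) : dual L)) er.
  rewrite r0 addr0 hornerZ hornerM Pgd mulr0 dual_horner -/fst1 qg.
  set b := _ + _ => /(congr1 snd) /= /eqP.
  rewrite mulr0 addr0 -/(dual_fst _) rmorphXn mulf_eq0 expf_eq0 (negbTE l0) andbF.
  by move/eqP => ->.
exists d, [set x | x \in adjoin S ((g, d) : dual L)]; split.
- split.
    have [h1 h2 h3] := adjoin_subring_closed S ((g, d) : dual L).
    split=> [|x y /asboolP xS /asboolP yS|x y /asboolP xS /asboolP yS]; apply/asboolP => //=.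
      exact: h2.
    exact: h3.
  move=> b /adjoinP[q qS qb]; suff : q.[(g, d) : dual L] = 0 by rewrite -qb => -[].
  by apply: main => //; rewrite dual_horner in qb; case: qb.
- by move=> x Gx; apply: sub_adjoin; apply/set_predP.
- exact: mem_adjoin.
Qed.

(** Zorn's lemma on graphs, starting from the subring generated over [k] by the pairs
    [(f j, (i == j)%:R)], the graph of the partial derivative on polynomials. A maximal graph is
    defined everywhere since each [g] is algebraic over [k(f)]. *)
Theorem dual_derivation n (f : 'I_n -> L) (i : 'I_n) :
  alg_indep c f -> (forall t : 'I_n.+1 -> L, ~ alg_indep c t) ->
  exists D, is_derivation D /\ forall j, D (f j) = (i == j)%:R.
Proof.
move=> hf hdep.
pose h j : dual L := (f j, (i == j)%:R); pose cd := (@dual_const L \o c)%FUN.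
pose G0 := range (mmap cd h).
have G0fst p : dual_fst (mmap cd h p) = mmap c f p.
  apply: (mpoly_morph_eq (a := (@dual_fst L \o mmap cd h)%FUN) (b := mmap c f)) => [x|j] /=.
    by rewrite !mmapC.
  by rewrite !mmapX !mmap1U.
have gG0 : graph G0.
  split; first split.
  - by apply/asboolP; exists 1; rewrite ?rmorph1.
  - by move=> _ _ /asboolP[p _ <-] /asboolP[q _ <-]; apply/asboolP; exists (p - q); rewrite ?rmorphB.
  - by move=> _ _ /asboolP[p _ <-] /asboolP[q _ <-]; apply/asboolP; exists (p * q); rewrite ?rmorphM.
  move=> b [p _ pb]; have := G0fst p; rewrite pb /= => /esym/hf p0.
  by move: pb; rewrite p0 rmorph0 => -[].
have [|G [G0G [Gring Gfun] Gmax]] := Zorn_above gG0.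
  move=> F [A0 FA0] FQ Ftot; split; first split.
  - by apply/asboolP; exists A0 => //; have [[/asboolP]] := FQ A0 FA0.
  - move=> x y /asboolP[A FA Ax] /asboolP[B FB Bx]; apply/asboolP.
    have [AB|BA] := Ftot A B FA FB.
      exists B => //; have [[_ hB _] _] := FQ B FB; apply/asboolP; apply: hB; apply/asboolP => //; exact: AB.
    exists A => //; have [[_ hA _] _] := FQ A FA; apply/asboolP; apply: hA; apply/asboolP => //; exact: BA.
  - move=> x y /asboolP[A FA Ax] /asboolP[B FB Bx]; apply/asboolP.
    have [AB|BA] := Ftot A B FA FB.
      exists B => //; have [[_ _ hB] _] := FQ B FB; apply/asboolP; apply: hB; apply/asboolP => //; exact: AB.
    exists A => //; have [[_ _ hA] _] := FQ A FA; apply/asboolP; apply: hA; apply/asboolP => //; exact: BA.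
  - by move=> b [A FA Ab]; have [_] := FQ A FA; apply.
have Gtot g : exists d, G (g, d).
  have [q [q0 qg qf]] := alg_dependent_root g hf hdep.
  have /choice[lift liftP] i0 : exists x, G0 x /\ dual_fst x = q`_i0.
    by have [p _ <-] := qf i0; exists (mmap cd h p); split; [exists p|].
  pose q' := \poly_(j < size q) lift j : {poly dual L}.
  have q'E : map_poly (@dual_fst L) q' = q.
    apply/polyP => j; rewrite coef_map coef_poly; case: ltnP => jq.
        exact: (liftP j).2.
    by rewrite raddf0 nth_default.
  have [||d [G' [gG' GG' G'g]]] := @graph_extend G g; first by split.
    exists q'; split.
    - move=> j; apply: G0G; rewrite coef_poly; case: ltnP => _; first by case: (liftP j).
      by exists 0; rewrite ?rmorph0.
    - by apply: contraNneq q0 => e; rewrite -q'E e rmorph0.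
    - by rewrite q'E.
  by exists d; rewrite -(Gmax G' GG' gG').
pose S := set_pred Gring : subringClosed (dual L).
have Guniq a b b' : G (a, b) -> G (a, b') -> b = b'.
  move=> /(set_predP Gring) h1 /(set_predP Gring) h2.
  have : ((a, b) : dual L) - ((a, b') : dual L) \in S by exact: rpredB.
  move=> /set_predP; have -> : ((a, b) : dual L) - (a, b') = (0, b - b') by congr pair => /=; rewrite subrr.
  by move=> /Gfun/eqP; rewrite subr_eq0 => /eqP.
have /choice[D DP] := Gtot.
have DS a : ((a, D a) : dual L) \in S by apply/set_predP.
exists D; split; first split.
- move=> a b; apply: (Guniq (a + b)) => //; apply/(set_predP Gring).
  exact: rpredD (DS a) (DS b).
- move=> a b; apply: (Guniq (a * b)) => //; apply/(set_predP Gring).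
  have -> : (a * b, a * D b + b * D a) = ((a, D a) : dual L) * ((b, D b) : dual L).
    by congr pair => /=; ring.
  exact: rpredM (DS a) (DS b).
- move=> x; apply: (Guniq (c x)) => //; apply: G0G; exists x%:MP => //.
  by rewrite mmapC.
- by move=> j; apply: (Guniq (f j)) => //; apply: G0G; exists 'X_j => //; rewrite mmapX mmap1U.
Qed.

End ExtendDerivation.

(** * Derivations and transcendence bases *)

Section DerivationsAlongAMorphism.
Variables (k K F : fieldType) (c : {rmorphism k -> K}) (phi : {rmorphism K -> F}).
Variable V : lmodType F.
Implicit Type E : K -> V.

(** One notion for derivations of a field, for the universal [dX], and for a derivation of the
    larger field composed with [phi]. *)
Definition derivation_along E : Prop :=
  [/\ forall a b, E (a + b) = E a + E b,
      forall a b, E (a * b) = phi a *: E b + phi b *: E a &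
      forall x, E (c x) = 0].

Lemma derivation_along_mmap n (f : 'I_n -> K) E p :
  derivation_along E -> (forall i, E (f i) = 0) -> E (mmap c f p) = 0.
Proof.
case=> ED EM Ec Ef.
have E0 : E 0 = 0 by rewrite -(rmorph0 c) Ec.
have E1 : E 1 = 0 by rewrite -(rmorph1 c) Ec.
have EX a m : E a = 0 -> E (a ^+ m) = 0.
  by move=> Ea; elim: m => [//|m IH]; rewrite exprS EM IH Ea !scaler0 addr0.
have Emm m : E (mmap1 f m) = 0.
  rewrite /mmap1; elim/big_ind: _ => // [x y Ex Ey|i _]; last exact: EX.
  by rewrite EM Ex Ey !scaler0 addr0.
rewrite /mmap; elim/big_ind: _ => // [x y Ex Ey|m _]; first by rewrite ED Ex Ey addr0.
by rewrite EM Ec Emm !scaler0 addr0.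
Qed.

Lemma derivation_along_horner E (q : {poly K}) g :
  derivation_along E -> (forall i, E q`_i = 0) ->
  E q.[g] = phi q^`().[g] *: E g.
Proof.
case=> ED EM Ec; elim/poly_ind: q => [|q a IH] Eq.
  by rewrite deriv0 !horner0 rmorph0 scale0r -(rmorph0 c) Ec.
have Ea : E a = 0 by have := Eq 0%N; rewrite coefD coefMX coefC eqxx add0r.
have {}IH := IH _; rewrite hornerMXaddC ED EM Ea addr0 IH.
  rewrite derivD derivM derivX derivC addr0 mulr1 hornerD hornerM hornerX.
  by rewrite rmorphD rmorphM scalerDl scalerA addrC [phi g * _]mulrC.
by move=> i; have := Eq i.+1; rewrite coefD coefMX coefC addr0.
Qed.

(** A derivation minus its expected expansion is again a derivation, so expansions need only be
    tested on coordinates. *)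
Lemma derivation_along_sub n (E : K -> V) (D : 'I_n -> K -> K) (v : 'I_n -> V) :
  derivation_along E -> (forall i, is_derivation c (D i)) ->
  derivation_along (fun g => E g - \sum_i phi (D i g) *: v i).
Proof.
case=> ED EM Ec hD; split=> [a b|a b|x].
- rewrite ED -!addrA; congr (_ + _); rewrite [RHS]addrCA; congr (_ + _).
  rewrite -opprD -big_split /=; congr (- _); apply: eq_bigr => i _.
  by case: (hD i) => -> _ _; rewrite rmorphD scalerDl.
- rewrite EM !scalerBr !scaler_sumr -!addrA; congr (_ + _).
  rewrite [RHS]addrCA; congr (_ + _); rewrite -opprD -big_split /=.
  congr (- _); apply: eq_bigr => i _; case: (hD i) => _ -> _.
  by rewrite rmorphD !rmorphM !scalerA scalerDl.
- rewrite Ec sub0r big1 ?oppr0 // => i _.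
  by case: (hD i) => _ _ ->; rewrite rmorph0 scale0r.
Qed.

Hypothesis char0 : forall n, n.+1%:R != 0 :> K.
Variables (n : nat) (f : 'I_n -> K).
Hypotheses (hf : alg_indep c f)
  (hdep : forall t : 'I_n.+1 -> K, ~ alg_indep c t).

(* A minimal equation of [g] over [k(f)] is separable. *)
Lemma derivation_along_eq0 E : derivation_along E ->
  (forall i, E (f i) = 0) -> forall g, E g = 0.
Proof.
move=> hE Ef g.
have [q0 [q00 q0g q0f]] := alg_dependent_root g hf hdep.
pose Q (q : {poly K}) := [/\ q != 0, q.[g] = 0 & forall i, mpoly_values c f q`_i].
have exQ : exists m, `[< exists2 q, Q q & size q = m >].
  by exists (size q0); apply/asboolP; exists q0.
have [m /asboolP[q [qn qg qf] <-] qmin] := ex_minnP exQ.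
have sq : (1 < size q)%N.
  rewrite ltnNge; apply/negP => /size1_polyC e; case/eqP: qn.
  by move: qg; rewrite {1}e hornerC => q00'; rewrite e q00'.
have dg : q^`().[g] != 0.
  apply/negP => /eqP dg0.
  have : (size q <= size q^`())%N.
    apply: qmin; apply/asboolP; exists q^`() => //; split=> //.
      rewrite -size_poly_gt0 (leq_trans _ (_ : (size q).-1 <= _)%N) //.
        by rewrite -subn1 subn_gt0.
      rewrite leqNgt; apply/negP => h.
      have := nth_default 0 (_ : size q^`() <= (size q).-2)%N.
      have e : (size q).-2.+1 = (size q).-1 by rewrite prednK // -subn1 subn_gt0.
      rewrite -ltnS e => /(_ h); rewrite coef_deriv e -lead_coefE -mulr_natr => /eqP.
      by rewrite mulf_eq0 lead_coef_eq0 (negbTE qn) /= -e; exact/negP/char0.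
    move=> i; rewrite coef_deriv; have [p _ <-] := qf i.+1.
    by exists (p *+ i.+1); rewrite ?raddfMn.
  by apply/negP; rewrite -ltnNge lt_size_deriv.
have Eq i : E q`_i = 0.
  by have [p _ <-] := qf i; exact: derivation_along_mmap.
have := derivation_along_horner g hE Eq; rewrite qg.
have -> : E 0 = 0 by case: hE => _ _ Ec; rewrite -(rmorph0 c) Ec.
by move/esym/eqP; rewrite scaler_eq0 fmorph_eq0 (negbTE dg) => /eqP.
Qed.

End DerivationsAlongAMorphism.

Section Frames.
Variables (k K : fieldType) (c : {rmorphism k -> K}).
Hypothesis char0 : forall n, n.+1%:R != 0 :> K.
Variables (n : nat) (f : 'I_n -> K).
Hypotheses (hf : alg_indep c f)
  (hdep : forall t : 'I_n.+1 -> K, ~ alg_indep c t).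

(** The partial derivatives in the coordinates [u], characterized by duality rather than by [u]
    being a transcendence basis. *)
Definition frame (u : 'I_n -> K) (D : 'I_n -> K -> K) : Prop :=
  (forall i, is_derivation c (D i)) /\ forall i j, D i (u j) = (i == j)%:R.

Lemma is_derivation_along (D : K -> K) :
  is_derivation c D -> @derivation_along _ _ _ c idfun K^o D.
Proof. by []. Qed.

(** Vanishing on the known transcendence basis [f] suffices, and values on [u] determine those on
    [f]: the matrix of derivatives of [f] along [u] times that of [u] along [f] is 1 by the chain
    rule, and the reverse product is then 1 because the matrices are square. *)
Lemma frame_eq0 (F : fieldType) (phi : {rmorphism K -> F}) (V : lmodType F)
    (E : K -> V) u D :
  frame u D -> derivation_along c phi E -> (forall i, E (u i) = 0) ->
  forall g, E g = 0.
Proof.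
move=> [hD hu] hE Eu.
have /choice[D0 D0P] i := dual_derivation char0 i hf hdep.
have chain (G : fieldType) (W : lmodType G) (psi : {rmorphism K -> G}) (H : K -> W) (g : K) :
    derivation_along c psi H -> H g = \sum_j psi (D0 j g) *: H (f j).
  move=> hH; apply/eqP; rewrite -subr_eq0; apply/eqP.
  have h := derivation_along_sub (fun j => H (f j)) hH (fun i => (D0P i).1).
  apply: (derivation_along_eq0 char0 hf hdep h) => i.
  rewrite (bigD1 i) //= (D0P i).2 eqxx rmorph1 scale1r big1 ?addr0 ?subrr //.
  by move=> j ji; rewrite (D0P j).2 (negbTE ji) rmorph0 scale0r.
pose M := \matrix_(i, j) D i (f j); pose N := \matrix_(j, l) D0 j (u l).
have MN : M *m N = 1%:M.
  apply/matrixP => i l; rewrite !mxE -hu (chain _ _ _ _ _ (is_derivation_along (hD i))).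
  by apply: eq_bigr => j _; rewrite !mxE mulrC.
have NM := mulmx1C MN.
apply: (derivation_along_eq0 char0 hf hdep hE) => j.
have e : E (f j) = \sum_j' phi ((N *m M) j' j) *: E (f j').
  rewrite NM (bigD1 j) //= mxE eqxx rmorph1 scale1r big1 ?addr0 // => j' ne.
  by rewrite mxE (negbTE ne) rmorph0 scale0r.
rewrite e; under eq_bigr do rewrite mxE rmorph_sum scaler_suml.
rewrite exchange_big big1 //= => l _.
under eq_bigr do rewrite rmorphM mulrC -scalerA.
rewrite -scaler_sumr; have := Eu l; rewrite (chain _ _ _ _ _ hE) => h.
by under eq_bigr do rewrite mxE; rewrite h scaler0.
Qed.

Lemma frame_chain (F : fieldType) (phi : {rmorphism K -> F}) (V : lmodType F)
    (E : K -> V) u D g :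
  frame u D -> derivation_along c phi E -> E g = \sum_i phi (D i g) *: E (u i).
Proof.
move=> hu hE; apply/eqP; rewrite -subr_eq0; apply/eqP; case: (hu) => hD uD.
have h := derivation_along_sub (fun j => E (u j)) hE hD.
apply: (frame_eq0 hu h) => i.
rewrite (bigD1 i) //= uD eqxx rmorph1 scale1r big1 ?addr0 ?subrr //.
by move=> j ji; rewrite uD (negbTE ji) rmorph0 scale0r.
Qed.

End Frames.

(** * Lifting logarithmic derivations along an integral extension *)

Section PrimeElements.
Variables (L : fieldType) (B : subringClosed L).

Definition multiples (v : L) : set L := [set x | exists2 b, b \in B & x = v * b].

Lemma multiples_ideal v : v \in B -> ideal_in B (multiples v).
Proof.
move=> vB; split.
- by move=> _ [b bB ->]; rewrite rpredM.
- by exists 0; rewrite ?rpred0 ?mulr0.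
- by move=> _ _ [a aB ->] [b bB ->]; exists (a + b); rewrite ?rpredD ?mulrDr.
- by move=> a _ aB [b bB ->]; exists (a * b); rewrite ?rpredM // mulrCA.
Qed.

Variables (n : nat) (u : 'I_n -> L) (I : pred 'I_n).
Hypotheses (uB : forall j, u j \in B) (u0 : forall j, u j != 0).
Hypothesis uprime : forall j, I j -> prime_in B (multiples (u j)).

Definition unit_in (e : L) : Prop := [/\ e \in B, e != 0 & e^-1 \in B].

Lemma factor_dividing_product (s : seq 'I_n) g b : all I s ->
  g \in B -> b \in B -> g * b = \prod_(j <- s) u j ->
  exists e s', [/\ unit_in e, all I s' & g = e * \prod_(j <- s') u j].
Proof.
elim: s g b => [|j s IH] g b.
  move=> _ gB bB; rewrite big_nil => gb; have g0 : g != 0.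
    by apply/eqP => g0; move/eqP: gb; rewrite g0 mul0r eq_sym oner_eq0.
  exists g, [::]; rewrite big_nil mulr1; split=> //; split=> //.
  by rewrite -[g^-1]mulr1 -gb mulKf.
move=> /= /andP[Ij Is] gB bB; rewrite big_cons => gb.
have sB : \prod_(i <- s) u i \in B by rewrite rpred_prod.
have [_ _ hj] := uprime Ij.
have [|[g1 g1B e]|[b1 b1B e]] := hj g b gB bB.
- by exists (\prod_(i <- s) u i).
- have [|e' [s' [h1 h2 h3]]] := IH g1 b Is g1B bB.
    by apply: (mulfI (u0 j)); rewrite -gb e mulrA.
  by exists e', (j :: s'); rewrite /= Ij h2 big_cons e h3 mulrCA.
- apply: (IH g b1) => //.
  by apply: (mulfI (u0 j)); rewrite -gb e mulrCA.
Qed.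

(** The product [h] of the [u j] lies in every prime containing [g], hence in the radical of [g B],
    so [g] divides a power of [h]. *)
Lemma factor_prime_support g : g \in B ->
  (forall P, prime_in B P -> P g -> exists2 j, I j & P (u j)) ->
  exists e s, [/\ unit_in e, all I s & g = e * \prod_(j <- s) u j].
Proof.
move=> gB hg; pose h := \prod_(j | I j) u j.
have hB : h \in B by rewrite rpred_prod.
have [[N [b bB hN]]|no] := pselect (exists N, multiples g (h ^+ N)).
  pose s := flatten (nseq N [seq j <- enum 'I_n | I j]).
  apply: (@factor_dividing_product s g b) => //.
    by rewrite /s; elim: (N) => //= N' IH; rewrite all_cat IH andbT filter_all.
  rewrite -hN /s; elim: (N) => /= [|N' IH]; first by rewrite expr0 big_nil.
  by rewrite exprS big_cat IH /= big_filter big_enum_cond.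
have [|P [hP gP hnP]] := prime_avoiding (multiples_ideal gB) hB.
  by move=> N hN; apply: no; exists N.
have [|j Ij Pj] := hg P hP; first by apply: gP; exists 1; rewrite ?rpred1 ?mulr1.
case: hnP; rewrite /h (bigD1 j) //= mulrC.
by case: hP => -[_ _ _ PM] _ _; apply: PM => //; rewrite rpred_prod.
Qed.

Hypothesis udist : forall i j, I i -> I j -> i != j -> ~ multiples (u i) (u j).

Lemma factor_at j (e : L) (s : seq 'I_n) : I j -> all I s -> unit_in e ->
  exists m v, [/\ v \in B, ~ multiples (u j) v &
    e * \prod_(i <- s) u i = u j ^+ m * v].
Proof.
move=> Ij sI [eB e0 eVB]; have [[_ _ _ PM] P1 hP] := uprime Ij.
elim: s sI => [_|i s IH /= /andP[Ii /IH{IH}[m [v [vB nv ev]]]]].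
  exists 0%N, e; rewrite big_nil expr0 mul1r mulr1; split=> // he; apply: P1.
  by rewrite -(mulVf e0); exact: PM.
rewrite big_cons mulrCA ev; have [->|ne] := eqVneq i j.
  by exists m.+1, v; rewrite exprS mulrA.
exists m, (u i * v); rewrite rpredM // mulrCA; split=> //.
move=> /(hP _ _ (uB i) vB)[]//; apply: udist => //; by rewrite eq_sym.
Qed.

End PrimeElements.

Lemma derivation_horner (k L : fieldType) (c : {rmorphism k -> L}) (E : L -> L)
    (q : {poly L}) g :
  is_derivation c E -> E q.[g] = (map_poly E q).[g] + q^`().[g] * E g.
Proof.
move=> [ED EM Ec]; have E0 : E 0 = 0 by rewrite -[X in E X](rmorph0 c) Ec.
have mapE p i : (map_poly E p)`_i = E p`_i by exact: coef_map_id0.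
elim/poly_ind: q => [|q a IH].
  by rewrite deriv0 !horner0 mul0r addr0 E0 /map_poly size_poly0 poly_def big_ord0 horner0.
have -> : map_poly E (q * 'X + a%:P) = map_poly E q * 'X + (E a)%:P.
  apply/polyP => i; rewrite mapE !coefD !coefMX !coefC ED mapE.
  by case: i => [|i] /=; rewrite ?E0.
rewrite !hornerMXaddC ED EM IH derivD derivM derivX derivC addr0 mulr1.
by rewrite hornerD hornerM hornerX; ring.
Qed.

Section Descend.
Variables (k L : fieldType) (c : {rmorphism k -> L}).
Hypothesis char0 : forall n, n.+1%:R != 0 :> L.
Variables (B A0 : subringClosed L) (C : {pred L}) (Th : L -> L).
Variables (n : nat) (u : 'I_n -> L) (I : pred 'I_n).
Local Notation mult := (multiples B).
Hypotheses (natB : forall n, (n.+1%:R)^-1 \in B).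
Hypotheses (A0B : forall a, a \in A0 -> a \in B) (CB : forall a, a \in C -> a \in B).
Hypothesis fracC : forall b, b \in B ->
  exists a a', [/\ a \in C, a' \in C, unit_in B a' & b * a' = a].
Hypothesis intC : forall b, b \in C ->
  exists q : {poly L}, [/\ q \is monic, q \is a polyOver A0 & root q b].
Hypothesis Thder : is_derivation c Th.
Hypothesis ThA0 : forall a, a \in A0 -> Th a \in B.
Hypotheses (uB : forall j, u j \in B) (u0 : forall j, u j != 0).
Hypothesis uprime : forall j, I j -> prime_in B (mult (u j)).
Hypothesis udist : forall i j, I i -> I j -> i != j -> ~ mult (u i) (u j).
Hypothesis Thlog : forall j, I j -> exists t m v b,
  [/\ t = u j ^+ m.+1 * v, v \in B, ~ mult (u j) v, b \in B & Th t = t * b].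

(* One pole along [u j] is removed: modulo [u j] the derivation [u j * g * Th]
   vanishes on [A0], over which everything is integral, hence vanishes. *)
Let descend_step (g : L) j : I j -> g \in B ->
  (forall b, b \in B -> u j * g * Th b \in B) ->
  (forall i, I i -> mult (u i) (u j * g * Th (u i))) ->
  (forall b, b \in B -> g * Th b \in B) /\
  (forall i, I i -> mult (u i) (g * Th (u i))).
Proof.
move=> Ij gB EB Eu; pose E x := u j * g * Th x; pose P := mult (u j).
have [ThD ThM Thc] := Thder.
have Eder : is_derivation c E.
  split=> [a b|a b|x]; rewrite /E ?ThD ?ThM ?Thc; ring.
have [ED EM Ec] := Eder.
have hP := uprime Ij; have [idP P1 PM'] := hP.
have [PB P0 PD PM] := idP.
(* This makes [E] act on the domain [B / P]; the hypothesis on [E (u j)] is what it takes. *)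
have EP x : P x -> P (E x).
  move=> [b bB ->]; rewrite EM; apply: PD; first by exists (E b); rewrite ?EB.
  by apply: PM => //; exact: Eu.
have EA0 a : a \in A0 -> P (E a).
  by move=> aA; exists (g * Th a); rewrite ?rpredM ?ThA0 // /E mulrA.
have EC b : b \in C -> P (E b).
  move=> bC; have bB := CB bC.
  (* The monic equation of integrality is relaxed to a leading coefficient outside [P], so that the
     derivative of [q] qualifies too if it vanishes at [b] modulo [P]. A shortest [q] is therefore
     separable at [b]. *)
  pose Q (q : {poly L}) := [/\ q \is a polyOver B, forall i, P (E q`_i), P q.[b] & ~ P (lead_coef q)].
  have exQ : exists m, `[< exists2 q, Q q & size q = m >].
    have [q [qmon /polyOverP qA /eqP qb]] := intC bC.
    exists (size q); apply/asboolP; exists q => //; split.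
    - by apply/polyOverP => i; exact: A0B.
    - by move=> i; exact: EA0.
    - by rewrite qb.
    - by rewrite (monicP qmon).
  have [m /asboolP[q [qB qE qb ql] <-] qmin] := ex_minnP exQ.
  have qBi := polyOverP qB.
  have hornB p : p \is a polyOver B -> p.[b] \in B.
    by move=> /polyOverP pB; rewrite horner_coef rpred_sum // => i _; rewrite rpredM ?rpredX.
  have sq : (1 < size q)%N.
    rewrite ltnNge; apply/negP => /size1_polyC e; apply: ql.
    by move: qb; rewrite e hornerC lead_coefC.
  have e : (size q).-2.+1 = (size q).-1 by rewrite prednK // -subn1 subn_gt0.
  (* Characteristic 0 enters here: the integer [(size q).-1] is invertible in [B], so the derivative
     keeps a leading coefficient outside [P]. *)
  have ldq : ~ P (q^`()`_(size q).-2).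
    rewrite coef_deriv e -lead_coefE -e => h; apply: ql.
    have -> : lead_coef q = ((size q).-2.+1%:R)^-1 * (lead_coef q *+ (size q).-2.+1).
      by rewrite -[lead_coef q *+ _]mulr_natl mulKf.
    by apply: PM.
  have dq0 : q^`()`_(size q).-2 != 0 by apply/eqP => h; apply: ldq; rewrite h.
  have sdq : size q^`() = (size q).-1.
    apply/eqP; rewrite eqn_leq -ltnS prednK ?lt_size_deriv ?(ltnW sq) //=; last first.
      by rewrite -size_poly_gt0 ltnW.
    by rewrite -e ltnNge; apply/negP => /(nth_default 0)/eqP; rewrite (negbTE dq0).
  have dqB : q^`() \is a polyOver B.
    by apply/polyOverP => i; rewrite coef_deriv rpredMn.
  have ndq : ~ P q^`().[b].
    move=> h; have : (size q <= size q^`())%N.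
      apply: qmin; apply/asboolP; exists q^`() => //; split=> //.
        move=> i; rewrite coef_deriv -mulr_natr EM.
        have -> : E i.+1%:R = 0 by rewrite -(rmorph_nat c) Ec.
        by rewrite mulr0 add0r; apply: (PM); [rewrite rpred_nat|exact: qE].
      by rewrite lead_coefE sdq.
    by rewrite sdq; case: (size q) sq => //= a _; rewrite ltnn.
  (* Modulo [P], applying [E] to [q.[b]] leaves the derivative of [q] at [b] times [E b], and the
     first factor is outside [P]. *)
  have := EP _ qb; rewrite (derivation_horner _ _ Eder).
  have E0 : E 0 = 0 by rewrite -[X in E X](rmorph0 c) Ec.
  have mP : P (map_poly E q).[b].
    rewrite horner_coef; apply: ideal_sum idP _ => i _; rewrite mulrC.
    by apply: (PM); [exact: rpredX|rewrite coef_map_id0 //; exact: qE].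
  move=> h; have := ideal_sub idP h mP; rewrite addrAC subrr add0r.
  by case/(PM' _ _ (hornB _ dqB) (EB _ bB)).
have EBP b : b \in B -> P (E b).
  move=> bB; have [a [a' [aC a'C [a'B a'0 a'VB] e]]] := fracC bB.
  have : P (a' * E b).
    have -> : a' * E b = E a - b * E a' by rewrite -e EM; ring.
    by apply: (ideal_sub idP); [exact: EC|apply: (PM) => //; exact: EC].
  by move=> h; rewrite -[E b](mulKf a'0); exact: PM.
have Eg x : E x = u j * (g * Th x) by rewrite /E mulrA.
have gTh b : b \in B -> g * Th b \in B.
  by move=> /EBP[w wB]; rewrite Eg => /(mulfI (u0 j)) ->.
split=> // i Ii; have [eij|ne] := eqVneq i j; last first.
  have [_ _ hi] := uprime Ii; have := Eu i Ii; rewrite -mulrA.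
  case/(hi _ _ (uB j) (gTh _ (uB i))) => // h.
  by case: (udist Ii Ij ne).
(* In the product rule for [t = u j ^+ m.+1 * v], both [E t] and [u j ^+ m.+1 * E v] are in
   [u j ^+ m.+2 B], hence so is [m.+1%:R * u j ^+ m * v * E (u j)]. Cancelling [u j ^+ m.+1] leaves
   [v * (g * Th (u j))] in [u j B], and [v] is outside this prime. *)
rewrite {i Ii}eij; have [t [m [v [b [et vB nv bB Tht]]]]] := Thlog Ij.
have [w wB Ew] := EBP v vB.
have EX : E (u j ^+ m.+1) = m.+1%:R * u j ^+ m * E (u j).
  elim: m {et} => [|m IH]; first by rewrite expr0 expr1 !mul1r.
  by rewrite exprS EM IH -[m.+2]addn1 natrD; rewrite !exprS; ring.
have Et : E t = u j ^+ m.+2 * (g * v * b) by rewrite Eg Tht et !exprS; ring.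
have : mult (u j) (v * (g * Th (u j))).
  exists ((m.+1%:R)^-1 * (g * v * b - w)).
    by rewrite rpredM ?natB // rpredB ?rpredM.
  apply: (mulfI (expf_neq0 m.+1 (u0 j))); apply: (mulfI (char0 m)).
  have -> : m.+1%:R * (u j ^+ m.+1 * (v * (g * Th (u j)))) =
      v * (m.+1%:R * u j ^+ m * E (u j)) by rewrite Eg exprS; ring.
  have -> : v * (m.+1%:R * u j ^+ m * E (u j)) = E t - u j ^+ m.+1 * E v.
    by rewrite -EX et EM; ring.
  by rewrite Et Ew !exprS; move: (_.+1%:R) (char0 m) => x x0; field.
by case/(PM' _ _ vB (gTh _ (uB j))).
Qed.

(** In the application [B] is the local ring at [x], [C] the ring of functions on the preimage of an
    affine [V], and [A0] the ring of functions pulled back from [V]. The factors that clear the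
    poles are stripped one by one, with both stability conditions carried along. *)
Lemma log_derivation_descends (s : seq 'I_n) : all I s ->
  (forall b, b \in B -> (\prod_(j <- s) u j) * Th b \in B) ->
  (forall i, I i -> mult (u i) ((\prod_(j <- s) u j) * Th (u i))) ->
  (forall b, b \in B -> Th b \in B) /\ (forall i, I i -> mult (u i) (Th (u i))).
Proof.
elim: s => [_|j s IH /= /andP[Ij sI]]; rewrite ?big_nil ?big_cons.
  move=> h1 h2; split=> [b /h1|i /h2]; by rewrite mul1r.
move=> h1 h2; have [|h3 h4] := descend_step Ij _ h1 h2; first by rewrite rpred_prod.
exact: IH.
Qed.

End Descend.

(** * Forms and closed sets of projective space *)

Section HomogeneousForms.
Variable k : comNzRingType.

Lemma dhomog_meval_scale n d (p : {mpoly k[n]}) a (v : 'I_n -> k) :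
  p \is d.-homog -> p.@[fun i => a * v i] = a ^+ d * p.@[v].
Proof.
move=> /dhomogP hp; rewrite !mevalE mulr_sumr big_seq [RHS]big_seq.
apply: eq_bigr => m /hp /= <-; rewrite mulrCA; congr (_ * _).
by rewrite mdegE -prodrXr -big_split; apply: eq_bigr => i _; rewrite exprMn.
Qed.

Definition subst n m (F : 'I_n -> {mpoly k[m]}) (p : {mpoly k[n]}) : {mpoly k[m]} :=
  mmap (@mpolyC m k) F p.

Lemma meval_subst n m (F : 'I_n -> {mpoly k[m]}) p v :
  (subst F p).@[v] = p.@[fun i => (F i).@[v]].
Proof.
apply: (mpoly_morph_eq (a := (meval v \o mmap (@mpolyC m k) F)%FUN)
                       (b := meval (fun i => (F i).@[v]))) => [x|i] /=.
  by rewrite mmapC !mevalC.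
by rewrite mmapX mmap1U mevalXU.
Qed.

Lemma dhomog_subst n m d e (F : 'I_n -> {mpoly k[m]}) p :
  p \is d.-homog -> (forall i, F i \is e.-homog) -> subst F p \is (d * e).-homog.
Proof.
move=> /dhomogP hp hF; rewrite /subst /mmap big_seq rpred_sum // => mm /hp /= <-.
rewrite mul_mpolyC rpredZ // /mmap1 mdegE big_distrl /=.
elim: (index_enum _) => [|i r IH]; first by rewrite !big_nil dhomog1.
by rewrite !big_cons dhomogM // mulnC dhomogMn.
Qed.

End HomogeneousForms.

Section Points.
Variable k : closedFieldType.

Definition crd N (x : proj_space k N) (i : 'I_N.+1) : k := vpick (val x) 0 i.

Lemma heval_crd N (x : proj_space k N) p : heval x p = p.@[crd x].
Proof. by []. Qed.

Lemma heval_form N (x : proj_space k N) i : heval x 'X_i = crd x i.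
Proof. exact: mevalXU. Qed.

Lemma point_line N (x : proj_space k N) :
  vpick (val x) != 0 /\ val x = <[vpick (val x)]>%VS.
Proof.
have d1 := valP x; have v0 : vpick (val x) != 0.
  by rewrite vpick0 -dimv_eq0 (eqP d1).
split=> //; apply/esym/eqP; rewrite eqEdim -memvE memv_pick (eqP d1).
by rewrite dim_vline v0.
Qed.

Lemma crd_neq0 N (x : proj_space k N) : exists i, crd x i != 0.
Proof.
have [v0 _] := point_line x; apply: contrapT => /forallNP h; case/eqP: v0.
by apply/rowP => i; rewrite mxE; have /negP/negPn/eqP := h i.
Qed.

Lemma crd_line N (x : proj_space k N) (v : 'rV[k]_N.+1) :
  val x = <[v]>%VS -> exists2 a, a != 0 & forall i, crd x i = a * v 0 i.
Proof.
move=> e; have [v0 _] := point_line x.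
have /vlineP[a ea] : vpick (val x) \in <[v]>%VS by rewrite -e memv_pick.
exists a; first by apply: contraNneq v0 => a0; rewrite ea a0 scale0r.
by move=> i; rewrite /crd ea mxE.
Qed.

Lemma heval_line N (x : proj_space k N) (v : 'rV[k]_N.+1) :
  val x = <[v]>%VS -> exists2 a, a != 0 &
    forall d (p : {mpoly k[N.+1]}), p \is d.-homog -> heval x p = a ^+ d * p.@[v 0].
Proof.
move=> /crd_line[a a0 ea]; exists a => // d p hp.
by rewrite -dhomog_meval_scale //; apply: meval_eq => i; rewrite -ea.
Qed.

Lemma point_of N (v : 'I_N.+1 -> k) : (exists i, v i != 0) ->
  exists x : proj_space k N, exists2 a, a != 0 & forall i, crd x i = a * v i.
Proof.
move=> [i vi]; pose r := \row_j v j.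
have r0 : r != 0 by apply: contraNneq vi => /rowP/(_ i); rewrite !mxE => ->.
have d1 : \dim <[r]>%VS == 1%N by rewrite dim_vline r0.
exists (Sub <[r]>%VS d1).
have [|a a0 ea] := @crd_line _ (Sub <[r]>%VS d1) r; first by rewrite SubK.
by exists a => // j; rewrite ea mxE.
Qed.

Lemma point_eq N (x y : proj_space k N) a :
  a != 0 -> (forall i, crd x i = a * crd y i) -> x = y.
Proof.
move=> a0 h; apply: val_inj; have [_ ->] := point_line x; have [_ ->] := point_line y.
have -> : vpick (val x) = a *: vpick (val y).
  by apply/rowP => i; rewrite mxE -[LHS]/(crd x i) h.
apply/vspaceP => w; apply/vlineP/vlineP => -[b ->].
  by exists (b * a); rewrite scalerA.
by exists (b / a); rewrite scalerA divfK.
Qed.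

Lemma heval_subst N M (F : 'I_M.+1 -> {mpoly k[N.+1]}) p (x : proj_space k N) :
  heval x (subst F p) = p.@[fun i => heval x (F i)].
Proof. exact: meval_subst. Qed.

Lemma meval_dhomog0 n d (p : {mpoly k[n]}) : p \is d.+1.-homog -> p.@[fun=> 0] = 0.
Proof.
move=> hp; have e := dhomog_meval_scale 0 (fun=> 0) hp.
by rewrite exprS !mul0r in e; rewrite -[RHS]e; apply: meval_eq => i; rewrite ?mul0r.
Qed.

End Points.

Section ClosedSets.
Variables (k : closedFieldType) (N : nat).
Implicit Types (S A B D E Z : set (proj_space k N)) (p g : {mpoly k[N.+1]}).

Definition vanishes_on S p : Prop := forall x, S x -> heval x p = 0.

Lemma closed_separate Z x : zariski_closed Z -> ~ Z x ->
  exists d p, [/\ p \is d.-homog, vanishes_on Z p & heval x p != 0].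
Proof.
move=> [T [Thom ZT]] /ZT/existsNP[p /not_implyP[Tp /eqP px]].
by have [d hd] := Thom p Tp; exists d, p; split=> // z /ZT; exact.
Qed.

Lemma closed_of_separate Z :
  (forall x, ~ Z x -> exists d p, [/\ p \is d.-homog, vanishes_on Z p & heval x p != 0]) ->
  zariski_closed Z.
Proof.
move=> h; exists [set p | (exists d, p \is d.-homog) /\ vanishes_on Z p].
split=> [p [] //|x]; split=> [Zx p [_]|hx]; first exact.
apply: contrapT => /h[d [p [hd pZ /eqP]]]; apply; apply: hx.
by split=> //; exists d.
Qed.

Definition closure E : set (proj_space k N) :=
  [set x | forall d p, p \is d.-homog -> vanishes_on E p -> heval x p = 0].

Lemma sub_closure E : E `<=` closure E.
Proof. by move=> x Ex d p _; apply. Qed.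

Lemma closure_min E Z : zariski_closed Z -> E `<=` Z -> closure E `<=` Z.
Proof.
move=> hZ EZ x cx; apply: contrapT => /(closed_separate hZ)[d [p [hd pZ /eqP]]].
by apply; apply: (cx d p hd) => z Ez; apply: pZ; exact: EZ.
Qed.

Lemma closure_closed E : zariski_closed (closure E).
Proof.
apply: closed_of_separate => x /existsNP[d /existsNP[p /not_implyP[hd /not_implyP[pE /eqP px]]]].
by exists d, p; split=> // z cz; exact: (cz d).
Qed.

Lemma closure_irreducible E : irreducible_set E -> irreducible_set (closure E).
Proof.
move=> [[x Ex] irr]; split; first by exists x; exact: sub_closure.
move=> A B hA hB cAB; have [|h|h] := irr A B hA hB.
- by apply: subset_trans cAB; exact: sub_closure.
- by left; exact: closure_min.
- by right; exact: closure_min.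
Qed.

Lemma irreducible_vanish D p q d e : irreducible_set D -> p \is d.-homog ->
  q \is e.-homog -> vanishes_on D (p * q) -> vanishes_on D p \/ vanishes_on D q.
Proof.
move=> [_ irr] hp hq pq; apply: (irr _ _ (closed_hypersurface hp) (closed_hypersurface hq)) => x /pq.
by rewrite hevalM => /eqP; rewrite mulf_eq0 => /orP[]/eqP; [left|right].
Qed.

(** The union of a chain of irreducible sets is irreducible, so there is a maximal irreducible
    subset of [S] above [D]. Its closure is irreducible and in [S], hence equal to it. *)
Lemma component_above D S : irreducible_set D -> D `<=` S -> zariski_closed S ->
  exists2 R, irreducible_component S R & D `<=` R.
Proof.
move=> hD DS hS.
have [||R [DR [hR RS] Rmax]] :=
    @Zorn_above _ [set E | irreducible_set E /\ E `<=` S] D => //.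
  move=> F [A0 FA0] FQ Ftot; split; last by move=> x [A /FQ[_]]; apply.
  split; first by have [[[x A0x] _] _] := FQ A0 FA0; exists x, A0.
  move=> A B hA hB FAB; apply: contrapT => /not_orP[].
  move=> /existsNP[x /not_implyP[[E1 FE1 E1x] Ax]] /existsNP[y /not_implyP[[E2 FE2 E2y] By]].
  have [E [FE Ex Ey]] : exists E, [/\ F E, E x & E y].
    by have [h|h] := Ftot E1 E2 FE1 FE2; [exists E2|exists E1]; split=> //; exact: h.
  have [[_ irr] _] := FQ E FE.
  have EAB : E `<=` A `|` B by move=> z Ez; apply: FAB; exists E.
  by have [h|h] := irr A B hA hB EAB; [apply: Ax|apply: By]; exact: h.
have Rcl : closure R = R.
  apply: Rmax; first exact: sub_closure.
  by split; [exact: closure_irreducible|exact: closure_min].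
exists R => //; split=> //; first by rewrite -Rcl; exact: closure_closed.
by move=> D' _ hD' RD' D'S; apply: Rmax.
Qed.

End ClosedSets.

(** * Values of rational functions *)

Section RationalFunctions.
Variables (k : closedFieldType) (X : proj_variety k).
Local Notation form := {mpoly k[(ambient X).+1]}.
Implicit Types (f g : ratfun X) (x z : ambient_space X).

Lemma addE f g : f + g = ratfun_add f g. Proof. by []. Qed.
Lemma mulE f g : f * g = ratfun_mul f g. Proof. by []. Qed.

Lemma ratfun_const_additive : additive (ratfun_const X).
Proof.
move=> a b; apply: (addIr (ratfun_const X b)); rewrite subrK addE ratio_add.
by apply/ratioP => x _; rewrite !heval_frac; ring.
Qed.
Lemma ratfun_const_multiplicative : multiplicative (ratfun_const X).
Proof.
split=> // a b; rewrite mulE ratio_mul.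
by apply/ratioP => x _; rewrite !heval_frac; ring.
Qed.
HB.instance Definition _ := GRing.isAdditive.Build k (ratfun X) (ratfun_const X)
  ratfun_const_additive.
HB.instance Definition _ := GRing.isMultiplicative.Build k (ratfun X)
  (ratfun_const X) ratfun_const_multiplicative.

Lemma has_value_ratio (a : frac X) x : heval x (den a) != 0 ->
  has_value (ratio a) x (heval x (num a) / heval x (den a)).
Proof. by exists a. Qed.

Lemma has_valueD f g x a b :
  has_value f x a -> has_value g x b -> has_value (f + g) x (a + b).
Proof.
move=> [p [-> dp ->]] [q [-> dq ->]]; rewrite addE ratio_add.
exists (frac_add p q); rewrite !heval_frac mulf_neq0 //; split=> //.
by rewrite addf_div.
Qed.

Lemma has_valueM f g x a b :
  has_value f x a -> has_value g x b -> has_value (f * g) x (a * b).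
Proof.
move=> [p [-> dp ->]] [q [-> dq ->]]; rewrite mulE ratio_mul.
exists (frac_mul p q); rewrite !heval_frac mulf_neq0 //; split=> //.
by rewrite mulf_div.
Qed.

Lemma has_value_const x a : has_value (ratfun_const X a) x a.
Proof.
by exists (frac_const X a); rewrite !heval_frac oner_eq0 divr1.
Qed.

Lemma has_value0 x : has_value (0 : ratfun X) x 0.
Proof. by rewrite -(rmorph0 (ratfun_const X)); exact: has_value_const. Qed.

Lemma has_value1 x : has_value (1 : ratfun X) x 1.
Proof. by rewrite -[in X in has_value X](rmorph1 (ratfun_const X)); exact: has_value_const. Qed.

Lemma has_valueN f x a : has_value f x a -> has_value (- f) x (- a).
Proof.
move=> h; rewrite -mulN1r -[- a]mulN1r; apply: has_valueM => //.
rewrite -[in X in has_value X](rmorph1 (ratfun_const X)) -rmorphN.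
exact: has_value_const.
Qed.

Lemma has_valueB f g x a b :
  has_value f x a -> has_value g x b -> has_value (f - g) x (a - b).
Proof. by move=> hf /has_valueN; exact: has_valueD. Qed.

Lemma has_valueV f x a : points X x -> a != 0 ->
  has_value f x a -> has_value f^-1 x a^-1.
Proof.
move=> Xx a0 [p [-> dp ea]].
have np : heval x (num p) != 0.
  by apply: contraNneq a0 => n0; rewrite ea n0 mul0r.
have [d [hn hd _]] := fracP p.
have hq : frac_pair (den p, num p).
  by apply/asboolP; split; [exists d|exists x].
exists (mk_frac hq); split=> //; last by rewrite ea invf_div.
have e : ratio p * ratio (mk_frac hq) = 1.
  rewrite mulE ratio_mul -[1]/(ratio (frac_const X 1)).
  by apply/ratioP => y _; rewrite !heval_frac /=; ring.
by rewrite -[RHS](mulKf (_ : ratio p != 0)) ?e ?mulr1 //; apply: contraTneq isT => p0;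
   have := oner_neq0 (ratfun X); rewrite -e p0 mul0r eqxx.
Qed.

(** The value may come from another fraction of the same function, so this holds also where [den a]
    vanishes. *)
Lemma has_value_num (a : frac X) x c : points X x ->
  has_value (ratio a) x c -> heval x (num a) = c * heval x (den a).
Proof.
move=> Xx [b [/ratioP ab db ->]].
by rewrite mulrAC -(ab x Xx) mulfK.
Qed.

Lemma ratfun_eq f g d (h : form) : h \is d.-homog ->
  (exists2 x, points X x & heval x h != 0) ->
  (forall x, points X x -> heval x h != 0 ->
     exists c, has_value f x c /\ has_value g x c) -> f = g.
Proof.
move=> hh hx hfg; have [a ea] := ratio_surj f; have [b eb] := ratio_surj g.
rewrite ea eb; apply/ratioP => x Xx.
have [da [na da' _]] := fracP a; have [db [nb db' _]] := fracP b.
have hp : num a * den b - num b * den a \is (da + db).-homog.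
  by rewrite rpredB ?(dhomogM na db') // addnC dhomogM.
apply/eqP; rewrite -subr_eq0 -!hevalM -hevalN -hevalD; apply/eqP.
apply: (vanishing_cancel hp hh hx) Xx => {}x Xx.
have [->|hx0] := eqVneq (heval x h) 0; first by rewrite mulr0.
have [c [fc gc]] := hfg x Xx hx0.
rewrite hevalD hevalN !hevalM (@has_value_num a x c) -?ea //.
by rewrite (@has_value_num b x c) -?eb //; ring.
Qed.

Lemma has_value_mmap m (y : 'I_m -> ratfun X) x a H :
  (forall i, has_value (y i) x (a i)) ->
  has_value (mmap (ratfun_const X) y H) x H.@[a].
Proof.
move=> hy; rewrite /meval /mmap; elim/big_rec2: _ => [|i b c _ hb]; first exact: has_value0.
apply: has_valueD => //; apply: has_valueM; first exact: has_value_const.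
rewrite /mmap1; elim/big_rec2: _ => [|j e e' _ he]; first exact: has_value1.
apply: has_valueM => //; have yX r : has_value (y j ^+ r) x (a j ^+ r).
  by elim: r => [|r IH]; [exact: has_value1|rewrite !exprS; exact: has_valueM].
exact: yX.
Qed.

(** A neighbourhood filter based on principal open sets: intersections become products of forms, and
    a local statement amounts to exhibiting a form that is nonzero at [x]. *)
Definition near x (P : ambient_space X -> Prop) : Prop :=
  exists d (h : form), [/\ h \is d.-homog, heval x h != 0 &
    forall z, points X z -> heval z h != 0 -> P z].

Lemma near_point x (P : ambient_space X -> Prop) : points X x -> near x P -> P x.
Proof. by move=> Xx [d [h [_ hx]]]; apply. Qed.

Lemma near_form x d (h : form) : h \is d.-homog -> heval x h != 0 ->
  near x (fun z => heval z h != 0).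
Proof. by move=> hh hx; exists d, h. Qed.

Lemma near_all x (P : ambient_space X -> Prop) :
  (forall z, points X z -> P z) -> near x P.
Proof. by move=> h; exists 0%N, 1; rewrite dhomog1 heval1 oner_neq0; split=> // z /h. Qed.

Lemma near_and x (P Q : ambient_space X -> Prop) :
  near x P -> near x Q -> near x (fun z => P z /\ Q z).
Proof.
move=> [d [g [gd gx hg]]] [e [h [he hx hh]]]; exists (d + e)%N, (g * h).
rewrite dhomogM // hevalM mulf_neq0 //; split=> // z Xz.
by rewrite hevalM mulf_eq0 negb_or => /andP[g0 h0]; split; [exact: hg|exact: hh].
Qed.

Lemma near_imp x (P Q : ambient_space X -> Prop) :
  (forall z, points X z -> P z -> Q z) -> near x P -> near x Q.
Proof.
by move=> PQ [d [g [gd gx hg]]]; exists d, g; split=> // z Xz /(hg z Xz)/(PQ z Xz).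
Qed.

Lemma near_forall (J : finType) x (P : J -> ambient_space X -> Prop) :
  (forall i, near x (P i)) -> near x (fun z => forall i, P i z).
Proof.
move=> h; suff : near x (fun z => forall i, i \in enum J -> P i z).
  by apply: near_imp => z _ hz i; apply: hz; rewrite mem_enum.
elim: (enum J) => [|j s IH]; first exact: near_all.
by apply: near_imp (near_and (h j) IH) => z _ [Pj Ps] i; rewrite inE => /predU1P[->|/Ps].
Qed.

Lemma near_not_closed x Z : zariski_closed Z -> ~ Z x -> near x (fun z => ~ Z z).
Proof.
move=> hZ /(closed_separate hZ)[d [p [hd pZ px]]]; exists d, p; split=> // z _ pz Zz.
by rewrite (pZ z Zz) eqxx in pz.
Qed.

Lemma closed_of_near S : S `<=` points X ->
  (forall x, points X x -> ~ S x -> near x (fun z => ~ S z)) -> zariski_closed S.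
Proof.
move=> SX h; apply: closed_of_separate => x Sx.
have [Xx|nXx] := pselect (points X x).
  have [d [g [hd gx hg]]] := h x Xx Sx; exists d, g; split=> // z Sz.
  by apply: contrapT => /eqP /(hg z (SX z Sz)).
have [d [p [hd pX px]]] := closed_separate (pv_closed X) nXx.
by exists d, p; split=> // z /SX; exact: pX.
Qed.

Lemma irreducible_near D S x : irreducible_set D -> D `<=` points X ->
  D x -> zariski_closed S -> near x (fun z => D z -> S z) -> D `<=` S.
Proof.
move=> [_ irr] DX Dx hS [d [g [hd gx hg]]].
have [||] := irr _ _ (closed_hypersurface hd) hS; last by [].
  move=> z Dz; have [g0|g0] := eqVneq (heval z g) 0; first by left.
  by right; exact: hg (DX z Dz) g0 Dz.
by move=> /(_ x Dx) /= g0; rewrite g0 eqxx in gx.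
Qed.

Lemma near_eq f g x : points X x ->
  near x (fun z => exists c, has_value f z c /\ has_value g z c) -> f = g.
Proof.
move=> Xx [d [h [hd hx hz]]]; apply: (ratfun_eq hd) => //; first by exists x.
Qed.

Lemma has_value_near f x c : has_value f x c -> near x (fun z => exists c', has_value f z c').
Proof.
move=> [a [-> da _]]; have [d [_ hd _]] := fracP a.
exists d, (den a); split=> // z _ dz; eexists; exact: has_value_ratio dz.
Qed.

Definition locp x : {pred (ratfun X)} := fun f => `[< local_ring x f >].

Lemma locpP x f : reflect (exists c, has_value f x c) (f \in locp x).
Proof. exact: asboolP. Qed.

Lemma locp_closed x : subring_closed (locp x).
Proof.
split=> [|f g /locpP[a fa] /locpP[b gb]|f g /locpP[a fa] /locpP[b gb]]; apply/locpP.
- by exists 1; exact: has_value1.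
- by exists (a - b); exact: has_valueB.
- by exists (a * b); exact: has_valueM.
Qed.
HB.instance Definition _ x :=
  GRing.isSubringClosed.Build (ratfun X) (locp x) (locp_closed x).

Lemma locp_const x a : ratfun_const X a \in locp x.
Proof. by apply/locpP; exists a; exact: has_value_const. Qed.

Lemma has_value_locp f x c : has_value f x c -> f \in locp x.
Proof. by move=> h; apply/locpP; exists c. Qed.

Lemma near_locp f x : f \in locp x -> near x (fun z => f \in locp z).
Proof.
by move=> /locpP[c /has_value_near]; apply: near_imp => z _ /locpP.
Qed.

Lemma maximal_ideal_locp f x : maximal_ideal x f -> f \in locp x.
Proof. exact: has_value_locp. Qed.

Lemma maximal_ideal_ideal x : ideal_in (locp x) (maximal_ideal x).
Proof.
split=> [a|||a b /locpP[c ac] bm].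
- exact: maximal_ideal_locp.
- exact: has_value0.
- by move=> a b /has_valueD h /h; rewrite addr0.
- by have := has_valueM ac bm; rewrite mulr0.
Qed.

Lemma locp_unit f x : points X x -> f \in locp x -> ~ maximal_ideal x f ->
  unit_in (locp x) f.
Proof.
move=> Xx /locpP[c fc] nf; have c0 : c != 0 by apply: contra_notN nf => /eqP e; rewrite e in fc.
split; first exact: has_value_locp fc; last first.
  exact: has_value_locp (has_valueV Xx c0 fc).
by apply: contra_notN nf => /eqP ->; exact: has_value0.
Qed.

Lemma unit_notin_maximal f x : points X x -> unit_in (locp x) f -> ~ maximal_ideal x f.
Proof.
move=> Xx [fB f0 /locpP[c fV]] fm; have := has_valueM fV fm.
rewrite mulVf // mulr0 => h; have := has_value_unique Xx h (has_value1 x).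
by move/eqP; rewrite eq_sym oner_eq0.
Qed.

Lemma sub_value_maximal f x c : has_value f x c -> maximal_ideal x (f - ratfun_const X c).
Proof. by move=> h; have := has_valueB h (has_value_const x c); rewrite subrr. Qed.

End RationalFunctions.

(** * Ideals of subvarieties *)

Section IdealSpan.
Variables (L : fieldType) (B : subringClosed L) (R : set L).
Hypothesis RB : forall a, R a <-> a \in B.

Lemma ideal_span_set1 v : ideal_span R [set v] = multiples B v.
Proof.
apply/seteqP; split=> [_ [m [a [g [aR gv ->]]]]|_ [b bB ->]].
  exists (\sum_i a i); first by rewrite rpred_sum // => i _; apply/RB.
  by rewrite mulr_sumr; apply: eq_bigr => i _; rewrite -(gv i) mulrC.
exists 1%N, (fun=> b), (fun=> v); split=> // [_|]; first exact/RB.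
by rewrite big_ord1 mulrC.
Qed.

Lemma ideal_span_ideal (G : set L) : (forall g, G g -> g \in B) ->
  ideal_in B (ideal_span R G).
Proof.
move=> GB; split.
- move=> _ [m [a [g [aR Gg ->]]]]; rewrite rpred_sum // => i _.
  by apply: rpredM; [exact/RB|exact: GB].
- by exists 0%N, (fun=> 0), (fun=> 0); split=> [[]|[]|] //; rewrite big_ord0.
- move=> _ _ [m [a [g [aR Gg ->]]]] [m' [a' [g' [a'R Gg' ->]]]].
  exists (m + m')%N, (fun i => match split i with inl j => a j | inr j => a' j end),
    (fun i => match split i with inl j => g j | inr j => g' j end).
  split=> [i|i|]; try by case: split.
  rewrite big_split_ord /=; congr (_ + _); apply: eq_bigr => i _.
    by rewrite (unsplitK (inl i)).
  by rewrite (unsplitK (inr i)).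
- move=> b _ bB [m [a [g [aR Gg ->]]]]; exists m, (fun i => b * a i), g.
  split=> // [i|]; first by apply/RB; apply: rpredM => //; exact/RB.
  by rewrite mulr_sumr; apply: eq_bigr => i _; exact: mulrA.
Qed.

Lemma ideal_span_gen (G : set L) g : G g -> ideal_span R G g.
Proof.
move=> Gg; exists 1%N, (fun=> 1), (fun=> g).
split=> // [_|]; first by apply/RB; rewrite rpred1.
by rewrite big_ord1 scale1r.
Qed.

Lemma ideal_span_min (G I : set L) : ideal_in B I -> G `<=` I -> ideal_span R G `<=` I.
Proof.
move=> hI GI _ [m [a [g [aR Gg ->]]]]; apply: ideal_sum (hI) _ => i _.
by case: (hI) => _ _ _ IM; apply: IM; [exact/RB|exact: GI].
Qed.

Lemma ideal_span_range n (t : 'I_n -> L) f : ideal_span R (range t) f ->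
  exists2 b : 'I_n -> L, forall i, b i \in B & f = \sum_i b i * t i.
Proof.
move=> [m [a [g [aR Gg ->]]]].
elim: m a g aR Gg => [|m IH] a g aR Gg.
  exists (fun=> 0) => [i|]; first by rewrite rpred0.
  by rewrite big_ord0 big1 // => i _; rewrite mul0r.
have [b bB e] := IH _ _ (fun i => aR (lift ord0 i)) (fun i => Gg (lift ord0 i)).
have [j _ tj] := Gg ord0.
exists (fun i => b i + (if i == j then a ord0 else 0)).
  by move=> i; rewrite rpredD //; case: ifP => _; [exact/RB|exact: rpred0].
rewrite big_ord_recl e addrC; under [RHS]eq_bigr do rewrite mulrDl.
rewrite big_split /=; congr (_ + _).
rewrite (bigD1 j) //= eqxx -tj big1 ?addr0 // => i /negbTE ->; by rewrite mul0r.
Qed.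

End IdealSpan.

Section LocalIdeals.
Variables (k : closedFieldType) (X : proj_variety k).
Implicit Types (f g : ratfun X) (x z : ambient_space X).
Local Notation form := {mpoly k[(ambient X).+1]}.

Lemma local_ringE x f : local_ring x f <-> f \in locp x.
Proof. by split=> [h|/locpP//]; apply/locpP. Qed.

Lemma near_meet (P Q : ambient_space X -> Prop) x z : points X x -> points X z ->
  near x P -> near z Q -> exists w, [/\ points X w, P w & Q w].
Proof.
move=> Xx Xz [d [g [gd gx hg]]] [e [h [he hz hh]]].
apply: contrapT => no; have [||] := @vanishing_prime _ X g h d e gd he.
- move=> w Xw; apply/eqP/negPn/negP; rewrite mulf_eq0 negb_or => /andP[g0 h0].
  by apply: no; exists w; split=> //; [exact: hg|exact: hh].
- by move=> /(_ x Xx) e0; rewrite e0 eqxx in gx.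
- by move=> /(_ z Xz) e0; rewrite e0 eqxx in hz.
Qed.

Lemma near_eq2 f g (P Q : ambient_space X -> Prop) x z :
  points X x -> points X z -> near x P -> near z Q ->
  (forall w, points X w -> P w -> Q w -> exists c, has_value f w c /\ has_value g w c) ->
  f = g.
Proof.
move=> Xx Xz [d [p [pd px hp]]] [e [q [qe qz hq]]] h.
apply: (@ratfun_eq _ X f g (d + e)%N (p * q)); first exact: dhomogM.
  have [w [Xw w1 w2]] := near_meet Xx Xz (near_form pd px) (near_form qe qz).
  by exists w => //; rewrite hevalM mulf_neq0.
move=> w Xw; rewrite hevalM mulf_eq0 negb_or => /andP[w1 w2].
by apply: h => //; [exact: hp|exact: hq].
Qed.

Lemma near_neq0 f x c : points X x -> has_value f x c -> c != 0 ->
  near x (fun z => exists2 c', has_value f z c' & c' != 0).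
Proof.
move=> Xx [a [-> da ec]] c0; have [d [na' da' _]] := fracP a.
have na : heval x (num a) != 0 by apply: contraNneq c0 => e; rewrite ec e mul0r.
apply: near_imp (near_and (near_form na' na) (near_form da' da)) => z Xz [n0 d0].
exists (heval z (num a) / heval z (den a)); first exact: has_value_ratio.
by rewrite mulf_neq0 ?invr_eq0.
Qed.

Lemma near_unit f x : points X x -> unit_in (locp x) f -> near x (fun z => unit_in (locp z) f).
Proof.
move=> Xx hf; have /locpP[c fc] : f \in locp x by case: hf.
have c0 : c != 0.
  by apply/eqP => e; case: (unit_notin_maximal Xx hf); rewrite /maximal_ideal /= -e.
apply: near_imp (near_neq0 Xx fc c0) => z Xz [c' fc' c'0].
apply: locp_unit => //; first exact: has_value_locp fc'.
by move=> h; rewrite (has_value_unique Xz fc' h) eqxx in c'0.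
Qed.

Section AlongASubvariety.
Variables (D : set (ambient_space X)) (x : ambient_space X).
Hypotheses (Dirr : irreducible_set D) (DX : D `<=` points X) (Dx : D x).

Lemma num_vanishes_near (a : frac X) :
  near x (fun z => D z -> maximal_ideal z (ratio a)) -> vanishes_on D (num a).
Proof.
move=> h; have [d [hn _ _]] := fracP a.
apply: (irreducible_near Dirr DX Dx (closed_hypersurface hn)).
apply: near_imp h => z Xz h Dz /=; have := h Dz.
by move=> /(has_value_num Xz) ->; rewrite mul0r.
Qed.

Lemma local_idealP f : local_ideal D x f <->
  f \in locp x /\ near x (fun z => D z -> maximal_ideal z f).
Proof.
split=> [[/locpP fx h]|[/locpP[c fx] h]].
  split=> //; apply: near_imp (near_locp fx) => z Xz /locpP[c fc] Dz.
  by rewrite /maximal_ideal /= -(h z c Dz fc).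
split; first by exists c.
move=> z c' Dz [b [fb db ->]].
have [a [fa da _]] := fx; have [d [na da' _]] := fracP a; have [e [nb db' _]] := fracP b.
rewrite fa in h; have nav := num_vanishes_near h.
have [|v|] := irreducible_vanish Dirr nb da'; last 1 first.
- by move=> /(_ x Dx) e0; rewrite e0 eqxx in da.
- move=> w Dw; have /ratioP ab : ratio a = ratio b by rewrite -fa -fb.
  by rewrite hevalM -(ab w (DX Dw)) nav ?mul0r.
- by rewrite (v z Dz) mul0r.
Qed.

Lemma local_ideal_ideal : ideal_in (locp x) (local_ideal D x).
Proof.
have mi z := maximal_ideal_ideal (X := X) z.
split.
- by move=> a /local_idealP[].
- by apply/local_idealP; rewrite rpred0; split=> //; apply: near_all => z _ _; exact: has_value0.
- move=> a b /local_idealP[aB ha] /local_idealP[bB hb]; apply/local_idealP.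
  rewrite rpredD //; split=> //; apply: near_imp (near_and ha hb) => z Xz [h1 h2] Dz.
  by case: (mi z) => _ _ hD _; apply: hD; [exact: h1|exact: h2].
- move=> a b aB /local_idealP[bB hb]; apply/local_idealP.
  rewrite rpredM //; split=> //; apply: near_imp (near_and (near_locp aB) hb) => z Xz [h1 h2] Dz.
  by case: (mi z) => _ _ _ hM; apply: hM => //; exact: h2.
Qed.

Lemma local_ideal_prime : prime_in (locp x) (local_ideal D x).
Proof.
split; first exact: local_ideal_ideal.
  move=> [_ /(_ x 1 Dx (has_value1 x))]/eqP; by rewrite oner_eq0.
move=> f g fB gB /local_idealP[_ h].
have /locpP[c1 [a [fa da _]]] := fB; have /locpP[c2 [b [gb db _]]] := gB.
have [d [na da' _]] := fracP a; have [e [nb db' _]] := fracP b.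
have : vanishes_on D (num a * num b).
  rewrite fa gb mulE ratio_mul in h; exact: (num_vanishes_near h).
suff van r q (hr : heval x (den r) != 0) : q \in locp x -> q = ratio r ->
    vanishes_on D (num r) -> local_ideal D x q.
  by case/(irreducible_vanish Dirr na nb) => v; [left; apply: (van a)|right; apply: (van b)].
move=> qB -> v; apply/local_idealP; split; first by apply/locpP; eexists; exact: has_value_ratio hr.
have [d' [_ dr _]] := fracP r.
apply: near_imp (near_form dr hr) => z Xz dz Dz.
by have := has_value_ratio dz; rewrite (v z Dz) mul0r.
Qed.

End AlongASubvariety.

Lemma local_equationE D x v : local_equation D x v ->
  local_ideal D x = multiples (locp x) v.
Proof. by move=> ->; apply: ideal_span_set1 => a; exact: local_ringE. Qed.

End LocalIdeals.

(** * Affine charts *)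

Section Composition.
Variables (k : closedFieldType) (X : proj_variety k).
Implicit Types (f g : ratfun X) (x z : ambient_space X).

Lemma open_near (U : set (ambient_space X)) x :
  zariski_open_in (points X) U -> U x -> near x U.
Proof.
move=> [Z hZ ->] [Xx nZ]; apply: near_imp (near_not_closed hZ nZ) => z Xz nz; by split.
Qed.

Lemma open_sub (U : set (ambient_space X)) x :
  zariski_open_in (points X) U -> U x -> points X x.
Proof. by move=> [Z hZ ->] []. Qed.

Variables (U : set (ambient_space X)) (M : nat) (T : set (proj_space k M)).
Variable u : ambient_space X -> proj_space k M.
Hypotheses (Uopen : zariski_open_in (points X) U) (ureg : regular_map U T u).

Lemma regular_map_near x : U x -> exists d (F : 'I_M.+1 -> {mpoly k[(ambient X).+1]}),
  [/\ forall i, F i \is d.-homog, exists i, heval x (F i) != 0 &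
   near x (fun z => exists2 a, a != 0 &
      forall e (p : {mpoly k[M.+1]}), p \is e.-homog ->
        heval (u z) p = a ^+ e * heval z (subst F p))].
Proof.
move=> Ux; have [_ /(_ x Ux)[d [F [Fd Fx Fu]]]] := ureg.
have [i Fi] : exists i, heval x (F i) != 0.
  apply: contrapT => /forallNP h; case/eqP: Fx; apply/rowP => i; rewrite !mxE.
  by have /negP/negPn/eqP := h i.
exists d, F; split=> //; first by exists i.
apply: near_imp (near_and (open_near Uopen Ux) (near_form (Fd i) Fi)) => z Xz [Uz Fz].
have Fz0 : \row_i heval z (F i) != 0.
  by apply: contraNneq Fz => /rowP/(_ i); rewrite !mxE => ->.
have [a a0 ha] := heval_line (Fu z Uz Fz0); exists a => // e p pe.
by rewrite (ha e) // heval_subst; congr (_ * _); apply: meval_eq => j; rewrite mxE.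
Qed.

(** Near each point the forms defining [u] turn [p / q] into a fraction on [X]. Two such fractions
    agree where their neighbourhoods meet, and these do meet since [X] is irreducible, so the
    fraction found at [x0] serves everywhere. *)
Lemma compose_ratio e (p q : {mpoly k[M.+1]}) x0 : p \is e.-homog -> q \is e.-homog ->
  U x0 -> heval (u x0) q != 0 ->
  exists g : ratfun X, forall x, U x -> heval (u x) q != 0 ->
    has_value g x (heval (u x) p / heval (u x) q).
Proof.
move=> pe qe Ux0 qx0.
have key x : U x -> heval (u x) q != 0 -> exists g : ratfun X,
    near x (fun z => has_value g z (heval (u z) p / heval (u z) q)).
  move=> Ux qx; have [d [F [Fd _ Fnear]]] := regular_map_near Ux.
  have Xx := open_sub Uopen Ux.
  have [a a0 ha] := near_point Xx Fnear.
  have sqx : heval x (subst F q) != 0.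
    by apply: contraNneq qx => s0; rewrite (ha e) // s0 mulr0.
  have sqd := dhomog_subst qe Fd; have spd := dhomog_subst pe Fd.
  have hfr : frac_pair (subst F p, subst F q).
    by apply/asboolP; split; [exists (e * d)%N|exists x].
  exists (ratio (mk_frac hfr)).
  apply: near_imp (near_and Fnear (near_form sqd sqx)) => z Xz [[b b0 hb] sqz].
  have := @has_value_ratio _ _ (mk_frac hfr) z sqz.
  by rewrite !(hb e) // -mulf_div mulfV ?mul1r // expf_neq0.
have [g hg] := key x0 Ux0 qx0; exists g => x Ux qx.
have [g' hg'] := key x Ux qx; have Xx := open_sub Uopen Ux.
have -> : g = g'.
  apply: (near_eq2 (open_sub Uopen Ux0) Xx hg hg') => w Xw h1 h2.
  by exists (heval (u w) p / heval (u w) q).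
exact: near_point hg'.
Qed.

End Composition.

Section Charts.
Variables (k : closedFieldType) (X : proj_variety k).
Implicit Types (f g : ratfun X) (x z : ambient_space X).
Local Notation ev y := (mmap (ratfun_const X) y).

(** The properties of an affine open set on which the later arguments rest. [chart_zeros] says that
    the common zeros of the relations between the [y i] come from points of [U]; it turns the
    algebraic Nullstellensatz into one about points. *)
Record chart (U : set (ambient_space X)) m (y : 'I_m -> ratfun X) : Prop := Chart {
  chart_sub : U `<=` points X;
  chart_regular : forall x i, U x -> y i \in locp x;
  chart_fraction : forall x f, U x -> f \in locp x ->
    exists G H, unit_in (locp x) (ev y H) /\ f * ev y H = ev y G;
  chart_zeros : forall a : 'I_m -> k, (forall H, ev y H = 0 -> H.@[a] = 0) ->
    exists2 x, U x & forall i, has_value (y i) x (a i);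
  chart_closed : forall S x, zariski_closed S -> U x -> ~ S x ->
    exists2 H, (forall z, U z -> S z -> maximal_ideal z (ev y H)) &
      ~ maximal_ideal x (ev y H);
  chart_separates : forall x z, U x -> U z ->
    (forall i c, has_value (y i) x c -> has_value (y i) z c) -> x = z
}.

Lemma dhomog_crd N d (p : {mpoly k[N.+1]}) (w : proj_space k N) l :
  p \is d.-homog -> crd w l != 0 ->
  p.@[fun i => crd w i / crd w l] = heval w p / crd w l ^+ d.
Proof.
move=> pd wl; rewrite -exprVn mulrC heval_crd -dhomog_meval_scale //.
by apply: meval_eq => i; rewrite mulrC.
Qed.

Definition coordinates_along M (U : set (ambient_space X)) (u : ambient_space X -> proj_space k M)
    (l : 'I_M.+1) (y : 'I_M.+1 -> ratfun X) : Prop :=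
  forall x, U x -> crd (u x) l != 0 /\ forall i, has_value (y i) x (crd (u x) i / crd (u x) l).

Lemma coordinates_form M U u l y d (p : {mpoly k[M.+1]}) x :
  @coordinates_along M U u l y -> p \is d.-homog -> U x ->
  has_value (ev y p) x (heval (u x) p / crd (u x) l ^+ d).
Proof.
move=> hy pd Ux; have [xl hx] := hy x Ux.
by rewrite -dhomog_crd //; exact: has_value_mmap.
Qed.

Lemma maximal_idealE f x c : points X x -> has_value f x c -> maximal_ideal x f <-> c = 0.
Proof.
move=> Xx fc; split=> [h|c0]; first exact: has_value_unique fc h.
by rewrite /maximal_ideal /= -c0.
Qed.

(** The index [l] of the hyperplane at infinity is free, so that one proof covers both the standard
    opens, with [u] and [v] the identity, and the sets with [is_affine], where [l = ord0]. *)
Lemma chart_of_iso (U : set (ambient_space X)) M (Z : set (proj_space k M)) (l : 'I_M.+1)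
    (u : ambient_space X -> proj_space k M) v x0 :
  zariski_open_in (points X) U -> U x0 -> zariski_closed Z ->
  let T := Z `&` [set w | heval w 'X_l != 0] in
  regular_map U T u -> regular_map T U v ->
  (forall x, U x -> v (u x) = x) -> (forall w, T w -> u (v w) = w) ->
  exists y, coordinates_along U u l y /\ chart U y.
Proof.
move=> Uopen Ux0 Zcl T ureg vreg vu uv.
have UX x : U x -> points X x by exact: open_sub.
have [uT _] := ureg; have [vU vloc] := vreg.
have ul x : U x -> crd (u x) l != 0 by move=> /uT[_]; rewrite /= heval_form.
have X1 i : ('X_i : {mpoly k[M.+1]}) \is 1.-homog by rewrite dhomogX /= mdeg1.
have /choice[y hy] i : exists g : ratfun X, forall x, U x ->
    has_value g x (crd (u x) i / crd (u x) l).
  have [|g hg] := compose_ratio Uopen ureg (X1 i) (X1 l) Ux0; first by rewrite heval_form ul.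
  by exists g => x Ux; have := hg x Ux; rewrite !heval_form; apply; exact: ul.
have hcoord : coordinates_along U u l y.
  by move=> x Ux; split; [exact: ul|move=> i; exact: hy].
have form_val := coordinates_form hcoord.
exists y; split=> //.
have vnear x : U x -> exists d (F : 'I_(ambient X).+1 -> {mpoly k[M.+1]}) i,
    [/\ forall j, F j \is d.-homog, heval (u x) (F i) != 0 &
    forall z j, U z -> heval (u z) (F j) != 0 -> exists2 a, a != 0 &
      forall e p, p \is e.-homog -> heval z p = a ^+ e * heval (u z) (subst F p)].
  move=> Ux; have [d [F [Fd Fx Fv]]] := vloc (u x) (uT x Ux).
  have [i Fi] : exists i, heval (u x) (F i) != 0.
    apply: contrapT => /forallNP h; case/eqP: Fx; apply/rowP => i; rewrite !mxE.
    by have /negP/negPn/eqP := h i.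
  exists d, F, i; split=> // z j Uz Fz.
  have Fz0 : \row_i heval (u z) (F i) != 0.
    by apply: contraNneq Fz => /rowP/(_ j); rewrite !mxE => ->.
  have e := Fv (u z) (uT z Uz) Fz0; rewrite vu // in e.
  have [a a0 ha] := heval_line e; exists a => // e' p pe.
  by rewrite (ha e') // heval_subst; congr (_ * _); apply: meval_eq => j'; rewrite mxE.
split=> //.
- by move=> x i Ux; exact: has_value_locp (hy i x Ux).
- move=> x f Ux /locpP[c [a [-> da _]]]; have [e [na' da' _]] := fracP a.
  have [d [F [i [Fd Fi hF]]]] := vnear x Ux.
  have Gd := dhomog_subst na' Fd; have Hd := dhomog_subst da' Fd.
  exists (subst F (num a)), (subst F (den a)).
  have ulX z n : U z -> crd (u z) l ^+ n != 0 by move=> Uz; rewrite expf_neq0 ?ul.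
  have sd z : U z -> heval (u z) (F i) != 0 -> heval z (den a) != 0 ->
      heval (u z) (subst F (den a)) != 0.
    move=> Uz Fz; have [b b0 hb] := hF z i Uz Fz.
    by apply: contraNneq => s0; rewrite (hb e) // s0 mulr0.
  split.
    apply: locp_unit; first exact: UX.
      exact: has_value_locp (form_val _ _ _ Hd Ux).
    move/(maximal_idealE (UX x Ux) (form_val _ _ _ Hd Ux))/eqP.
    by rewrite mulf_eq0 invr_eq0 (negbTE (ulX _ _ Ux)) (negbTE (sd x Ux Fi da)).
  apply: (near_eq (UX x Ux)).
  have Fnear : near x (fun z => heval (u z) (F i) != 0).
    have c0 : heval (u x) (F i) / crd (u x) l ^+ d != 0 by rewrite mulf_neq0 ?invr_eq0 ?ulX.
    apply: near_imp (near_and (open_near Uopen Ux)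
      (near_neq0 (UX x Ux) (form_val _ _ _ (Fd i) Ux) c0)) => z Xz [Uz [c' hc' c'0]].
    have ec : c' = heval (u z) (F i) / crd (u z) l ^+ d.
      exact: has_value_unique Xz hc' (form_val _ _ _ (Fd i) Uz).
    by apply: contraNneq c'0 => s0; rewrite ec s0 mul0r.
  apply: near_imp (near_and (open_near Uopen Ux) (near_and Fnear (near_form da' da))).
  move=> z Xz [Uz [Fz dz]]; eexists; split; last exact: form_val Gd Uz.
  have := has_valueM (has_value_ratio dz) (form_val _ _ _ Hd Uz).
  congr (has_value _ _ _); have [b b0 hb] := hF z i Uz Fz.
  rewrite (hb e _ na') (hb e _ da').
  have h1 := ulX z (e * d)%N Uz; have h2 := sd z Uz Fz dz; have h3 := expf_neq0 e b0.
  by field; rewrite h1 h2 h3.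
(* The relation ['X_l - 1] forces [a l = 1], so [a] gives a point off the hyperplane; it is on [Z]
   because forms vanishing on [Z] are relations between the [y i]. *)
- move=> a ha; have al : a l = 1.
    have : ('X_l - 1).@[a] = 0.
      apply: ha; apply: (near_eq (UX _ Ux0)); apply: near_imp (open_near Uopen Ux0) => z Xz Uz.
      exists 0; split; last exact: has_value0.
      rewrite rmorphB rmorph1 /= mmapX mmap1U; have := has_valueB (hy l z Uz) (has_value1 z).
      by rewrite divff ?ul // subrr.
    by rewrite mevalB mevalXU meval1 => /eqP; rewrite subr_eq0 => /eqP.
  have [|w [b b0 hb]] := @point_of k M a; first by exists l; rewrite al oner_neq0.
  have wl : crd w l = b by rewrite hb al mulr1.
  have Tw : T w.
    split; last by rewrite /= heval_form wl.
    apply: contrapT => /(closed_separate Zcl)[d [p [pd pZ /eqP]]]; apply.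
    rewrite heval_crd (meval_eq _ hb) (dhomog_meval_scale _ _ pd) ha ?mulr0 //.
    apply: (near_eq (UX _ Ux0)); apply: near_imp (open_near Uopen Ux0) => z Xz Uz.
    exists 0; split; last exact: has_value0.
    by have := form_val _ _ _ pd Uz; rewrite pZ ?mul0r //; case: (uT z Uz).
  exists (v w); first exact: vU.
  move=> i; have := hy i (v w) (vU w Tw); rewrite uv // hb wl mulrAC divff ?mul1r //.
- move=> S x Scl Ux nSx; have [d0 [p0 [p0d p0S p0x]]] := closed_separate Scl nSx.
  have [j xj] := crd_neq0 x.
  (* The extra factor makes the degree positive, so that [subst F p] also vanishes where all the
     [F j] do and the formula for [v] says nothing. *)
  pose p := p0 * 'X_j; have pd : p \is d0.+1.-homog by rewrite /p -[d0.+1]addn1 dhomogM // dhomogX /= mdeg1.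
  have pS : vanishes_on S p by move=> z Sz; rewrite hevalM p0S ?mul0r.
  have px : heval x p != 0 by rewrite hevalM mulf_neq0 ?heval_form.
  have [d [F [i [Fd Fi hF]]]] := vnear x Ux.
  have Gd := dhomog_subst pd Fd; exists (subst F p).
    move=> z Uz Sz; apply/(maximal_idealE (UX z Uz) (form_val _ _ _ Gd Uz)).
    suff -> : heval (u z) (subst F p) = 0 by rewrite mul0r.
    have [[j' Fz]|/forallNP F0] := pselect (exists j', heval (u z) (F j') != 0); last first.
      rewrite heval_subst -(meval_dhomog0 pd); apply: meval_eq => j'.
      by have /negP/negPn/eqP := F0 j'.
    have [b b0 hb] := hF z j' Uz Fz; have := pS z Sz; rewrite (hb _ _ pd) => /eqP.
    by rewrite mulf_eq0 expf_eq0 (negbTE b0) andbF => /eqP.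
  move/(maximal_idealE (UX x Ux) (form_val _ _ _ Gd Ux))/eqP.
  have [b b0 hb] := hF x i Ux Fi.
  rewrite mulf_eq0 invr_eq0 expf_eq0 (negbTE (ul x Ux)) andbF orbF => /eqP s0.
  by move: px; rewrite (hb _ _ pd) s0 mulr0 eqxx.
- move=> x z Ux Uz h; rewrite -(vu x Ux) -(vu z Uz); congr v.
  have a0 : crd (u x) l / crd (u z) l != 0 by rewrite mulf_neq0 ?invr_eq0 ?ul.
  apply: (point_eq a0) => i.
  have := has_value_unique (UX z Uz) (h i _ (hy i x Ux)) (hy i z Uz).
  move/(congr1 (fun c => c * crd (u x) l)); rewrite divfK ?ul // => ->.
  by ring.
Qed.

Lemma mmap_fg m (y : 'I_m -> ratfun X) H :
  ev y H \in fg_algebra (ratfun_const X) (codom y).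
Proof.
rewrite /mmap rpred_sum // => i _; rewrite rpredM ?fg_algebra_const // /mmap1 rpred_prod // => j _.
by rewrite rpredX // fg_algebra_gen // codom_f.
Qed.

(** The values on the [y i] of the homomorphism given by the Nullstellensatz satisfy all relations
    between them, hence are the coordinates of a point of [U]. *)
Lemma chart_point U m (y : 'I_m -> ratfun X) (B : subringClosed (ratfun X)) Q G :
  chart U y -> prime_in B Q -> (forall a, ratfun_const X a \in B) ->
  (forall i, y i \in B) -> ~ Q (ev y G) ->
  exists x, [/\ U x, ~ maximal_ideal x (ev y G) &
    forall H, Q (ev y H) -> maximal_ideal x (ev y H)].
Proof.
move=> [UX _ _ hzeros _ _] hQ cB yB nG.
have [|s [hs sQ sG]] := nullstellensatz (zs := codom y) hQ cB _ (mmap_fg y G) nG.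
  by move=> _ /codomP[i ->].
pose a i := s (y i).
have sE H : s (ev y H) = H.@[a].
  have yS i : y i \in fg_algebra (ratfun_const X) (codom y) by rewrite fg_algebra_gen ?codom_f.
  have yXS i r : y i ^+ r \in fg_algebra (ratfun_const X) (codom y) by rewrite rpredX.
  have sX i r : s (y i ^+ r) = a i ^+ r by exact: (hom_onX hs).
  have sM (b : 'X_{1..m}) : s (mmap1 y b) = mmap1 a b.
    suff [] : mmap1 y b \in fg_algebra (ratfun_const X) (codom y) /\ s (mmap1 y b) = mmap1 a b by [].
    rewrite /mmap1; elim/big_rec2: _ => [|i v w _ [vS <-]]; first by rewrite rpred1 (hom_on1 hs).
    split; first by apply: rpredM; rewrite ?yXS.
    by case: hs => _ hM _; rewrite hM ?yXS // sX.
  have mS (b : 'X_{1..m}) : mmap1 y b \in fg_algebra (ratfun_const X) (codom y).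
    by rewrite /mmap1 rpred_prod // => i _; exact: yXS.
  rewrite /meval /mmap (hom_on_sum hs) => [|b]; last first.
    by apply: rpredM; [exact: fg_algebra_const|exact: mS].
  by apply: eq_bigr => b _; case: hs => _ hM hc; rewrite hM ?fg_algebra_const ?mS ?hc ?sM.
have [H H0|x Ux hx] := hzeros a.
  by rewrite -sE H0 (hom_on0 hs).
exists x; split=> // [h|H QH]; last first.
  by rewrite /maximal_ideal /= -(sQ _ (mmap_fg y H) QH) sE; exact: has_value_mmap.
case/eqP: sG; rewrite sE.
exact/(maximal_idealE (UX x Ux) (has_value_mmap G hx)).
Qed.
End Charts.

(** * Primes of a local ring *)

Section StandardCharts.
Variables (k : closedFieldType) (X : proj_variety k).
Implicit Types (f g : ratfun X) (x z : ambient_space X).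
Local Notation ev y := (mmap (ratfun_const X) y).
Local Notation form := {mpoly k[(ambient X).+1]}.

Definition standard_open (l : 'I_(ambient X).+1) : set (ambient_space X) :=
  points X `&` [set z | heval z 'X_l != 0].

Lemma dhomog_var N (i : 'I_N) : ('X_i : {mpoly k[N]}) \is 1.-homog.
Proof. by rewrite dhomogX /= mdeg1. Qed.

Lemma standard_open_open l : zariski_open_in (points X) (standard_open l).
Proof.
exists [set z | heval z 'X_l = 0]; first exact: closed_hypersurface (dhomog_var l).
by apply/seteqP; split=> z [Xz /= h]; split=> //; apply/eqP.
Qed.

Lemma regular_map_id (l : 'I_(ambient X).+1) : regular_map (standard_open l) (standard_open l) id.
Proof.
split=> // x Ux; exists 1%N, (fun i => 'X_i); split.
- by move=> i; exact: dhomog_var.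
- have [i xi] := crd_neq0 x; apply: contraNneq xi => /rowP/(_ i).
  by rewrite !mxE heval_form => ->.
- move=> z _ _; have [_ {1}->] := point_line z; congr (<[_]>%VS).
  by apply/rowP => i; rewrite mxE heval_form.
Qed.

Lemma standard_chart x : points X x -> exists l y,
  [/\ standard_open l x, coordinates_along (standard_open l) id l y &
      chart (standard_open l) y].
Proof.
move=> Xx; have [l xl] := crd_neq0 x.
have Ux : standard_open l x by split=> //=; rewrite heval_form.
have [y [hy hc]] := chart_of_iso (standard_open_open l) Ux (pv_closed X)
  (regular_map_id l) (regular_map_id l) (fun _ _ => erefl) (fun _ _ => erefl).
by exists l, y.
Qed.

Lemma affine_chart (U : set (ambient_space X)) x : zariski_open_in (points X) U ->
  U x -> is_affine U -> exists m (y : 'I_m -> ratfun X), chart U y.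
Proof.
move=> Uopen Ux [m [Z [Zcl [u [v [ureg vreg vu uv]]]]]].
have [y [_ hy]] := chart_of_iso Uopen Ux Zcl ureg vreg vu uv.
by exists m.+1, y.
Qed.

Lemma coordinates_ratio l y x (a : frac X) :
  coordinates_along (standard_open l) id l y -> standard_open l x ->
  ratio a * ev y (den a) = ev y (num a).
Proof.
move=> hy Ux; have Xx : points X x by case: Ux.
have [d [hn hd [z Xz dz]]] := fracP a.
apply: (near_eq2 Xx Xz (open_near (standard_open_open l) Ux) (near_form hd dz)).
move=> w Xw Uw dw; exists (heval w (num a) / crd w l ^+ d); split; last exact: (coordinates_form hy hn Uw).
have := has_valueM (has_value_ratio dw) (coordinates_form hy hd Uw).
by rewrite mulrA divfK.
Qed.

Lemma prime_in_unit x (P : set (ratfun X)) f :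
  prime_in (locp x) P -> unit_in (locp x) f -> ~ P f.
Proof.
move=> [[_ _ _ PM] P1 _] [fB f0 fVB] Pf; apply: P1.
by rewrite -(mulVf f0); exact: PM.
Qed.

(* [D] is the zero locus of [P]; the Nullstellensatz makes it irreducible. *)
Lemma prime_locus x (P : set (ratfun X)) : points X x -> prime_in (locp x) P ->
  exists D, [/\ irreducible_set D, zariski_closed D, D `<=` points X, D x &
    (forall f, P f -> near x (fun z => D z -> maximal_ideal z f)) /\
    forall R, irreducible_set R -> R `<=` points X -> D `<=` R ->
      local_ideal R x `<=` P].
Proof.
move=> Xx hP; have [[PB P0 PD PM] P1 Pprime] := hP.
have [l [y [Ux hy hc]]] := standard_chart Xx.
have UX z : standard_open l z -> points X z by case.
have lX z n : standard_open l z -> crd z l ^+ n != 0.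
  by move=> Uz; rewrite expf_neq0 //; case: Uz => _ /=; rewrite heval_form.
have Pmax f : P f -> maximal_ideal x f.
  move=> Pf; apply: contrapT => nf.
  exact: (prime_in_unit hP (locp_unit Xx (PB f Pf) nf)).
have yB i : y i \in locp x by exact: (chart_regular hc).
have evB (H : form) : ev y H \in locp x.
  by apply: has_value_locp; apply: has_value_mmap => i; have [_] := hy x Ux; apply.
pose D := [set z | points X z /\
  forall d (p : form), p \is d.-homog -> P (ev y p) -> heval z p = 0].
have null d (p : form) : p \is d.-homog -> vanishes_on D p -> P (ev y p).
  move=> pd pD; apply: contrapT => np.
  have [z [Uz nz hz]] := chart_point hc hP (locp_const x) yB np.
  apply/nz/(maximal_idealE (UX z Uz) (coordinates_form hy pd Uz)).
  rewrite pD ?mul0r //; split=> [|e q qe Pq]; first exact: UX.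
  have /(maximal_idealE (UX z Uz) (coordinates_form hy qe Uz))/eqP := hz q Pq.
  by rewrite mulf_eq0 invr_eq0 (negbTE (lX z e Uz)) orbF => /eqP.
have Dx : D x.
  split=> // d p pd /Pmax/(maximal_idealE Xx (coordinates_form hy pd Ux))/eqP.
  by rewrite mulf_eq0 invr_eq0 (negbTE (lX x d Ux)) orbF => /eqP.
have Dvan d (p : form) : p \is d.-homog -> P (ev y p) -> vanishes_on D p.
  by move=> pd Pp z [_ hz]; exact: (hz d).
have den_unit (a : frac X) : heval x (den a) != 0 -> unit_in (locp x) (ev y (den a)).
  have [d [_ hd _]] := fracP a => dx; apply: locp_unit => //.
  move/(maximal_idealE Xx (coordinates_form hy hd Ux))/eqP.
  by rewrite mulf_eq0 invr_eq0 (negbTE (lX x d Ux)) (negbTE dx).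
exists D; split=> //.
- split; first by exists x.
  move=> A B hA hB DAB; apply: contrapT => /not_orP[].
  move=> /existsNP[a /not_implyP[Da Aa]] /existsNP[b /not_implyP[Db Bb]].
  have [d [p [pd pA pa]]] := closed_separate hA Aa.
  have [e [q [qe qB qb]]] := closed_separate hB Bb.
  have : P (ev y p * ev y q).
    rewrite -rmorphM; apply: (null (d + e)%N); first exact: dhomogM.
    by move=> z /DAB[/pA|/qB] h; rewrite hevalM h ?mul0r ?mulr0.
  case/(Pprime _ _ (evB p) (evB q)) => h.
    by rewrite (Dvan _ _ pd h a Da) eqxx in pa.
  by rewrite (Dvan _ _ qe h b Db) eqxx in qb.
- apply: closed_of_separate => z nDz.
  have [Xz|nXz] := pselect (points X z); last first.
    have [d [p [pd pX pz]]] := closed_separate (pv_closed X) nXz.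
    by exists d, p; split=> // w [Xw _]; exact: (pX w Xw).
  apply: contrapT => no; apply: nDz; split=> // d p pd Pp; apply: contrapT => /eqP pz.
  by apply: no; exists d, p; split=> //; exact: (Dvan d p pd Pp).
- by move=> z [].
split.
- move=> f Pf; have /locpP[c [a [fa da _]]] := PB f Pf.
  have [d [hn hd _]] := fracP a.
  have van : vanishes_on D (num a).
    apply: (Dvan d) => //; rewrite -(coordinates_ratio a hy Ux) -fa mulrC.
    by apply: PM => //; exact: evB.
  apply: near_imp (near_form hd da) => z Xz dz Dz.
  by rewrite fa; have := has_value_ratio dz; rewrite van ?mul0r.
- move=> R Rirr RX DR f [/locpP fB Rf].
  have /locpP[c [a [fa da _]]] := fB; have [d [hn hd _]] := fracP a.
  have : P (ev y (num a) * ev y (den a)).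
    rewrite -rmorphM; apply: (null (d + d)%N); first exact: dhomogM.
    move=> z /DR Rz; rewrite hevalM; have [->|dz] := eqVneq (heval z (den a)) 0.
      by rewrite mulr0.
    have := Rf z _ Rz; rewrite fa => /(_ _ (has_value_ratio dz)) /eqP.
    by rewrite mulf_eq0 invr_eq0 (negbTE dz) orbF => /eqP ->; rewrite mul0r.
  case/(Pprime _ _ (evB _) (evB _)) => [Pn|/(prime_in_unit hP (den_unit a da))//].
  have [uB u0 uVB] := den_unit a da.
  have -> : f = (ev y (den a))^-1 * ev y (num a).
    by rewrite -(coordinates_ratio a hy Ux) fa mulrCA mulVf ?mulr1.
  exact: PM.
Qed.

(** The zero locus of [P] lies in [S], hence in one component [R]; a function vanishing on [R]
    vanishes on the locus and so belongs to [P]. This is how a prime is shown to contain one of the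
    [u j]. *)
Lemma prime_above_component x (P : set (ratfun X)) S : points X x ->
  prime_in (locp x) P -> zariski_closed S -> S `<=` points X ->
  (forall D, irreducible_set D -> zariski_closed D -> D `<=` points X -> D x ->
    (forall f, P f -> near x (fun z => D z -> maximal_ideal z f)) -> D `<=` S) ->
  exists R, [/\ irreducible_component S R, R x & local_ideal R x `<=` P].
Proof.
move=> Xx hP Scl SX hS; have [D [Dirr Dcl DX Dx [Dvan DR]]] := prime_locus Xx hP.
have [R hR sub] := component_above Dirr (hS D Dirr Dcl DX Dx Dvan) Scl.
have [_ Rirr RS _] := hR; exists R; split=> //; first exact: sub.
by apply: DR => // z /RS /SX.
Qed.

End StandardCharts.

(** * Differentials in local parameters *)

Section MatricesOverSubring.

Lemma det_in (R : comNzRingType) (B : subringClosed R) n (A : 'M[R]_n) : (forall i j, A i j \in B) -> \det A \in B.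
Proof.
move=> hA; rewrite /determinant rpred_sum // => s _.
by rewrite rpredM ?rpred_prod // rpredX // rpredN rpred1.
Qed.

Variables (L : fieldType) (B : subringClosed L).

Lemma adj_in n (A : 'M[L]_n) : (forall i j, A i j \in B) -> forall i j, \adj A i j \in B.
Proof.
move=> hA i j; rewrite mxE /cofactor rpredM ?det_in //.
  by rewrite rpredX // rpredN rpred1.
by move=> a b; rewrite !mxE.
Qed.

Lemma invmx_in n (A : 'M[L]_n) : (forall i j, A i j \in B) -> unit_in B (\det A) ->
  exists A' : 'M[L]_n, [/\ forall i j, A' i j \in B, A' *m A = 1%:M & A *m A' = 1%:M].
Proof.
move=> hA [dB d0 dVB]; exists ((\det A)^-1 *: \adj A); split.
- by move=> i j; rewrite mxE rpredM ?adj_in.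
- by rewrite -scalemxAl mul_adj_mx scale_scalar_mx mulVf.
- by rewrite -scalemxAr mul_mx_adj scale_scalar_mx mulVf.
Qed.

End MatricesOverSubring.

Section Derivations.
Variables (k L : fieldType) (c : {rmorphism k -> L}).

Lemma derivation_comb n (D : 'I_n -> L -> L) (v : 'I_n -> L) :
  (forall i, is_derivation c (D i)) ->
  is_derivation c (fun f => \sum_i v i * D i f).
Proof.
move=> hD; split=> [a b|a b|x].
- rewrite -big_split /=; apply: eq_bigr => i _; case: (hD i) => -> _ _.
  by rewrite mulrDr.
- rewrite !mulr_sumr -big_split /=; apply: eq_bigr => i _; case: (hD i) => _ -> _.
  by ring.
- by rewrite big1 // => i _; case: (hD i) => _ _ ->; rewrite mulr0.
Qed.

Lemma derivation_inv (E : L -> L) f : is_derivation c E -> f != 0 ->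
  E f^-1 = - (f^-1 ^+ 2) * E f.
Proof.
move=> [ED EM Ec] f0; have := EM f f^-1.
have -> : E (f * f^-1) = 0 by rewrite divff // -(rmorph1 c) Ec.
move=> /esym/eqP; rewrite addr_eq0 => /eqP h.
by rewrite -[LHS](mulKf f0) h expr2; ring.
Qed.

End Derivations.

Section LocalFrames.
Variables (k : closedFieldType) (X : proj_variety k).
Hypothesis hchar : [pchar k] =i pred0.
Implicit Types (f g : ratfun X) (x z : ambient_space X).
Local Notation cX := (ratfun_const X).
Local Notation ev y := (mmap (ratfun_const X) y).

Lemma ratfun_nat_neq0 m : m.+1%:R != 0 :> ratfun X.
Proof.
by rewrite -(rmorph_nat cX) fmorph_eq0 ((pcharf0P k).1 hchar m.+1).
Qed.

Lemma locp_nat x m : (m.+1%:R)^-1 \in locp x.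
Proof. by rewrite -(rmorph_nat cX) -fmorphV; exact: locp_const. Qed.

Lemma has_value_det n (A : 'M[ratfun X]_n) (a : 'M[k]_n) x :
  (forall i j, has_value (A i j) x (a i j)) -> has_value (\det A) x (\det a).
Proof.
move=> hA; rewrite /determinant; elim/big_rec2: _ => [|s p q _ hp]; first exact: has_value0.
apply: has_valueD => //; apply: has_valueM.
  have vX r : has_value ((-1 : ratfun X) ^+ r) x ((-1) ^+ r).
    elim: r => [|r IH]; first exact: has_value1.
    by rewrite !exprS; apply: has_valueM => //; exact: has_valueN (has_value1 x).
  exact: vX.
elim/big_rec2: _ => [|i r t _ h]; first exact: has_value1.
exact: has_valueM.
Qed.

Lemma det_unit n (A : 'M[ratfun X]_n) (a : 'M[k]_n) x : points X x ->
  (forall i j, has_value (A i j) x (a i j)) -> \det a != 0 -> unit_in (locp x) (\det A).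
Proof.
move=> Xx hA d0; have hd := has_value_det hA.
apply: locp_unit => //; first exact: has_value_locp hd.
by move=> /(maximal_idealE Xx hd) e; rewrite e eqxx in d0.
Qed.

Lemma fraction_of_local x f : points X x ->
  exists g h, [/\ g \in locp x, h \in locp x, h != 0 & f * h = g].
Proof.
move=> Xx; have [l [y [Ux hy hc]]] := standard_chart Xx.
have [a ea] := ratio_surj f; have [d [_ hd [z Xz dz]]] := fracP a.
have evB (H : {mpoly k[(ambient X).+1]}) : ev y H \in locp x.
  by apply: has_value_locp; apply: has_value_mmap => i; have [_] := hy x Ux; apply.
exists (ev y (num a)), (ev y (den a)); split=> //; last first.
  by rewrite ea (coordinates_ratio a hy Ux).
apply/eqP => e0.
have [w [Xw Uw dw]] := near_meet Xx Xz (open_near (standard_open_open l) Ux) (near_form hd dz).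
have := coordinates_form hy hd Uw; rewrite e0 => h.
have /eqP := has_value_unique Xw h (has_value0 w).
rewrite mulf_eq0 invr_eq0 expf_eq0 (negbTE dw) /=; case: Uw => _ /=.
by rewrite heval_form => /negbTE ->; rewrite andbF.
Qed.

(** One family [a] serving all derivations at once stands for the expansion of [df] in the
    [d (y i)]. Functions with such an expansion include constants and coordinates and are stable
    under sums, products and inverses of the units that occur. *)
Lemma differential_in_chart U m (y : 'I_m -> ratfun X) x f : chart U y -> U x ->
  f \in locp x -> exists2 a : 'I_m -> ratfun X, forall i, a i \in locp x &
    forall E, is_derivation cX E -> E f = \sum_i a i * E (y i).
Proof.
move=> hc Ux fB; pose good g := g \in locp x /\
  exists2 a : 'I_m -> ratfun X, forall i, a i \in locp x &
    forall E, is_derivation cX E -> E g = \sum_i a i * E (y i).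
have gC b : good (cX b).
  split; first exact: locp_const.
  exists (fun=> 0) => [i|E [_ _ Ec]]; first exact: rpred0.
  by rewrite Ec big1 // => i _; rewrite mul0r.
have gD g h : good g -> good h -> good (g + h).
  move=> [gB [a aB ha]] [hB [b bB hb]]; split; first exact: rpredD.
  exists (fun i => a i + b i) => [i|E hE]; first exact: rpredD.
  have [-> _ _] := hE; rewrite (ha E hE) (hb E hE) -big_split; apply: eq_bigr => i _.
  by rewrite mulrDl.
have gM g h : good g -> good h -> good (g * h).
  move=> [gB [a aB ha]] [hB [b bB hb]]; split; first exact: rpredM.
  exists (fun i => g * b i + h * a i) => [i|E hE]; first by rewrite rpredD ?rpredM.
  have [_ -> _] := hE; rewrite (ha E hE) (hb E hE) !mulr_sumr -big_split; apply: eq_bigr => i _ /=.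
  by ring.
have gy i : good (y i).
  split; first exact: (chart_regular hc).
  exists (fun j => (i == j)%:R) => [j|E hE]; first by case: eqP; rewrite ?rpred0 ?rpred1.
  rewrite (bigD1 i) //= eqxx mul1r big1 ?addr0 // => j /negbTE ji.
  by rewrite eq_sym ji mul0r.
have g0 : good 0 by rewrite -[0](rmorph0 cX); exact: gC.
have g1 : good 1 by rewrite -[1](rmorph1 cX); exact: gC.
have gX g r : good g -> good (g ^+ r).
  by move=> hg; elim: r => // r IH; rewrite exprS; exact: gM.
have gev H : good (ev y H).
  rewrite /mmap; elim/big_ind: _ => [|v w|b _]; [exact: g0|exact: gD|].
  apply: (gM); first exact: gC.
  rewrite /mmap1; elim/big_ind: _ => [|v w|i _]; [exact: g1|exact: gM|].
  by apply: gX.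
have [G [H [Hu e]]] := chart_fraction hc Ux fB.
have [HB H0 HVB] := Hu.
have gV : good (ev y H)^-1.
  split=> //; have [_ [a aB ha]] := gev H.
  exists (fun i => - ((ev y H)^-1 ^+ 2) * a i) => [i|E hE].
    by rewrite rpredM // rpredN rpredX.
  rewrite (derivation_inv hE) // (ha E hE) mulr_sumr; apply: eq_bigr => i _.
  by rewrite mulrA.
have -> : f = ev y G * (ev y H)^-1 by rewrite -e mulfK.
by have [] := gM _ _ (gev G) gV.
Qed.

Definition local_frame n x (u : 'I_n -> ratfun X) (D : 'I_n -> ratfun X -> ratfun X) : Prop :=
  [/\ frame cX u D, forall i, u i \in locp x & forall i f, f \in locp x -> D i f \in locp x].

Variable n : nat.
Hypothesis hX : smooth_of_dim X n.

Lemma local_parametersP x (t : 'I_n -> ratfun X) : local_parameters x t ->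
  (forall i, maximal_ideal x (t i)) /\
  forall f, maximal_ideal x f ->
    exists2 b : 'I_n -> ratfun X, forall i, b i \in locp x & f = \sum_i b i * t i.
Proof.
move=> ht; split=> [i|f]; rewrite ht.
  by apply: (ideal_span_gen (B := locp x)) => [a|]; [exact: local_ringE|exists i].
exact: (ideal_span_range (B := locp x) (@local_ringE _ _ x)).
Qed.

(* Nakayama's lemma: modulo the maximal ideal, the differentials of the
   coordinates of a chart are combinations of the [d (u i)]. *)
Lemma differential_in_parameters x (u : 'I_n -> ratfun X) f : points X x ->
  local_parameters x u -> f \in locp x ->
  exists2 a : 'I_n -> ratfun X, forall i, a i \in locp x &
    forall E, is_derivation cX E -> E f = \sum_i a i * E (u i).
Proof.
move=> Xx /local_parametersP[umax ugen] fB.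
have [l [y [Ux hy hc]]] := standard_chart Xx; set m := (ambient X).+1 in l y Ux hy hc *.
have yv i : has_value (y i) x (crd x i / crd x l) by have [_] := hy x Ux; apply.
have /choice[b hb] i : exists b : 'I_n -> ratfun X, (forall j, b j \in locp x) /\
    y i - cX (crd x i / crd x l) = \sum_j b j * u j.
  by have [b bB e] := ugen _ (sub_value_maximal (yv i)); exists b.
have /choice[a ha] (ij : 'I_m * 'I_n) : exists a : 'I_m -> ratfun X, (forall r, a r \in locp x) /\
    forall E, is_derivation cX E -> E (b ij.1 ij.2) = \sum_r a r * E (y r).
  have [a aB hE] := differential_in_chart hc Ux ((hb ij.1).1 ij.2); by exists a.
(* Differentiating the expansion of [y i] in the [u j], and expanding each [d (b i j)] in the
   [d (y r)] again, gives [(1 - M) dy = b du] with [M] in the maximal ideal, so [\det (1 - M)] has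
   value 1. *)
pose M : 'M[ratfun X]_m := \matrix_(i, r) \sum_j u j * a (i, j) r.
have Mmax i r : maximal_ideal x (M i r).
  rewrite mxE; apply: ideal_sum (maximal_ideal_ideal x) _ => j _; rewrite mulrC.
  by case: (maximal_ideal_ideal (X := X) x) => _ _ _ IM; apply: IM; [case: (ha (i, j))|exact: umax].
have vM i r : has_value ((1%:M - M) i r) x ((1%:M : 'M[k]_m) i r).
  have -> : (1%:M - M) i r = (i == r)%:R - M i r by rewrite !mxE.
  rewrite [X in has_value _ _ X]mxE -[X in has_value _ _ X]subr0; apply: has_valueB; last exact: (Mmax i r).
  by case: eqP => _; [exact: has_value1|exact: has_value0].
have du : unit_in (locp x) (\det (1%:M - M)) by apply: (det_unit Xx vM); rewrite det1 oner_neq0.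
have MB i j : (1%:M - M) i j \in locp x by exact: has_value_locp (vM i j).
have [A' [A'B A'M _]] := invmx_in MB du.
pose bm : 'M[ratfun X]_(m, n) := \matrix_(i, j) b i j.
have key E : is_derivation cX E -> forall i, E (y i) = \sum_j (A' *m bm) i j * E (u j).
  move=> hE i; pose Z : 'cV[ratfun X]_m := \col_r E (y r); pose W : 'cV[ratfun X]_n := \col_j E (u j).
  have [ED EM Ec] := hE.
  have eZ : (1%:M - M) *m Z = bm *m W.
    rewrite mulmxBl mul1mx; apply/colP => r; rewrite !mxE.
    have E0 : E 0 = 0 by rewrite -[X in E X](rmorph0 cX) Ec.
    have Esum (J : finType) (F : J -> ratfun X) : E (\sum_j F j) = \sum_j E (F j).
      by elim/big_rec2: _ => // j p q _ <-.
    have -> : E (y r) = E (y r - cX (crd x r / crd x l)).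
      by rewrite -[in LHS](subrK (cX (crd x r / crd x l)) (y r)) ED Ec addr0.
    rewrite (hb r).2 Esum; under eq_bigr do rewrite EM.
    rewrite big_split /=; apply/eqP; rewrite subr_eq; apply/eqP; congr (_ + _).
      by apply: eq_bigr => j _; rewrite !mxE.
    under eq_bigr do rewrite ((ha (r, _)).2 E hE).
    under [RHS]eq_bigr do rewrite !mxE mulr_suml.
    rewrite exchange_big; apply: eq_bigr => j _; rewrite mulr_sumr.
    by apply: eq_bigr => i' _; rewrite mulrA.
  have : Z = A' *m bm *m W by rewrite -mulmxA -eZ mulmxA A'M mul1mx.
  move=> /colP/(_ i); rewrite !mxE => ->.
  by apply: eq_bigr => j _; rewrite !mxE.
have [e eB he] := differential_in_chart hc Ux fB.
exists (fun j => \sum_i e i * (A' *m bm) i j).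
  move=> j; rewrite rpred_sum // => i _; rewrite rpredM // mxE rpred_sum // => r _.
  by rewrite rpredM // mxE; case: (hb r).
move=> E hE; rewrite (he E hE); under eq_bigr do rewrite (key E hE) mulr_sumr.
rewrite exchange_big; apply: eq_bigr => j _; rewrite mulr_suml.
by apply: eq_bigr => i _; rewrite mulrA.
Qed.

End LocalFrames.

Section SmoothPoints.
Variables (k : closedFieldType) (X : proj_variety k).
Hypothesis hchar : [pchar k] =i pred0.
Implicit Types (f g : ratfun X) (x z : ambient_space X).
Local Notation cX := (ratfun_const X).
Variable n : nat.
Hypothesis hX : smooth_of_dim X n.

Lemma smooth_basis : exists f : 'I_n -> ratfun X,
  alg_indep cX f /\ forall t : 'I_n.+1 -> ratfun X, ~ alg_indep cX t.
Proof. by case: hX => -[[f hf] hdep] _; exists f. Qed.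

Lemma derivation_local_eq0 x (E : ratfun X -> ratfun X) : points X x ->
  is_derivation cX E -> (forall f, f \in locp x -> E f = 0) -> forall f, E f = 0.
Proof.
move=> Xx hE hE0 f; have [g [h [gB hB h0 e]]] := fraction_of_local f Xx.
have [_ EM _] := hE; have := EM f h; rewrite e (hE0 g gB) (hE0 h hB) mulr0 add0r => /esym/eqP.
by rewrite mulf_eq0 (negbTE h0) => /eqP.
Qed.

(** The dual derivations of a transcendence basis are transformed by the inverse of the matrix of
    their values on [u]. A kernel vector of that matrix would give a nonzero derivation killing [u],
    hence the local ring and the field. The resulting [D i] preserve the local ring since [D i g] is
    a coefficient of [differential_in_parameters]. *)
Lemma frame_of_parameters x (u : 'I_n -> ratfun X) : points X x ->
  local_parameters x u -> exists D, local_frame x u D.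
Proof.
move=> Xx hu; have [f [hf hdep]] := smooth_basis.
have /choice[D0 D0P] i := dual_derivation (ratfun_nat_neq0 X hchar) i hf hdep.
have D0d i : is_derivation cX (D0 i) by case: (D0P i).
pose A := \matrix_(i, l) D0 i (u l).
have dA : \det A != 0.
  apply/negP => /det0P[v v0 vA]; case/eqP: v0; apply/rowP => j.
  pose E g := \sum_i v 0 i * D0 i g.
  have hE : is_derivation cX E by exact: derivation_comb.
  have Eu l : E (u l) = 0.
    by have /rowP/(_ l) := vA; rewrite !mxE => <-; apply: eq_bigr => i _; rewrite mxE.
  have E0 : forall g, E g = 0.
    apply: (derivation_local_eq0 Xx hE) => g gB.
    have [a aB ha] := differential_in_parameters Xx hu gB.
    by rewrite (ha E hE) big1 // => i _; rewrite Eu mulr0.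
  have := E0 (f j); rewrite /E (bigD1 j) //= (D0P j).2 eqxx mulr1 big1 ?addr0.
    by rewrite mxE.
  by move=> i ij; rewrite (D0P i).2 (negbTE ij) mulr0.
have Au : A \in unitmx by rewrite unitmxE unitfE.
pose D i g := \sum_l invmx A i l * D0 l g.
have Dd i : is_derivation cX (D i) by exact: derivation_comb.
have Du i j : D i (u j) = (i == j)%:R.
  have /matrixP/(_ i j) := mulVmx Au; rewrite !mxE => <-.
  by apply: eq_bigr => l _; rewrite [A l j]mxE.
exists D; split=> //.
  by move=> i; have [h _] := local_parametersP hu; exact: maximal_ideal_locp.
move=> i g gB; have [a aB ha] := differential_in_parameters Xx hu gB.
rewrite (ha _ (Dd i)) (bigD1 i) //= Du eqxx mulr1 big1 ?addr0 //.
by move=> j ji; rewrite Du eq_sym (negbTE ji) mulr0.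
Qed.

Lemma frame_expand (F : fieldType) (phi : {rmorphism ratfun X -> F}) (V : lmodType F)
    (E : ratfun X -> V) u D g :
  @frame k (ratfun X) cX n u D -> derivation_along cX phi E ->
  E g = \sum_i phi (D i g) *: E (u i).
Proof.
have [f [hf hdep]] := smooth_basis.
exact: (frame_chain (ratfun_nat_neq0 X hchar) hf hdep).
Qed.

Lemma frame_expand_self (E : ratfun X -> ratfun X) u D g :
  @frame k (ratfun X) cX n u D -> is_derivation cX E ->
  E g = \sum_i D i g * E (u i).
Proof.
move=> hu /is_derivation_along hE; exact: (frame_expand (V := (ratfun X)^o) g hu hE).
Qed.

Lemma transition_matrices u D u' D' : @frame k (ratfun X) cX n u D -> @frame k _ cX n u' D' ->
  (\matrix_(i, j) D' j (u i)) *m (\matrix_(i, j) D j (u' i)) = 1%:M.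
Proof.
move=> hu hu'; have [hD Du] := hu; apply/matrixP => i j; rewrite !mxE.
rewrite [(i == j)%:R]mulrb eq_sym -[LHS]/(\sum_r _) -mulrb -Du.
rewrite (frame_expand_self (u i) hu' (hD j)).
by apply: eq_bigr => r _; rewrite !mxE.
Qed.

Lemma frame_transition_unit x u D u' D' : points X x ->
  local_frame x u D -> @local_frame _ _ n x u' D' ->
  unit_in (locp x) (\det (\matrix_(i, j) D' j (u i))).
Proof.
move=> Xx [hu uB DB] [hu' u'B D'B].
have := congr1 determinant (transition_matrices hu hu'); rewrite det_mulmx det1.
set a := \det _; set b := \det _ => ab.
have aB : a \in locp x by apply: det_in => i j; rewrite mxE; exact: D'B.
have bB : b \in locp x by apply: det_in => i j; rewrite mxE; exact: DB.
have a0 : a != 0 by apply/eqP => a0; move/eqP: ab; rewrite a0 mul0r eq_sym oner_eq0.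
by split=> //; rewrite -[a^-1]mulr1 -ab mulKf.
Qed.

(** Members of a frame need not vanish at the point, which lets frames spread to nearby points;
    recentring recovers parameters. Expanded in known parameters [v], the recentred [u l] have a
    matrix congruent, modulo the maximal ideal, to the transition matrix [A], whose determinant is a
    unit. *)
Lemma parameters_of_frame x (u : 'I_n -> ratfun X) D (a : 'I_n -> k) : points X x ->
  local_frame x u D -> (forall i, has_value (u i) x (a i)) ->
  local_parameters x (fun i => u i - cX (a i)).
Proof.
move=> Xx hu ha; have [_ /(_ x Xx)[v hv]] := hX.
have [D' hv'] := frame_of_parameters Xx hv; have [vmax vgen] := local_parametersP hv.
have [[hD' D'v] vB D'B] := hv'.
have umax i : maximal_ideal x (u i - cX (a i)) by exact: sub_value_maximal.
have /choice[C hC] l : exists b : 'I_n -> ratfun X, (forall j, b j \in locp x) /\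
    u l - cX (a l) = \sum_j b j * v j.
  by have [b bB e] := vgen _ (umax l); exists b.
have mI := maximal_ideal_ideal (X := X) x; have [_ _ mD mM] := mI.
pose A := \matrix_(l, j) D' j (u l); pose Cm := \matrix_(l, j) C l j.
have CB l j : C l j \in locp x by case: (hC l).
have AC l j : maximal_ideal x (A l j - Cm l j).
  have [DD DM Dc] := hD' j; rewrite !mxE.
  have D0 : D' j 0 = 0 by rewrite -[X in D' j X](rmorph0 cX) Dc.
  have Dsum (J : finType) (F : J -> ratfun X) : D' j (\sum_r F r) = \sum_r D' j (F r).
    by elim/big_rec2: _ => // r p q _ <-.
  have -> : D' j (u l) = \sum_r (C l r * D' j (v r) + v r * D' j (C l r)).
    rewrite -[u l](subrK (cX (a l))) DD Dc addr0 (hC l).2 Dsum.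
    by apply: eq_bigr => r _; rewrite DM.
  rewrite big_split /= (bigD1 j) //= D'v eqxx mulr1 [X in _ + X + _ - _]big1 ?addr0; last first.
    by move=> r rj; rewrite D'v eq_sym (negbTE rj) mulr0.
  rewrite addrAC subrr add0r; apply: ideal_sum mI _ => r _; rewrite mulrC.
  by apply: mM => //; exact: D'B.
have /choice[av avP] (l : 'I_n) : exists w : 'I_n -> k, forall j, has_value (A l j) x (w j).
  have /choice[w hw] j : exists b, has_value (A l j) x b.
    by apply/locpP; rewrite mxE; apply: D'B; case: hu.
  by exists w.
have CmV l j : has_value (Cm l j) x ((\matrix_(l, j) av l j) l j).
  rewrite mxE; have := has_valueB (avP l j) (AC l j).
  by rewrite subr0 opprB addrCA subrr addr0.
have dA := frame_transition_unit Xx hu hv'.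
have dav : \det (\matrix_(l, j) av l j) != 0.
  have hd : has_value (\det A) x (\det (\matrix_(l, j) av l j)).
    by apply: has_value_det => l j; rewrite [X in has_value _ _ X]mxE.
  apply/eqP => d0; apply: (unit_notin_maximal Xx dA).
  by rewrite -/A /maximal_ideal /= -d0.
have dC := det_unit Xx CmV dav.
have CmB l j : Cm l j \in locp x by rewrite mxE.
have [C' [C'B C'C _]] := invmx_in CmB dC.
have RB := @local_ringE _ X x.
apply/seteqP; split; last first.
  by apply: (ideal_span_min RB mI) => _ [i _ <-].
move=> f /vgen[b bB ->].
have idS : ideal_in (locp x) (ideal_span (local_ring x) (range (fun i => u i - cX (a i)))).
  by apply: (ideal_span_ideal RB) => _ [i _ <-]; exact: maximal_ideal_locp (umax i).
apply: ideal_sum (idS) _ => i _; have [_ _ _ sM] := idS; apply: (sM) => //.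
have -> : v i = \sum_l C' i l * (u l - cX (a l)).
  pose V : 'cV[ratfun X]_n := \col_j v j.
  have : V = C' *m (Cm *m V) by rewrite mulmxA C'C mul1mx.
  move=> /colP/(_ i); rewrite !mxE => ->; apply: eq_bigr => l _; congr (_ * _).
  by rewrite (hC l).2 mxE; apply: eq_bigr => j _; rewrite !mxE.
apply: ideal_sum (idS) _ => l _; apply: (sM) => //.
by apply: (ideal_span_gen RB); exists l.
Qed.

(** Only finitely many functions have to stay regular: the [u i], and the [D i (y j)] for chart
    coordinates [y], of which every [D i f] is a combination. *)
Lemma near_local_frame x (u : 'I_n -> ratfun X) D : points X x -> local_frame x u D ->
  near x (fun z => local_frame z u D).
Proof.
move=> Xx [hu uB DB]; have [l [y [Ux hy hc]]] := standard_chart Xx.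
have nu : near x (fun z => forall i, u i \in locp z).
  by apply: near_forall => i; apply: near_locp.
have nD : near x (fun z => forall i j, D i (y j) \in locp z).
  apply: near_forall => i; apply: near_forall => j; apply: near_locp; apply: DB.
  exact: (chart_regular hc).
apply: near_imp (near_and (open_near (standard_open_open l) Ux) (near_and nu nD)).
move=> z Xz [Uz [uz Dz]]; split=> // i f fB.
have [a aB ha] := differential_in_chart hc Uz fB.
by rewrite (ha (D i) (hu.1 i)) rpred_sum // => j _; rewrite rpredM.
Qed.

End SmoothPoints.

(** * The pullback *)

Section Pullback.
Variables (k : closedFieldType) (X Y : proj_variety k).
Variable pi : ambient_space X -> ambient_space Y.
Hypotheses (pireg : regular_map (points X) (points Y) pi)
  (pisurj : forall y, points Y y -> exists2 x, points X x & pi x = y).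
Implicit Types (f : ratfun Y) (g : ratfun X).

Lemma set0_closed N : zariski_closed (@set0 (proj_space k N)).
Proof.
apply: closed_of_separate => x _; exists 0%N, 1; rewrite dhomog1; split=> //.
by rewrite heval1 oner_neq0.
Qed.

Lemma points_open : zariski_open_in (points X) (points X).
Proof. by exists set0; rewrite ?setD0 //; exact: set0_closed. Qed.

Lemma pi_points x : points X x -> points Y (pi x).
Proof. by case: pireg => h _; exact: h. Qed.

Lemma near_pullback x (P : ambient_space Y -> Prop) : points X x ->
  near (pi x) P -> near x (fun z => P (pi z)).
Proof.
move=> Xx [e [h [he hx hP]]].
have [d [F [Fd _ Fn]]] := regular_map_near points_open pireg Xx.
have [a a0 ha] := near_point Xx Fn.
have sx : heval x (subst F h) != 0.
  by apply: contraNneq hx => s0; rewrite (ha _ _ he) s0 mulr0.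
apply: near_imp (near_and Fn (near_form (dhomog_subst he Fd) sx)) => z Xz [[b b0 hb] sz].
by apply: hP; [exact: pi_points|rewrite (hb _ _ he) mulf_neq0 // expf_neq0].
Qed.

Lemma preimage_closed S : zariski_closed S -> zariski_closed (inverse_image pi S).
Proof.
move=> hS; apply: closed_of_near => [x []//|x Xx nS].
have nSx : ~ S (pi x) by move=> h; apply: nS.
apply: near_imp (near_pullback Xx (near_not_closed hS nSx)) => z Xz nz [_ Sz].
exact: nz.
Qed.

Lemma preimage_open V : zariski_open_in (points Y) V ->
  zariski_open_in (points X) (inverse_image pi V).
Proof.
move=> [Z hZ ->]; exists (inverse_image pi Z); first exact: preimage_closed.
apply/seteqP; split=> x [Xx].
  by move=> [_ nZ]; split=> // -[_ Zx].
by move=> nZ; split=> //; split; [exact: pi_points|move=> Zx; apply: nZ].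
Qed.

(** The [xget] in [pullback] has a witness: the composite of one fraction of [f] with [pi], which
    agrees with the composites of all the others. *)
Lemma pullback_spec f x c : points X x -> has_value f (pi x) c ->
  has_value (pullback pi f) x c.
Proof.
have [a fa] := ratio_surj f; have [d [na da [y0 Yy0 dy0]]] := fracP a.
have [x0 Xx0 ex0] := pisurj Yy0.
suff : exists g, [set g | forall x c, points X x -> has_value f (pi x) c -> has_value g x c] g.
  by move=> h; have := xgetPex 0 h => /= hx Xx fc; exact: hx.
rewrite -ex0 in dy0; have [g hg] := compose_ratio points_open pireg na da Xx0 dy0.
exists g => {}x {}c Xx [b [fb db ->]]; have [e [nb db' _]] := fracP b.
have [g' hg'] := compose_ratio points_open pireg nb db' Xx db.
have -> : g = g'; last exact: hg'.
apply: (near_eq2 Xx0 Xx (near_pullback Xx0 (near_form da dy0)) (near_pullback Xx (near_form db' db))).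
move=> w Xw da0 db0; eexists; split; first exact: (hg w Xw da0).
have := hg' w Xw db0; congr (has_value _ _ _).
have /ratioP/(_ (pi w) (pi_points Xw)) : ratio a = ratio b by rewrite -fa -fb.
by move=> e'; apply/eqP; rewrite eqr_div // e'.
Qed.

Lemma pullback_eq f g x : points X x ->
  near x (fun z => exists c, has_value f (pi z) c /\ has_value g z c) -> pullback pi f = g.
Proof.
move=> Xx h; apply: (near_eq Xx); apply: near_imp h => z Xz [c [fc gc]].
by exists c; split=> //; exact: pullback_spec.
Qed.

Lemma near_regular2 f f' : exists2 x, points X x &
  near x (fun z => exists c c', has_value f (pi z) c /\ has_value f' (pi z) c').
Proof.
have [a fa] := ratio_surj f; have [b fb] := ratio_surj f'.
have [d [_ hd [z Yz dz]]] := fracP a; have [e [_ he [w Yw dw]]] := fracP b.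
have [y [Yy ay by_]] := near_meet Yz Yw (near_form hd dz) (near_form he dw).
have [x Xx ex] := pisurj Yy; exists x => //; rewrite -ex in ay by_.
apply: near_imp (near_and (near_pullback Xx (near_form hd ay)) (near_pullback Xx (near_form he by_))).
move=> v Xv [av bv]; rewrite fa fb.
by do 2!eexists; split; exact: has_value_ratio.
Qed.

Lemma pullback_rmorphism : exists phi : {rmorphism ratfun Y -> ratfun X},
  forall f, phi f = pullback pi f.
Proof.
have hadd : additive (pullback pi).
  move=> f f'; have [x Xx hx] := near_regular2 f f'.
  apply: (pullback_eq Xx); apply: near_imp hx => z Xz [c [c' [h h']]].
  exists (c - c'); split; first exact: has_valueB.
  by apply: has_valueB; exact: pullback_spec.
have hmul : multiplicative (pullback pi).
  split=> [f f'|].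
    have [x Xx hx] := near_regular2 f f'.
    apply: (pullback_eq Xx); apply: near_imp hx => z Xz [c [c' [h h']]].
    exists (c * c'); split; first exact: has_valueM.
    by apply: has_valueM; exact: pullback_spec.
  have [[x Xx] _] := pv_irreducible X.
  apply: (pullback_eq Xx); apply: near_all => z Xz.
  by exists 1; split; exact: has_value1.
pose phi : {rmorphism ratfun Y -> ratfun X} :=
  HB.pack (pullback pi) (GRing.isAdditive.Build _ _ _ hadd)
    (GRing.isMultiplicative.Build _ _ _ hmul).
by exists phi.
Qed.

Lemma pullback_const a : pullback pi (ratfun_const Y a) = ratfun_const X a.
Proof.
have [[x Xx] _] := pv_irreducible X; apply: (pullback_eq Xx); apply: near_all => z Xz.
by exists a; split; exact: has_value_const.
Qed.

End Pullback.

(** * Finite morphisms *)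

Section RegularOn.
Variables (k : closedFieldType) (X : proj_variety k) (U : set (ambient_space X)).
Implicit Types (f g : ratfun X) (x : ambient_space X).

Definition regp : {pred (ratfun X)} := fun f => `[< regular_on U f >].

Lemma regpP f : reflect (forall x, U x -> f \in locp x) (f \in regp).
Proof. by apply: (iffP (asboolP _)) => h x /h => [/local_ringE|/local_ringE]. Qed.

Lemma regp_closed : subring_closed regp.
Proof.
split=> [|f g /regpP hf /regpP hg|f g /regpP hf /regpP hg]; apply/regpP => x Ux.
- exact: rpred1.
- by rewrite rpredB ?hf ?hg.
- by rewrite rpredM ?hf ?hg.
Qed.
HB.instance Definition _ :=
  GRing.isSubringClosed.Build (ratfun X) regp regp_closed.

Lemma regp_const a : ratfun_const X a \in regp.
Proof. by apply/regpP => x _; exact: locp_const. Qed.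

Lemma chart_regp m (y : 'I_m -> ratfun X) i : chart U y -> y i \in regp.
Proof. by move=> hc; apply/regpP => x Ux; exact: (chart_regular hc). Qed.

Lemma chart_ev_regp m (y : 'I_m -> ratfun X) H : chart U y ->
  mmap (ratfun_const X) y H \in regp.
Proof.
move=> hc; rewrite /mmap rpred_sum // => b _; rewrite rpredM ?regp_const //.
by rewrite /mmap1 rpred_prod // => i _; rewrite rpredX // chart_regp.
Qed.

Lemma maximal_unit_cancel x f g : unit_in (locp x) g -> maximal_ideal x (f * g) ->
  maximal_ideal x f.
Proof.
move=> [gB g0 gVB] h; have [_ _ _ mM] := maximal_ideal_ideal (X := X) x.
by rewrite -(mulfK g0 f) mulrC; exact: mM.
Qed.

(** A weak Nullstellensatz for regular functions: [chart_point] handles polynomials in the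
    coordinates, and [chart_fraction] carries the vanishing over to all of [J]. *)
Lemma chart_maximal m (y : 'I_m -> ratfun X) (J : set (ratfun X)) : chart U y ->
  ideal_in regp J -> ~ J 1 ->
  exists2 x, U x & forall f, J f -> maximal_ideal x f.
Proof.
move=> hc hJ J1.
have [||P [hP JP _]] := prime_avoiding (h := 1) hJ; first exact: rpred1.
  by move=> r; rewrite expr1n.
have [[PB P0 PD PM] P1 _] := hP.
have [x [Ux _ hx]] := chart_point (G := 1) hc hP regp_const (fun i => chart_regp i hc)
  (fun h => P1 (eq_ind _ P h _ (rmorph1 _))).
exists x => // f /JP Pf; have fB := PB f Pf.
have [G [H [Hu e]]] := chart_fraction hc Ux (elimT (regpP f) fB x Ux).
apply: (maximal_unit_cancel Hu); rewrite e; apply: hx; rewrite -e mulrC.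
by apply: PM => //; exact: chart_ev_regp.
Qed.

End RegularOn.

Section ImageRing.
Variables (K L : comNzRingType) (phi : {rmorphism K -> L}) (S : subringClosed K).

Definition image_ring : {pred L} := fun b => `[< exists2 a, a \in S & b = phi a >].

Lemma image_ringP b : reflect (exists2 a, a \in S & b = phi a) (b \in image_ring).
Proof. exact: asboolP. Qed.

Lemma image_ring_closed : subring_closed image_ring.
Proof.
split=> [|_ _ /image_ringP[a aS ->] /image_ringP[b bS ->]|_ _ /image_ringP[a aS ->] /image_ringP[b bS ->]]; apply/image_ringP.
- by exists 1; rewrite ?rpred1 ?rmorph1.
- by exists (a - b); rewrite ?rpredB ?rmorphB.
- by exists (a * b); rewrite ?rpredM ?rmorphM.
Qed.
HB.instance Definition _ := GRing.isSubringClosed.Build L image_ring image_ring_closed.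

Lemma mem_image_ring a : a \in S -> phi a \in image_ring.
Proof. by move=> aS; apply/image_ringP; exists a. Qed.
End ImageRing.

Section FiniteOver.
Variables (k : closedFieldType) (X Y : proj_variety k).
Variable pi : ambient_space X -> ambient_space Y.
Hypotheses (pireg : regular_map (points X) (points Y) pi)
  (pisurj : forall y, points Y y -> exists2 x, points X x & pi x = y).
Variable phi : {rmorphism ratfun Y -> ratfun X}.
Hypothesis phiE : forall f, phi f = pullback pi f.
Implicit Types (x : ambient_space X) (y : ambient_space Y).

Lemma phi_value f x c : points X x -> has_value f (pi x) c -> has_value (phi f) x c.
Proof. by move=> Xx h; rewrite phiE; exact: pullback_spec. Qed.

Lemma phi_locp f x : points X x -> f \in locp (pi x) -> phi f \in locp x.
Proof. by move=> Xx /locpP[c /(phi_value Xx)]; exact: has_value_locp. Qed.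

Lemma phi_const a : phi (ratfun_const Y a) = ratfun_const X a.
Proof. by rewrite phiE (pullback_const pireg pisurj). Qed.

Variable V : set (ambient_space Y).
Hypothesis hfin : finite_over pi V.
Local Notation U := (inverse_image pi V).

Lemma phi_regp f : f \in regp V -> phi f \in regp U.
Proof. by move=> /regpP h; apply/regpP => x [Xx Vx]; apply: phi_locp => //; exact: h. Qed.

Lemma finite_generators : exists m (g : 'I_m -> ratfun X), (forall i, g i \in regp U) /\
  forall f, f \in regp U -> exists2 a : 'I_m -> ratfun Y, forall i, a i \in regp V &
    f = \sum_i phi (a i) * g i.
Proof.
have [m [g [hg hf]]] := hfin; exists m, g; split=> [i|f /asboolP/hf[a [ha ->]]].
  exact/asboolP.
exists a => [i|]; first exact/asboolP.
by apply: eq_bigr => i _; rewrite phiE.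
Qed.

(** Multiplication by [b] on the generators [g] has a matrix over the image of [regp V], with [b] as
    eigenvalue and [g] as eigenvector, nonzero because 1 is a combination of the [g i]. The
    characteristic polynomial is the equation. *)
Lemma regp_integral b : b \in regp U ->
  exists q : {poly ratfun X}, [/\ q \is monic, q \is a polyOver (image_ring phi (regp V)) & root q b].
Proof.
move=> bB; have [m [g [gB hg]]] := finite_generators.
have /choice[a ha] i : exists a : 'I_m -> ratfun Y, (forall j, a j \in regp V) /\
    b * g i = \sum_j phi (a j) * g j.
  by have [a aB e] := hg (b * g i) (rpredM bB (gB i)); exists a.
pose M : 'M[ratfun X]_m := \matrix_(j, i) phi (a i j).
exists (char_poly M); split; first exact: char_poly_monic.
  suff h : \det (char_poly_mx M) \in polyOver_pred (image_ring phi (regp V)) by exact: h.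
  apply: det_in => j i; rewrite !mxE.
  suff h : 'X *+ (j == i) - (phi (a i j))%:P \is a polyOver (image_ring phi (regp V)) by exact: h.
  rewrite rpredB ?polyOverC ?mem_image_ring ?(ha i).1 //.
  by rewrite rpredMn // polyOverX.
rewrite -eigenvalue_root_char; apply/eigenvalueP.
exists (\row_j g j).
  apply/rowP => i; rewrite !mxE (ha i).2; apply: eq_bigr => j _.
  by rewrite !mxE mulrC.
apply/eqP => g0; have [c cB e] := hg 1 (rpred1 _).
move/eqP: e; rewrite big1 ?oner_eq0 // => i _.
by have /rowP/(_ i) := g0; rewrite !mxE => ->; rewrite mulr0.
Qed.

(* If the fibre over [y] misses [S], the functions vanishing on [S] and the
   maximal ideal of [y] generate the unit ideal of [regp U]; by the determinant
   trick some function on [V], equal to [1] at [y], vanishes on the image. *)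
Lemma finite_closed_image S y : zariski_open_in (points Y) V -> V y ->
  is_affine V -> is_affine U -> zariski_closed S -> S `<=` points X ->
  ~ (exists2 x, S x & pi x = y) -> near y (fun w => ~ (exists2 x, S x & pi x = w)).
Proof.
move=> Vopen Vy Vaff Uaff Scl SX nS.
have Yy : points Y y by exact: open_sub Vopen Vy.
have [x0 Xx0 ex0] := pisurj Yy.
have Ux0 : U x0 by split=> //; rewrite /= ex0.
have [mY [yY hcY]] := affine_chart Vopen Vy Vaff.
have [mX [yX hcX]] := affine_chart (preimage_open pireg Vopen) Ux0 Uaff.
have UX x : U x -> points X x by case.
pose IS : set (ratfun X) := [set f | f \in regp U /\ forall x, U x -> S x -> maximal_ideal x f].
have IS_ideal : ideal_in (regp U) IS.
  split=> [f []//||f g [fB hf] [gB hg]|f g fB [gB hg]].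
  - by split=> [|x _ _]; [exact: rpred0|exact: has_value0].
  - split=> [|x Ux Sx]; first exact: rpredD.
    by have [_ _ mD _] := maximal_ideal_ideal (X := X) x; apply: mD; [exact: hf|exact: hg].
  - split=> [|x Ux Sx]; first exact: rpredM.
    have [_ _ _ mM] := maximal_ideal_ideal (X := X) x; apply: mM; last exact: hg.
    exact: (elimT (regpP U f) fB).
pose mV h := h \in regp V /\ maximal_ideal y h.
have mV_sum (J : finType) (F : J -> ratfun Y) : (forall i, mV (F i)) -> mV (\sum_i F i).
  move=> hF; split; first by rewrite rpred_sum // => i _; case: (hF i).
  by apply: ideal_sum (maximal_ideal_ideal (X := Y) y) _ => i _; case: (hF i).
have mV_mul a h : a \in regp V -> mV h -> mV (a * h).
  move=> aB [hB hm]; split; first exact: rpredM.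
  have [_ _ _ mM] := maximal_ideal_ideal (X := Y) y; apply: mM => //.
  exact: (elimT (regpP V a) aB).
have mV_add g h : mV g -> mV h -> mV (g + h).
  move=> [gB hg] [hB hh]; split; first exact: rpredD.
  by have [_ _ mD _] := maximal_ideal_ideal (X := Y) y; exact: mD.
have RB' f : regular_on U f <-> f \in regp U by split=> h; [exact/asboolP|exact/asboolP].
pose J := ideal_span (regular_on U) (IS `|` (phi @` mV)).
have GB f : (IS `|` (phi @` mV)) f -> f \in regp U.
  by case=> [[]//|[h [hB _] <-]]; exact: phi_regp.
have hJ : ideal_in (regp U) J by exact: ideal_span_ideal.
(* A common zero of [J] would lie in [S] by [chart_closed] and over [y] by [chart_separates]. *)
have J1 : J 1.
  apply: contrapT => nJ1; have [x Ux hx] := chart_maximal hcX hJ nJ1.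
  apply: nS; exists x.
    apply: contrapT => nSx; have [H HS nH] := chart_closed hcX Scl Ux nSx.
    apply: nH; apply: hx; apply: (ideal_span_gen (B := regp U)) => //; left.
    by split=> //; exact: chart_ev_regp.
  have Vx : V (pi x) by case: Ux.
  apply: (chart_separates hcY Vx Vy) => i c hc.
  have /locpP[a ha] := chart_regular hcY i Vy.
  pose h := yY i - ratfun_const Y a.
  have hm : mV h.
    split; last exact: sub_value_maximal.
    by rewrite rpredB ?regp_const ?chart_regp.
  have : maximal_ideal x (phi h).
    by apply: hx; apply: (ideal_span_gen (B := regp U)) => //; right; exists h.
  have := phi_value (UX x Ux) (has_valueB hc (has_value_const (pi x) a)).
  move=> h1 /(maximal_idealE (UX x Ux) h1)/eqP; rewrite subr_eq0 => /eqP ->.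
  exact: ha.
have [m [g [gB hg]]] := finite_generators.
(* [N] is [IS] plus the combinations of the [g i] with coefficients vanishing at [y]. It contains
   [J], hence every [g i], which gives a matrix congruent to 1 at [y] that kills the generators
   modulo [IS]. *)
pose N := [set f | exists2 b : 'I_m -> ratfun Y, forall i, mV (b i) & IS (f - \sum_i phi (b i) * g i)].
have [ISB IS0 ISD ISM] := IS_ideal.
have N0 f : IS f -> N f.
  move=> hf; exists (fun=> 0) => [i|].
    by split; [exact: rpred0|exact: has_value0].
  by rewrite big1 ?subr0 // => i _; rewrite rmorph0 mul0r.
have ND f f' : N f -> N f' -> N (f + f').
  move=> [b bm hb] [b' bm' hb']; exists (fun i => b i + b' i) => [i|]; first exact: mV_add.
  have -> : f + f' - \sum_i phi (b i + b' i) * g i =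
    (f - \sum_i phi (b i) * g i) + (f' - \sum_i phi (b' i) * g i).
    under eq_bigr do rewrite rmorphD mulrDl; rewrite big_split /=; ring.
  exact: ISD.
have JN : J `<=` N.
  move=> _ [r [a [gg [aB hgg ->]]]]; elim/big_rec: _ => [|i f _ Nf]; first exact: N0.
  apply: ND => //; have {}aB : a i \in regp U by apply/RB'.
  have [hi|[h hm e]] := hgg i; first by apply: N0; exact: ISM.
  have [b bB eb] := hg (a i) aB.
  exists (fun j => b j * h) => [j|]; first exact: mV_mul.
  suff -> : a i *: gg i - \sum_j phi (b j * h) * g j = 0 by [].
  apply/eqP; rewrite subr_eq0; apply/eqP; rewrite -[LHS]/(a i * gg i) -e eb mulr_suml.
  by apply: eq_bigr => j _; rewrite rmorphM mulrAC.
have /choice[mu hmu] i : exists b : 'I_m -> ratfun Y, (forall j, mV (b j)) /\ IS (g i - \sum_j phi (b j) * g j).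
  have [|b bm hb] := JN (g i); last by exists b.
  by rewrite -[g i]mulr1; case: hJ => _ _ _; apply.
pose M : 'M[ratfun Y]_m := 1%:M - \matrix_(i, j) mu i j.
have MB i j : M i j \in regp V.
  rewrite !mxE rpredB //; first by rewrite rpredMn ?rpred1.
  by case: (hmu i) => /(_ j)[].
have MV i j : has_value (M i j) y ((1%:M : 'M[k]_m) i j).
  have -> : M i j = (i == j)%:R - mu i j by rewrite !mxE.
  rewrite mxE -[X in has_value _ _ X]subr0; apply: has_valueB.
    by case: eqP => _; [exact: has_value1|exact: has_value0].
  by case: (hmu i) => /(_ j)[].
have dV : \det M \in regp V by exact: det_in.
have dval : has_value (\det M) y 1 by rewrite -(det1 k m); exact: has_value_det.
have phi_det : IS (phi (\det M)).
  pose G : 'cV[ratfun X]_m := \col_i g i.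
  have MG i : IS ((map_mx phi M *m G) i 0).
    suff -> : (map_mx phi M *m G) i 0 = g i - \sum_j phi (mu i j) * g j by case: (hmu i).
    rewrite map_mxB map_mx1 mulmxBl mul1mx !mxE; congr (_ - _).
    by apply: eq_bigr => j _; rewrite !mxE.
  have dG i : IS (phi (\det M) * g i).
    have : \adj (map_mx phi M) *m (map_mx phi M *m G) = phi (\det M) *: G.
      by rewrite mulmxA mul_adj_mx det_map_mx mul_scalar_mx.
    move=> /colP/(_ i); rewrite !mxE => <-; apply: ideal_sum IS_ideal _ => j _.
    have := MG j; rewrite mxE => h; apply: ISM => //.
    by apply: adj_in => i' j'; rewrite mxE phi_regp.
  have [a aB e1] := hg 1 (rpred1 _).
  rewrite -[phi _]mulr1 e1 mulr_sumr; apply: ideal_sum IS_ideal _ => i _.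
  by rewrite mulrCA; apply: ISM => //; exact: phi_regp.
apply: near_imp (near_and (open_near Vopen Vy) (near_neq0 Yy dval (oner_neq0 k))).
move=> w Yw [Vw [c hc c0]] [x Sx ex]; have Xx := SX x Sx.
have Ux : U x by split=> //; rewrite /= ex.
have [_ /(_ x Ux Sx)] := phi_det; rewrite -ex in hc.
by move/(maximal_idealE Xx (phi_value Xx hc))/eqP; rewrite (negbTE c0).
Qed.

End FiniteOver.

(** * The ramification locus *)

Section Ramification.
Variables (k : closedFieldType) (hchar : [pchar k] =i pred0) (n : nat).
Variables (X Y : proj_variety k) (hX : smooth_of_dim X n) (hY : smooth_of_dim Y n).
Variable pi : ambient_space X -> ambient_space Y.
Hypothesis hpi : finite_covering pi.
Variable phi : {rmorphism ratfun Y -> ratfun X}.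
Hypothesis phiE : forall f, phi f = pullback pi f.
Implicit Types (x : ambient_space X) (y : ambient_space Y).
Local Notation cX := (ratfun_const X).
Local Notation cY := (ratfun_const Y).

Let pireg : regular_map (points X) (points Y) pi. Proof. by case: hpi. Qed.
Let pisurj : forall y, points Y y -> exists2 x, points X x & pi x = y.
Proof. by case: hpi. Qed.

Definition jacobian (D : 'I_n -> ratfun X -> ratfun X) (t : 'I_n -> ratfun Y) : 'M[ratfun X]_n :=
  \matrix_(i, j) D j (phi (t i)).

Lemma jacobian_in x u D t th : points X x ->
  local_frame x u D -> local_frame (pi x) t th -> forall i j, jacobian D t i j \in locp x.
Proof.
by move=> Xx [_ _ DB] [_ tB _] i j; rewrite mxE DB // (phi_locp pireg pisurj phiE).
Qed.

(** Unramified means that the recentred pullbacks of [t] generate the maximal ideal, hence are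
    parameters at [x]; the Jacobian is then a transition matrix between two frames. *)
Lemma unramified_jacobian x u D t th : points X x ->
  local_frame x u D -> local_frame (pi x) t th ->
  unramified_at pi x -> unit_in (locp x) (\det (jacobian D t)).
Proof.
move=> Xx hu ht unr; have Yy := pi_points pireg Xx.
have /choice[a ha] i : exists c, has_value (t i) (pi x) c by case: ht => _ tB _; apply/locpP.
have /local_parametersP[tmax tgen] := parameters_of_frame hchar hY Yy ht ha.
have RB := @local_ringE _ X x.
have pmax i : maximal_ideal x (phi (t i) - cX (a i)).
  by apply: sub_value_maximal; apply: (phi_value pireg pisurj phiE).
have hpar : local_parameters x (fun i => phi (t i) - cX (a i)).
  apply/seteqP; split; last first.
    by apply: (ideal_span_min RB (maximal_ideal_ideal (X := X) x)) => _ [i _ <-].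
  have idS : ideal_in (locp x) (ideal_span (local_ring x) (range (fun i => phi (t i) - cX (a i)))).
    by apply: (ideal_span_ideal RB) => _ [i _ <-]; exact: maximal_ideal_locp (pmax i).
  rewrite unr; apply: (ideal_span_min RB idS) => _ [f /tgen[b bB ->] <-].
  rewrite -phiE rmorph_sum.
  apply: ideal_sum (idS) _ => i _; rewrite rmorphM rmorphB (phi_const pireg pisurj phiE).
  have [_ _ _ sM] := idS; apply: sM; first exact: (phi_locp pireg pisurj phiE).
  by apply: (ideal_span_gen RB); exists i.
have [D' hD'] := frame_of_parameters hchar hX Xx hpar.
have := frame_transition_unit hchar hX Xx hD' hu; congr (unit_in _ (\det _)).
apply/matrixP => i j; rewrite !mxE; have [[hD _] _ _] := hu.
have [DD _ Dc] := hD j.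
by have := DD (phi (t i) - cX (a i)) (cX (a i)); rewrite subrK Dc addr0.
Qed.

(** The columns of the inverse Jacobian combine the [D j] into derivations dual to the [phi (t i)],
    which are therefore parameters at [x] once recentred. *)
Lemma jacobian_unramified x u D t th : points X x ->
  local_frame x u D -> local_frame (pi x) t th ->
  unit_in (locp x) (\det (jacobian D t)) -> unramified_at pi x.
Proof.
move=> Xx hu ht dJ; have Yy := pi_points pireg Xx.
have [J' [J'B J'J JJ']] := invmx_in (jacobian_in Xx hu ht) dJ.
have [[hD Du] uB DB] := hu; have [_ tB _] := ht.
pose D' i g := \sum_j J' j i * D j g.
have hD' : local_frame x (fun i => phi (t i)) D'.
  split; first split.
  - by move=> i; exact: derivation_comb.
  - move=> i l; have /matrixP/(_ l i) := JJ'; rewrite !mxE eq_sym => <-.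
    by apply: eq_bigr => j _; rewrite !mxE mulrC.
  - by move=> i; apply: (phi_locp pireg pisurj phiE).
  - by move=> i f fB; rewrite rpred_sum // => j _; rewrite rpredM ?DB.
have /choice[a ha] i : exists c, has_value (t i) (pi x) c by apply/locpP.
have hp i : has_value (phi (t i)) x (a i) by exact: (phi_value pireg pisurj phiE).
have := parameters_of_frame hchar hX Xx hD' hp.
have RB := @local_ringE _ X x; have mI := maximal_ideal_ideal (X := X) x.
have pb f : (pullback pi @` maximal_ideal (pi x)) f -> maximal_ideal x f.
  by move=> [h hm <-]; rewrite -phiE; exact: (phi_value pireg pisurj phiE).
move=> hpar; apply/seteqP; split; last exact: (ideal_span_min RB mI).
rewrite hpar; apply: (ideal_span_min RB).
  by apply: (ideal_span_ideal RB) => f /pb; exact: maximal_ideal_locp.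
move=> _ [i _ <-]; apply: (ideal_span_gen RB); exists (t i - cY (a i)).
  exact: sub_value_maximal.
by rewrite -phiE rmorphB (phi_const pireg pisurj phiE).
Qed.

Lemma exists_local_frame x : points X x -> exists u D, @local_frame _ X n x u D.
Proof.
move=> Xx; have [_ /(_ x Xx)[u hu]] := hX.
by have [D hD] := frame_of_parameters hchar hX Xx hu; exists u, D.
Qed.

Lemma exists_local_frameY y : points Y y -> exists t th, @local_frame _ Y n y t th.
Proof.
move=> Yy; have [_ /(_ y Yy)[u hu]] := hY.
by have [D hD] := frame_of_parameters hchar hY Yy hu; exists u, D.
Qed.

Definition ramified : set (ambient_space X) := [set x | points X x /\ ~ unramified_at pi x].

Lemma ramified_closed : zariski_closed ramified.
Proof.
apply: closed_of_near => [x []//|x Xx nr].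
have unr : unramified_at pi x by apply: contrapT => h; apply: nr.
have [u [D hu]] := exists_local_frame Xx.
have [t [th ht]] := exists_local_frameY (pi_points pireg Xx).
have dJ := unramified_jacobian Xx hu ht unr.
apply: near_imp (near_and (near_local_frame Xx hu) (near_and
  (near_pullback pireg Xx (near_local_frame (pi_points pireg Xx) ht)) (near_unit Xx dJ))).
move=> z Xz [hu' [ht' dJ']] [_ nz]; apply: nz.
exact: jacobian_unramified hu' ht' dJ'.
Qed.

Lemma branch_locusE y : branch_locus pi y <-> exists2 x, ramified x & pi x = y.
Proof. by split=> [[x [Xx e nr]]|[x [Xx nr] e]]; exists x. Qed.

Lemma branch_locus_closed : zariski_closed (branch_locus pi).
Proof.
apply: closed_of_near => [y [x [Xx <- _]]|y Yy nB]; first exact: pi_points.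
have [_ _ /(_ y Yy)[V [Vy Vopen Vaff Uaff Vfin]]] := hpi.
have := finite_closed_image pireg pisurj phiE Vfin Vopen Vy Vaff Uaff ramified_closed.
move=> h; apply: near_imp (h _ _) => [z Yz nz /branch_locusE//|x []//|].
by move/branch_locusE.
Qed.

Lemma ramification_closed : zariski_closed (inverse_image pi (branch_locus pi)).
Proof. exact: preimage_closed branch_locus_closed. Qed.

(** A kernel vector would give a derivation [E] killing the image of [phi]. That image contains a
    transcendence basis of the function field of [X], as both dimensions are [n], so [E = 0] in
    characteristic 0, while its values on [u] are the entries of the vector. *)
Lemma jacobian_neq0 x u D t th : points X x ->
  local_frame x u D -> local_frame (pi x) t th -> \det (jacobian D t) != 0.
Proof.
move=> Xx [[hD Du] _ _] [ht _ _]; rewrite -det_tr; apply/negP => /det0P[v v0 vJ].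
case/eqP: v0; apply/rowP => j; pose E g := \sum_j v 0 j * D j g.
have hE : is_derivation cX E by exact: derivation_comb.
have Et i : E (phi (t i)) = 0.
  have /rowP/(_ i) := vJ; rewrite !mxE => <-.
  by apply: eq_bigr => l _; rewrite !mxE.
have hEphi : derivation_along cY phi (E \o phi : ratfun Y -> (ratfun X)^o).
  have [ED EM Ec] := hE; split=> [a b|a b|a] /=.
  - by rewrite rmorphD ED.
  - by rewrite rmorphM EM.
  - by rewrite (phi_const pireg pisurj phiE) Ec.
have Ephi g : E (phi g) = 0.
  rewrite -[LHS]/((E \o phi : ratfun Y -> (ratfun X)^o) g).
  rewrite (frame_expand hchar hY g ht hEphi) big1 // => i _ /=.
  by rewrite Et scaler0.
have [f [hf _]] := smooth_basis hY; have [_ [_ hdep]] := smooth_basis hX.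
have hpf : alg_indep cX (fun i => phi (f i)).
  move=> p p0; apply: hf; apply: (fmorph_inj phi); rewrite rmorph0 -p0 /mmap rmorph_sum.
  apply: eq_bigr => b _; rewrite rmorphM (phi_const pireg pisurj phiE) /mmap1 rmorph_prod.
  by congr (_ * _); apply: eq_bigr => i _; rewrite rmorphXn.
have := derivation_along_eq0 (ratfun_nat_neq0 X hchar) hpf hdep (is_derivation_along hE) (fun i => Ephi (f i)).
move=> /(_ (u j)); rewrite mxE /E (bigD1 j) //= Du eqxx mulr1 big1 ?addr0 //.
by move=> l lj; rewrite Du (negbTE lj) mulr0.
Qed.

End Ramification.

(** * Logarithmic forms *)

Lemma scaler_mulVK (L : fieldType) (V : lmodType L) (a b : L) (v : V) :
  a != 0 -> (a * b) *: (a^-1 *: v) = b *: v.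
Proof. by move=> a0; rewrite scalerA mulrAC mulfV ?mul1r. Qed.

Lemma regular_scaleV (L : fieldType) (a b : L) : a != 0 -> a^-1 *: (a * b : L^o) = b.
Proof. by move=> a0; exact: mulKf a0 b. Qed.

Lemma regular_scale1 (L : fieldType) (a : L) : a *: (1 : L^o) = a.
Proof. exact: mulr1. Qed.

Lemma logarithmic_quotient (L : fieldType) (a b x y m : L) :
  a != 0 -> b != 0 -> (a * b)^-1 * (m * (a * x + b * y)) = b^-1 * m * x + a^-1 * (m * y).
Proof. by move=> a0 b0; field; rewrite a0 b0. Qed.

Lemma scaler_logarithmic (L : fieldType) (V : lmodType L) (a b : L) (v w : V) :
  a != 0 -> b != 0 -> (a * b)^-1 *: (a *: (b *: v) + b *: w) = a^-1 *: w + v.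
Proof.
move=> a0 b0; rewrite scalerDr !scalerA mulVf ?mulf_neq0 // scale1r addrC.
by rewrite invfM divfK.
Qed.

Section Spans.
Variables (L : fieldType) (V : lmodType L) (B : subringClosed L) (R : set L).
Hypothesis RB : forall a, R a <-> a \in B.
Implicit Type G : set V.

Lemma span_gen G g : G g -> span R G g.
Proof.
move=> Gg; exists 1%N, (fun=> 1), (fun=> g); rewrite big_ord1 scale1r.
by split=> // _; apply/RB; rewrite rpred1.
Qed.

Lemma span_add G v w : span R G v -> span R G w -> span R G (v + w).
Proof.
move=> [m [a [g [aR Gg ->]]]] [m' [a' [g' [a'R Gg' ->]]]].
exists (m + m')%N, (fun i => match split i with inl j => a j | inr j => a' j end),
  (fun i => match split i with inl j => g j | inr j => g' j end).
split=> [i|i|]; try by case: split.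
rewrite big_split_ord /=; congr (_ + _); apply: eq_bigr => i _.
  by rewrite (unsplitK (inl i)).
by rewrite (unsplitK (inr i)).
Qed.

Lemma span_0 G : span R G 0.
Proof. by exists 0%N, (fun=> 0), (fun=> 0); split=> [[]|[]|] //; rewrite big_ord0. Qed.

Lemma span_scale G b v : b \in B -> span R G v -> span R G (b *: v).
Proof.
move=> bB [m [a [g [aR Gg ->]]]]; exists m, (fun i => b * a i), g.
split=> // [i|]; first by apply/RB; apply: rpredM => //; exact/RB.
by rewrite scaler_sumr; apply: eq_bigr => i _; rewrite scalerA.
Qed.

Lemma span_sum G J (r : seq J) F : (forall i, span R G (F i)) -> span R G (\sum_(i <- r) F i).
Proof.
by move=> hF; elim/big_rec: _ => [|i v _]; [exact: span_0|exact: span_add].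
Qed.

Lemma span_lincomb G n (e : 'I_n -> V) :
  (forall g, G g -> exists2 b : 'I_n -> L, forall i, b i \in B & g = \sum_i b i *: e i) ->
  forall v, span R G v -> exists2 b : 'I_n -> L, forall i, b i \in B & v = \sum_i b i *: e i.
Proof.
move=> hG _ [m [a [g [aR Gg ->]]]]; elim/big_rec: _ => [|i v _ [b bB ->]].
  by exists (fun=> 0) => [i|]; rewrite ?rpred0 // big1 // => i _; rewrite scale0r.
have [c cB ->] := hG _ (Gg i); have {}aR : a i \in B by apply/RB.
exists (fun j => a i * c j + b j) => [j|]; first by rewrite rpredD ?rpredM.
rewrite scaler_sumr -big_split; apply: eq_bigr => j _ /=.
by rewrite scalerDl scalerA.
Qed.

Lemma additive_on_sum (A : zmodType) (N : set V) (h : V -> A) J (r : seq J) F :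
  N 0 -> (forall v w, N v -> N w -> N (v + w)) ->
  (forall v w, N v -> N w -> h (v + w) = h v + h w) ->
  (forall i, N (F i)) -> h (\sum_(i <- r) F i) = \sum_(i <- r) h (F i).
Proof.
move=> N0 ND hD NF.
suff [] : N (\sum_(i <- r) F i) /\ h (\sum_(i <- r) F i) = \sum_(i <- r) h (F i) by [].
elim/big_rec2: _ => [|i v w _ [Nw <-]].
  by split=> //; apply: (addrI (h 0)); rewrite -hD ?addr0.
by split; [exact: ND|rewrite hD].
Qed.

End Spans.

Section LogarithmicForms.
Variables (k : closedFieldType) (hchar : [pchar k] =i pred0) (n : nat).
Variables (X Y : proj_variety k) (hX : smooth_of_dim X n) (hY : smooth_of_dim Y n).
Variable pi : ambient_space X -> ambient_space Y.
Hypothesis hpi : finite_covering pi.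
Variable phi : {rmorphism ratfun Y -> ratfun X}.
Hypothesis phiE : forall f, phi f = pullback pi f.
Local Notation cX := (ratfun_const X).
Local Notation cY := (ratfun_const Y).
Local Notation Br := (branch_locus pi).
Local Notation Rm := (inverse_image pi (branch_locus pi)).

Let pireg : regular_map (points X) (points Y) pi. Proof. by case: hpi. Qed.
Let pisurj : forall y, points Y y -> exists2 x, points X x & pi x = y.
Proof. by case: hpi. Qed.
Let phiv x f c := phi_value pireg pisurj phiE (x := x) (f := f) (c := c).

Variable x : ambient_space X.
Hypothesis Xx : points X x.
Local Notation y := (pi x).
Local Notation A := (locp y).
Local Notation B := (locp x).
Let Yy : points Y y := pi_points pireg Xx.

Variables (u : 'I_n -> ratfun X) (D : 'I_n -> ratfun X -> ratfun X).
Variables (t : 'I_n -> ratfun Y) (th : 'I_n -> ratfun Y -> ratfun Y).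
Hypotheses (hu : local_frame x u D) (ht : local_frame y t th).
Hypotheses (upar : local_parameters x u) (tpar : local_parameters y t).
Hypothesis uR : forall R, ramification_divisors pi R -> R x -> exists j, local_equation R x (u j).
Hypothesis tB : forall E, branch_divisors pi E -> E y -> exists i, local_equation E y (t i).

Definition log_index (Z : proj_variety k) (Delta : set (set (ambient_space Z)))
    (z : ambient_space Z) (v : 'I_n -> ratfun Z) : pred 'I_n :=
  fun j => `[< exists E, [/\ Delta E, E z & local_equation E z (v j)] >].

Local Notation IX := (log_index (ramification_divisors pi) x u).
Local Notation IY := (log_index (branch_divisors pi) y t).

Let RmX : Rm `<=` points X. Proof. by move=> z []. Qed.
Let BrY : Br `<=` points Y. Proof. by move=> z [w [Xw <- _]]; exact: pi_points. Qed.

Lemma frame_member_neq0 (Z : proj_variety k) z (v : 'I_n -> ratfun Z) E j :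
  local_frame z v E -> v j != 0.
Proof.
move=> [[hE Ev] _ _]; apply/eqP => v0; have := Ev j j; rewrite v0 eqxx.
have [_ _ Ec] := hE j; rewrite -[X in E j X](rmorph0 (ratfun_const Z)) Ec.
by move/esym/eqP; rewrite oner_eq0.
Qed.

Let u0 j : u j != 0. Proof. exact: frame_member_neq0 hu. Qed.
Let t0 i : t i != 0. Proof. exact: frame_member_neq0 ht. Qed.
Let uB j : u j \in B. Proof. by case: hu. Qed.
Let umax j : maximal_ideal x (u j). Proof. by case: (local_parametersP upar). Qed.

Let uprime j : IX j -> prime_in B (multiples B (u j)).
Proof.
move=> /asboolP[R [[_ Rirr RS _] Rx eqR]]; rewrite -(local_equationE eqR).
by apply: local_ideal_prime => // z /RS /RmX.
Qed.

(** If [u j = u i * b], applying [D j] gives [1 = u i * D j b], which is in the maximal ideal. *)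
Let udist i j : IX i -> IX j -> i != j -> ~ multiples B (u i) (u j).
Proof.
move=> _ _ ij [b bB e]; have [[hD Du] _ DB] := hu.
have [_ DM _] := hD j; have := Du j j; rewrite eqxx e DM Du [j == i]eq_sym (negbTE ij) mulr0 addr0.
move=> e1; have : maximal_ideal x 1.
  have [_ _ _ mM] := maximal_ideal_ideal (X := X) x.
  by rewrite -[1]e1 mulrC; apply: mM => //; exact: DB.
by move=> h; have /eqP := has_value_unique Xx h (has_value1 x); rewrite eq_sym oner_eq0.
Qed.

Let component_support (P : set (ratfun X)) : prime_in B P ->
  (forall E, irreducible_set E -> zariski_closed E -> E `<=` points X -> E x ->
    (forall f, P f -> near x (fun z => E z -> maximal_ideal z f)) -> E `<=` Rm) ->
  exists2 j, IX j & P (u j).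
Proof.
move=> hP hE; have [R [hR Rx RP]] := prime_above_component Xx hP
  (ramification_closed hchar hX hY hpi phiE) RmX hE.
have [j ej] := uR hR Rx; exists j; first by apply/asboolP; exists R.
by apply: RP; rewrite (local_equationE ej); exists 1; rewrite ?rpred1 ?mulr1.
Qed.

(** On the zero locus of [P] the determinant vanishes near [x], where both frames are still frames,
    so the locus is ramified there; irreducibility extends this to all of it. *)
Lemma jacobian_support P : prime_in B P -> P (\det (jacobian phi D t)) ->
  exists2 j, IX j & P (u j).
Proof.
move=> hP Pd; apply: component_support => // E Eirr Ecl EX Ex hE.
suff sub : E `<=` ramified pi by move=> z /sub[Xz nz]; split=> //; exists z.
apply: (irreducible_near Eirr EX Ex (ramified_closed hchar hX hY hpi phiE)).
apply: near_imp (near_and (near_local_frame Xx hu) (near_and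
  (near_pullback pireg Xx (near_local_frame Yy ht)) (hE _ Pd))).
move=> z Xz [hu' [ht' hd]] Ez; split=> // unr.
have dJ := unramified_jacobian hchar hX hY hpi phiE Xz hu' ht' unr.
exact: (unit_notin_maximal Xz dJ (hd Ez)).
Qed.

(** [t i] is an equation of the branch divisor only near [pi x], while the whole zero locus [E] of
    [P] must map into the divisor. So each form [F] vanishing on the divisor is tested separately:
    near [pi x] it is a multiple of [t i], its pullback is in [P], and vanishing near [x] spreads
    over [E]. *)
Lemma branch_equation_support P i : IY i -> prime_in B P -> P (phi (t i)) ->
  exists2 j, IX j & P (u j).
Proof.
move=> /asboolP[Bi [[Bcl Birr BS _] By eqB]] hP Pt.
have [[PB P0 PD PM] P1 _] := hP.
apply: component_support => // E Eirr Ecl EX Ex hE.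
suff sub : E `<=` inverse_image pi Bi by move=> z /sub[Xz /BS].
move=> w Ew; split; first exact: EX.
apply: contrapT => /(closed_separate Bcl)[d [F [Fd FB Fw]]].
have [l yl] := crd_neq0 y.
have Xl := dhomogMn d (dhomog_var k l).
rewrite mul1n in Xl.
have hl : heval y ('X_l ^+ d) != 0.
  by rewrite /heval rmorphXn /= -/(heval y _) heval_form expf_neq0.
have hfr : frac_pair (F, 'X_l ^+ d).
  by apply/asboolP; split; [exists d|exists y].
pose f : ratfun Y := ratio (mk_frac hfr).
have fv z : heval z ('X_l ^+ d) != 0 -> has_value f z (heval z F / heval z ('X_l ^+ d)).
  by move=> hz; exact: (@has_value_ratio _ _ (mk_frac hfr)).
have : local_ideal Bi y f.
  apply/(local_idealP Birr (fun z Bz => BrY (BS z Bz)) By).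
  split; first exact: has_value_locp (fv y hl).
  apply: near_imp (near_form Xl hl) => z Yz hz Bz.
  by have := fv z hz; rewrite FB // mul0r.
rewrite (local_equationE eqB) => -[b bA ef].
have Pf : P (phi f).
  rewrite ef rmorphM mulrC; apply: PM => //.
  exact: (phi_locp pireg pisurj phiE).
suff sub : E `<=` inverse_image pi [set z | heval z F = 0].
  by have [_ /= F0] := sub w Ew; rewrite F0 eqxx in Fw.
apply: (irreducible_near Eirr EX Ex (preimage_closed pireg (closed_hypersurface Fd))).
apply: near_imp (near_and (near_pullback pireg Xx (near_form Xl hl)) (hE _ Pf)).
move=> z Xz [hz hm] Ez; split=> //=.
have /eqP := (maximal_idealE Xz (phiv Xz (fv _ hz))).1 (hm Ez).
by rewrite mulf_eq0 invr_eq0 (negbTE hz) orbF => /eqP.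
Qed.

Let JB i j : jacobian phi D t i j \in B.
Proof. exact: (jacobian_in hpi phiE Xx hu ht). Qed.
Let J0 : \det (jacobian phi D t) != 0.
Proof. exact: (jacobian_neq0 hchar hX hY hpi phiE Xx hu ht). Qed.

Lemma branch_equation_factor i : IY i -> exists e s,
  [/\ unit_in B e, all IX s & phi (t i) = e * \prod_(j <- s) u j].
Proof.
move=> Ii; apply: (factor_prime_support uB u0 uprime).
  by apply: (phi_locp pireg pisurj phiE) => //; case: ht.
by move=> P hP Pt; exact: branch_equation_support Pt.
Qed.

(** The closure of the image of [R] is irreducible and in the branch locus, hence in a branch
    divisor, which passes through [pi x]. *)
Lemma ramification_over_branch j : IX j -> exists2 i, IY i & multiples B (u j) (phi (t i)).
Proof.
move=> /asboolP[R [[Rcl Rirr RS _] Rx eqR]].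
have RX z : R z -> points X z by move=> /RS /RmX.
have imirr : irreducible_set (pi @` R).
  split; first by exists y, x.
  move=> E1 E2 h1 h2 cov; have [_ irr] := Rirr.
  have [|h|h] := irr _ _ (preimage_closed pireg h1) (preimage_closed pireg h2).
  - move=> z Rz; have [|h|h] := cov (pi z); first by exists z.
      by left; split=> //; exact: RX.
    by right; split=> //; exact: RX.
  - by left=> _ [z Rz <-]; case: (h z Rz).
  - by right=> _ [z Rz <-]; case: (h z Rz).
have Brcl := branch_locus_closed hchar hX hY hpi phiE.
have [|Bi hBi sub] := component_above (closure_irreducible imirr) _ Brcl.
  by apply: closure_min => // _ [z Rz <-]; case: (RS z Rz).
have piR z : R z -> Bi (pi z) by move=> Rz; apply: sub; apply: sub_closure; exists z.
have [i ei] := tB hBi (piR x Rx).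
exists i; first by apply/asboolP; exists Bi; split=> //; exact: piR.
rewrite -(local_equationE eqR); have [_ tA _] := ht.
apply/(local_idealP Rirr RX Rx); split; first exact: (phi_locp pireg pisurj phiE).
apply: near_imp (near_pullback pireg Xx (near_locp (tA i))) => z Xz /locpP[c hc] Rz.
have : local_ideal Bi y (t i) by rewrite (local_equationE ei); exists 1; rewrite ?rpred1 ?mulr1.
by move=> [_ /(_ _ c (piR z Rz) hc) c0]; rewrite c0 in hc; exact: phiv.
Qed.

(* [mu i = t i] along a branch divisor and [1] otherwise: the forms
   [dt i / mu i] are a basis of the logarithmic forms on [Y], dual to the
   logarithmic derivations [mu i * th i], which [lift_log] extends to [X]. *)
Definition mu i : ratfun Y := if IY i then t i else 1.
Definition lift i (g : ratfun X) : ratfun X :=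
  \sum_j invmx (jacobian phi D t) j i * D j g.
Definition lift_log i (g : ratfun X) : ratfun X := phi (mu i) * lift i g.

Let mu0 i : mu i != 0. Proof. by rewrite /mu; case: ifP; rewrite ?oner_neq0. Qed.
Let muA i : mu i \in A. Proof. by rewrite /mu; case: ifP => _; [case: ht|exact: rpred1]. Qed.

Let lift_der i : is_derivation cX (lift i).
Proof. by have [[hD _] _ _] := hu; exact: derivation_comb. Qed.

Let lift_log_der i : is_derivation cX (lift_log i).
Proof.
have [h1 h2 h3] := lift_der i.
by split=> [a b|a b|a]; rewrite /lift_log ?h1 ?h2 ?h3; ring.
Qed.

Let lift_t i l : lift i (phi (t l)) = (i == l)%:R.
Proof.
have Ju : jacobian phi D t \in unitmx by rewrite unitmxE unitfE.
have /matrixP/(_ l i) := mulmxV Ju; rewrite !mxE eq_sym => <-.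
by apply: eq_bigr => j _; rewrite [jacobian _ _ _ l j]mxE mulrC.
Qed.

Let lift_frame : @frame k (ratfun X) cX n (fun i => phi (t i)) lift.
Proof. by split; [exact: lift_der|exact: lift_t]. Qed.

(** Both sides are derivations along [phi] with the same values on [t]; thus [lift i] extends
    [th i]. *)
Let lift_phi i f : lift i (phi f) = phi (th i f).
Proof.
have [ED EM Ec] := lift_der i; have [ht' _ _] := ht.
have hE : derivation_along cY phi (lift i \o phi : ratfun Y -> (ratfun X)^o).
  split=> [a b|a b|a] /=; first by rewrite rmorphD ED.
    by rewrite rmorphM EM.
  by rewrite (phi_const pireg pisurj phiE) Ec.
rewrite -[LHS]/((lift i \o phi : ratfun Y -> (ratfun X)^o) f).
rewrite (frame_expand hchar hY f ht' hE) (bigD1 i) //= lift_t eqxx.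
rewrite big1 => [|l li]; last by rewrite lift_t eq_sym (negbTE li) scaler0.
by rewrite addr0; exact: mulr1.
Qed.

Let det_lift i b : b \in B -> \det (jacobian phi D t) * lift i b \in B.
Proof.
move=> bB; rewrite mulr_sumr rpred_sum // => j _.
have -> : \det (jacobian phi D t) * (invmx (jacobian phi D t) j i * D j b) =
   \adj (jacobian phi D t) j i * D j b.
  rewrite /invmx unitmxE unitfE J0 mxE mulrA; congr (_ * _).
  by rewrite mulrA divff // mul1r.
by have [_ _ DB] := hu; apply: rpredM; [exact: adj_in|exact: DB].
Qed.

Lemma lift_log_local i : (forall b, b \in B -> lift_log i b \in B) /\
  (forall j, IX j -> multiples B (u j) (lift_log i (u j))).
Proof.
have [_ _ /(_ y Yy)[V [Vy Vopen Vaff Uaff Vfin]]] := hpi.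
have Ux : inverse_image pi V x by split.
have [m [yX hc]] := affine_chart (preimage_open pireg Vopen) Ux Uaff.
have [e [s [[eB e0 eVB] sI ed]]] := factor_prime_support uB u0 uprime
  (det_in JB) jacobian_support.
have sB r : \prod_(j <- r) u j \in B by rewrite rpred_prod.
have gT b : b \in B -> (\prod_(j <- s) u j) * lift_log i b \in B.
  move=> bB; have -> : \prod_(j <- s) u j = e^-1 * \det (jacobian phi D t).
    by rewrite ed mulKf.
  have -> : e^-1 * \det (jacobian phi D t) * lift_log i b =
    e^-1 * phi (mu i) * (\det (jacobian phi D t) * lift i b) by rewrite /lift_log; ring.
  by rewrite rpredM ?det_lift // rpredM // (phi_locp pireg pisurj phiE Xx (muA i)).
(* The product over [s] clears the poles of [lift_log i]. The further product over [r] contains each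
   [u j] of a ramification divisor, which makes the condition on the ideals [u j B] hold at the
   start of the descent. *)
pose r := [seq j <- enum 'I_n | IX j].
have rI : all IX r by rewrite /r filter_all.
have regB f : f \in regp (inverse_image pi V) -> f \in B by move=> /regpP; apply.
have A0B f : f \in image_ring phi (regp V) -> f \in B.
  move=> /image_ringP[h hB ->]; apply: (phi_locp pireg pisurj phiE) => //.
  by move/regpP: hB; apply.
have frac b : b \in B -> exists a a', [/\ a \in regp (inverse_image pi V),
    a' \in regp (inverse_image pi V), unit_in B a' & b * a' = a].
  move=> bB; have [G [H [Hu eH]]] := chart_fraction hc Ux bB.
  by exists (mmap cX yX G), (mmap cX yX H); split=> //; exact: chart_ev_regp.
have TA0 f : f \in image_ring phi (regp V) -> lift_log i f \in B.
  move=> /image_ringP[h /regpP hB ->]; rewrite /lift_log lift_phi.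
  have [_ _ tA] := ht.
  by rewrite rpredM // (phi_locp pireg pisurj phiE) // tA // hB.
have Tlog j : IX j -> exists t' m' v b, [/\ t' = u j ^+ m'.+1 * v, v \in B,
    ~ multiples B (u j) v, b \in B & lift_log i t' = t' * b].
  (* Here it matters that the derivation is logarithmic: [lift_log i] multiplies [phi (t l)] by 1 if
     [l = i] and by 0 otherwise. Exponent 0 is excluded because [u j] divides [phi (t l)]. *)
  move=> Ij; have [l Il tl] := ramification_over_branch Ij.
  have [e' [s' [he' hs' es']]] := branch_equation_factor Il.
  have [[|m'] [v [vB nv ev]]] := factor_at uB uprime udist Ij hs' he'.
    by case: nv; rewrite -[v]mul1r -[1](expr0 (u j)) -ev -es'.
  exists (phi (t l)), m', v, (i == l)%:R; split=> //; first by rewrite es' ev.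
    by case: eqP; rewrite ?rpred1 ?rpred0.
  rewrite /lift_log lift_t; have [ei|_] := eqVneq i l; last by rewrite !mulr0.
  by rewrite ei /mu Il.
apply: (log_derivation_descends (ratfun_nat_neq0 X hchar) (locp_nat x) A0B regB
  frac (@regp_integral _ _ _ pi phi phiE V Vfin) (lift_log_der i) TA0 uB u0 uprime udist Tlog
  (s := s ++ r)).
- by rewrite all_cat sI.
- move=> b bB; rewrite big_cat /=.
  have -> : \prod_(j <- s) u j * \prod_(j <- r) u j * lift_log i b =
    \prod_(j <- r) u j * (\prod_(j <- s) u j * lift_log i b) by ring.
  by rewrite rpredM ?gT.
- move=> j Ij; rewrite big_cat /=.
  have -> : \prod_(l <- r) u l = u j * \prod_(l | IX l && (l != j)) u l.
    by rewrite /r big_filter big_enum_cond (bigD1 j).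
  exists (\prod_(l | IX l && (l != j)) u l * ((\prod_(l <- s) u l) * lift_log i (u j))).
    by rewrite rpredM ?gT // rpred_prod.
  by ring.
Qed.

Section Forms.
Variables (OmegaX : lmodType (ratfun X)) (dX : ratfun X -> OmegaX).
Variables (OmegaY : lmodType (ratfun Y)) (dY : ratfun Y -> OmegaY).
Hypotheses (hOmegaX : rational_forms dX) (hOmegaY : rational_forms dY).
Variable p : OmegaY -> OmegaX.
Hypothesis hp : forms_pullback pi dX dY p.
Local Notation N := (log_forms dX (ramification_divisors pi) x).
Local Notation M := (log_forms dY (branch_divisors pi) y).

Definition log_form i : OmegaY := (mu i)^-1 *: dY (t i).
Definition log_form_pullback i : OmegaX := (phi (mu i))^-1 *: dX (phi (t i)).
Local Notation om := log_form.
Local Notation e := log_form_pullback.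

Let dXder : derivation dX. Proof. by case: hOmegaX. Qed.
Let dYder : derivation dY. Proof. by case: hOmegaY. Qed.
Let RBX := @local_ringE _ X x.
Let RBY := @local_ringE _ Y y.

Lemma dX_expand f : dX f = \sum_i lift_log i f *: e i.
Proof.
have hd : derivation_along cX idfun dX by exact: dXder.
rewrite (frame_expand hchar hX f lift_frame hd); apply: eq_bigr => i _ /=.
by apply/esym/scaler_mulVK; rewrite fmorph_eq0 mu0.
Qed.

Lemma dY_expand f : dY f = \sum_i (mu i * th i f) *: om i.
Proof.
have hd : derivation_along cY idfun dY by exact: dYder.
have [ht' _ _] := ht.
rewrite (frame_expand hchar hY f ht' hd); apply: eq_bigr => i _ /=.
exact/esym/scaler_mulVK/mu0.
Qed.

Lemma p_comb (r : 'I_n -> ratfun Y) : p (\sum_i r i *: om i) = \sum_i phi (r i) *: e i.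
Proof.
have [pD pd] := hp.
have p0 : p 0 = 0 by apply: (addrI (p 0)); rewrite -pD !addr0.
elim/big_rec2: _ => // i v w _ <-; rewrite pD; congr (_ + _).
by rewrite scalerA pd -!phiE rmorphM fmorphV scalerA.
Qed.

(** The containment that rests on [lift_log_local]: the coordinates of [dz / z] are
    [lift_log i z / z], which are in [B] because [z] is a unit times [u j] and [lift_log i]
    preserves [u j B]. *)
Lemma log_formsX_comb w : N w -> exists2 b : 'I_n -> ratfun X, forall i, b i \in B & w = \sum_i b i *: e i.
Proof.
apply: (span_lincomb RBX) => _ [[f /RBX fB <-]|[R [z [hR Rx ez ->]]]].
  exists (fun i => lift_log i f); last exact: dX_expand.
  by move=> i; have [h _] := lift_log_local i; exact: h.
have [j ej] := uR hR Rx; have Ij : IX j by apply/asboolP; exists R.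
exists (fun i => z^-1 * lift_log i z); last first.
  by rewrite dX_expand scaler_sumr; apply: eq_bigr => i _; rewrite scalerA.
move=> i; have [h1 h2] := lift_log_local i.
have /(_ (u j)) : local_ideal R x `<=` multiples B z by rewrite (local_equationE ez).
rewrite (local_equationE ej) => /(_ _)[|a aB ua]; first by exists 1; rewrite ?rpred1 ?mulr1.
have : multiples B (u j) z.
  by rewrite -(local_equationE ej) (local_equationE ez); exists 1; rewrite ?rpred1 ?mulr1.
move=> [b bB zb]; have [c cB Tu] := h2 j Ij.
have ab : b * a = 1.
  by apply: (mulfI (u0 j)); rewrite mulr1 mulrA -zb -ua.
have b0 : b != 0 by apply/eqP => b0; move/eqP: ab; rewrite b0 mul0r eq_sym oner_eq0.
have Vb : b^-1 = a by rewrite -[LHS]mulr1 -ab mulKf.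
have [_ TM _] := lift_log_der i.
rewrite zb TM Tu -[X in _ * X]mul1r (logarithmic_quotient _ _ _ (u0 j) b0) Vb mulr1 mul1r.
by rewrite (mulKf (u0 j)); apply: rpredD => //; apply: rpredM => //; exact: h1.
Qed.

(** Along a branch divisor [phi (t i)] is a unit times a product of the [u j] of ramification
    divisors, so its logarithmic differential is a sum of multiples of generators. *)
Lemma log_form_pullback_in i : N (e i).
Proof.
have tiB : phi (t i) \in B by apply: (phi_locp pireg pisurj phiE) => //; case: ht.
have dN f : f \in B -> N (dX f).
  by move=> fB; apply: (span_gen RBX); left; exists f => //; exact/RBX.
rewrite /log_form_pullback /mu; case: ifP => [Ii|_]; last first.
  by rewrite rmorph1 invr1 scale1r; exact: dN.
have [a [s [[aB a0 aVB] sI ta]]] := branch_equation_factor Ii.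
have [dD dM dc] := dXder.
have -> : (phi (t i))^-1 *: dX (phi (t i)) =
    a^-1 *: dX a + \sum_(j <- s | IX j) (u j)^-1 *: dX (u j).
  rewrite ta; have pr r : all IX r -> dX (\prod_(j <- r) u j) =
     (\prod_(j <- r) u j) *: \sum_(j <- r | IX j) (u j)^-1 *: dX (u j).
    elim: r => [_|j r IH /= /andP[Ij /IH{}IH]].
      by rewrite !big_nil scaler0 -(rmorph1 cX) dc.
    by rewrite !big_cons Ij dM IH scalerDr (scaler_mulVK _ _ (u0 j)) scalerA addrC.
  have pr0 : \prod_(j <- s) u j != 0 by rewrite prodf_seq_neq0; apply/allP => j _; rewrite u0.
  by rewrite dM (pr s sI) (scaler_logarithmic _ _ a0 pr0).
apply: (span_add (v := a^-1 *: dX a)); first by apply: (span_scale RBX) => //; exact: dN.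
elim/big_rec: _ => [|j v Ij]; first exact: span_0.
apply: span_add; apply: (span_gen RBX); right; move/asboolP: Ij => [R [h1 h2 h3]].
by exists R, (u j).
Qed.

Lemma log_formsX_sum (b : 'I_n -> ratfun X) : (forall i, b i \in B) -> N (\sum_i b i *: e i).
Proof. by move=> bB; apply: span_sum => i; apply: (span_scale RBX) => //; exact: log_form_pullback_in. Qed.

Lemma log_formsY_comb w : M w -> exists2 r : 'I_n -> ratfun Y, forall i, r i \in A & w = \sum_i r i *: om i.
Proof.
have [[hth tht] tA thA] := ht.
apply: (span_lincomb RBY) => _ [[f /RBY fB <-]|[E [z [hE Ey ez ->]]]].
  exists (fun i => mu i * th i f); last exact: dY_expand.
  by move=> i; rewrite rpredM ?thA.
have [l el] := tB hE Ey; have Il : IY l by apply/asboolP; exists E.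
exists (fun i => z^-1 * (mu i * th i z)); last first.
  by rewrite dY_expand scaler_sumr; apply: eq_bigr => i _; rewrite scalerA.
move=> i; have : multiples A z (t l).
  by rewrite -(local_equationE ez) (local_equationE el); exists 1; rewrite ?rpred1 ?mulr1.
have : multiples A (t l) z.
  by rewrite -(local_equationE el) (local_equationE ez); exists 1; rewrite ?rpred1 ?mulr1.
move=> [b bA zb] [a aA ta].
have ab : b * a = 1 by apply: (mulfI (t0 l)); rewrite mulr1 mulrA -zb -ta.
have b0 : b != 0 by apply/eqP => b0; move/eqP: ab; rewrite b0 mul0r eq_sym oner_eq0.
have Vb : b^-1 = a by rewrite -[LHS]mulr1 -ab mulKf.
have [_ TM _] := hth i; have tl0 := t0 l.
have thbA : a * mu i * th i b \in A.
  by apply: rpredM; [apply: rpredM|exact: thA].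
rewrite zb TM tht (logarithmic_quotient _ _ _ tl0 b0) Vb; apply: rpredD => //.
have [il|_] := eqVneq i l; last by rewrite !mulr0 rpred0.
by rewrite il /mu Il mulr1 mulVf // rpred1.
Qed.

Lemma log_form_in i : M (om i).
Proof.
rewrite /log_form /mu; case: ifP => [/asboolP[E [hE Ey eE]]|_]; apply: (span_gen RBY).
  by right; exists E, (t i).
by left; exists (t i); [apply/RBY; case: ht|rewrite invr1 scale1r].
Qed.

(** The universal property of [dX] turns the derivations [lift_log i] into linear forms dual to the
    [e i], which makes the [e i] independent. *)
Lemma log_form_coordinates : exists h : 'I_n -> {linear OmegaX -> (ratfun X)^o},
  forall (b : 'I_n -> ratfun X) i, h i (\sum_l b l *: e l) = b i.
Proof.
have /choice[h hh] i : exists h : {linear OmegaX -> (ratfun X)^o}, forall f, h (dX f) = lift_log i f.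
  have hd : derivation (lift_log i : ratfun X -> (ratfun X)^o) by exact: lift_log_der.
  by have [_ /(_ _ _ hd)[h [h1 _]]] := hOmegaX; exists h.
have he i l : h i (e l) = (i == l)%:R.
  rewrite linearZ /= hh /lift_log lift_t.
  have [->|_] := eqVneq i l; last by rewrite mulr0 scaler0.
  by apply: regular_scaleV; rewrite fmorph_eq0 mu0.
exists h => b i; rewrite linear_sum (bigD1 i) //= linearZ /= he eqxx regular_scale1.
by rewrite big1 ?addr0 // => l li; rewrite linearZ /= he eq_sym (negbTE li) scaler0.
Qed.

Lemma log_forms_base_change : base_change_iso (local_ring y) (local_ring x) phi M N p.
Proof.
have [h hh] := log_form_coordinates.
have [pD _] := hp.
have ap a r : a *: p (\sum_i r i *: om i) = \sum_i (a * phi (r i)) *: e i.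
  by rewrite p_comb scaler_sumr; apply: eq_bigr => i _; rewrite scalerA.
have phiB f : f \in A -> phi f \in B by exact: (phi_locp pireg pisurj phiE).
have MD v w : M v -> M w -> M (v + w) by exact: span_add.
have ND v w : N v -> N w -> N (v + w) by exact: span_add.
split.
- move=> a m /RBX aB /log_formsY_comb[r rA ->]; rewrite ap.
  by apply: log_formsX_sum => i; rewrite rpredM ?phiB.
- split=> [a b m _ _ _|a m m' _ _ _|a r m _ _ /log_formsY_comb[s sA ->]].
  + by rewrite scalerDl.
  + by rewrite pD scalerDr.
  + rewrite ap scaler_sumr.
    under [in RHS]eq_bigr do rewrite scalerA.
    rewrite ap; apply: eq_bigr => i _; by rewrite rmorphM mulrA.
- move=> Z beta [bDl bDr bM]; split.
    (* Both modules are free, on the [om i] and on the [e i = p (om i)], so the factorization has to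
       send [b i *: e i] to [beta (b i) (om i)]. *)
    exists (fun w => \sum_i beta (h i w) (om i)); split.
      move=> w w' /log_formsX_comb[b bB ->] /log_formsX_comb[b' b'B ->].
      cbv beta; rewrite -[RHS]big_split /=; apply: eq_bigr => i _; rewrite linearD !hh.
      by apply: bDl; [exact/RBX|exact/RBX|exact: log_form_in].
    move=> a m aS /log_formsY_comb[r rA ->]; cbv beta; rewrite ap.
    have -> : \sum_i beta (h i (\sum_l (a * phi (r l)) *: e l)) (om i) =
      \sum_i beta (a * phi (r i)) (om i) by apply: eq_bigr => i _; rewrite hh.
    rewrite (@additive_on_sum _ _ Z M (beta a)) //; last 2 first.
    + by move=> v w; exact: bDr.
    + by move=> i; apply: (span_scale RBY) => //; exact: log_form_in.
    + by apply: eq_bigr => i _; apply: bM => //; [exact/RBY|exact: log_form_in].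
    + exact: span_0.
  move=> g g' [gD gb] [gD' gb'] w /log_formsX_comb[b bB ->].
  have Nb i : N (b i *: e i) by apply: (span_scale RBX) => //; exact: log_form_pullback_in.
  rewrite (@additive_on_sum _ _ Z N g) ?(@additive_on_sum _ _ Z N g') //; try exact: span_0.
  apply: eq_bigr => i _.
  have -> : e i = p (om i).
    by rewrite -[om i]scale1r; have [_ pd] := hp; rewrite /log_form scalerA mul1r pd -!phiE fmorphV.
  by rewrite gb ?gb' //; [exact/RBX|exact: log_form_in|exact/RBX|exact: log_form_in].
Qed.

End Forms.
End LogarithmicForms.

Local Close Scope classical_set_scope.
Unset Implicit Arguments.

Theorem theorem2p18 (k : closedFieldType) (hchar : [pchar k] =i pred0)
  (n : nat) (X Y : proj_variety k)
  (hX : smooth_of_dim X n) (hY : smooth_of_dim Y n)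
  (pi : ambient_space X -> ambient_space Y)
  (hpi : finite_covering pi)
  (hB : snc n (branch_divisors pi))
  (hR : snc n (ramification_divisors pi))
  (OmegaX : lmodType (ratfun X)) (dX : ratfun X -> OmegaX)
  (hOmegaX : rational_forms dX)
  (OmegaY : lmodType (ratfun Y)) (dY : ratfun Y -> OmegaY)
  (hOmegaY : rational_forms dY)
  (p : OmegaY -> OmegaX) (hp : forms_pullback pi dX dY p) :
  forall x, points X x ->
    base_change_iso (local_ring (pi x)) (local_ring x) (pullback pi)
      (log_forms dY (branch_divisors pi) (pi x))
      (log_forms dX (ramification_divisors pi) x) p.
Proof.
move=> x Xx; have [pireg pisurj _] := hpi.
have [phi phiE] := pullback_rmorphism pireg pisurj.
have [u [upar uR]] := hR x Xx; have [t [tpar tB]] := hB (pi x) (pi_points pireg Xx).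
have [D hu] := frame_of_parameters hchar hX Xx upar.
have [th ht] := frame_of_parameters hchar hY (pi_points pireg Xx) tpar.
have <- : phi = pullback pi :> (_ -> _) by apply/funext.
exact: (log_forms_base_change hchar hX hY hpi phiE Xx hu ht upar uR tB hOmegaX hOmegaY hp).
Qed.
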